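(* Let $d\ge 1$, $\mu>0$, $\beta>0$, $t_\iota\in\mathbb{R}$, and let $U\colon[t_\iota,\infty)\times\mathbb{R}^d\to\mathbb{R}_+$, $(t,q)\mapsto U_t(q)$, be a sufficiently regular and confining time-dependent potential (in the sense of the standing assumptions in the context). Let $\mathtt{p}_t(q)$ be the solution, for $t\ge t_\iota$ and $q\in\mathbb{R}^d$, of the Fokker-Planck equation $$\partial_t \mathtt{p}_t(q)-\mu\,\big\langle \partial_q,\ (\partial U_t)(q)\,\mathtt{p}_t(q)\big\rangle-\frac{\mu}{\beta}\,\partial_q^2\,\mathtt{p}_t(q)=0$$ with initial datum a probability density $\mathtt{p}_{t_\iota}$ at time $t_\iota$. Then for every $t\ge t_\iota$ and $q\in\mathbb{R}^d$, $$\mathtt{p}_t(q)=\mathrm{E}_{\mathcal{Q}}\!\left(\mathtt{p}_{t_\iota}(\mathscr{q}_{t_\iota})\,\exp\Big(-\frac{\beta}{2}\int_{t_\iota}^t\Big(\big\langle d\mathscr{q}_s,(\partial U_s)(\mathscr{q}_s)\big\rangle+\frac{\mu}{2}\,\big\|(\partial U_s)(\mathscr{q}_s)\big\|^2ds\Big)\Big)\ \Big|\ \mathscr{q}_t=q\right),$$ where $\mathcal{Q}$ is the path measure of the driftless backward process $d^\flat \mathscr{q}_s=\sqrt{2\mu/\beta}\,dw_s$, and the stochastic integral is in the pre-point discretization.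
   Context: Notation: $\partial U_t$ is the gradient of $U_t$ in the space variable, $\langle\partial_q,\cdot\rangle$ is the divergence, $\partial_q^2$ is the Laplacian, and $\langle\cdot,\cdot\rangle$, $\|\cdot\|$ are the Euclidean inner product and norm. Process under $\mathcal{Q}$: $w$ is a standard $d$-dimensional Wiener process. Conditioned on $\mathscr{q}_t=q$, the process is run backward in time: $$\mathscr{q}_s=q-\sqrt{\frac{2\mu}{\beta}}\,(w_t-w_s),\qquad s\in[t_\iota,t].$$ Pre-point stochastic integral: over partitions $t_\iota=s_0<s_1<\dots<s_N=t$ with mesh tending to $0$, $$\int_{t_\iota}^t\langle d\mathscr{q}_s,(\partial U_s)(\mathscr{q}_s)\rangle=\lim\sum_{i=0}^{N-1}\big\langle \mathscr{q}_{s_{i+1}}-\mathscr{q}_{s_i},\ (\partial U_{s_i})(\mathscr{q}_{s_i})\big\rangle ,$$ i.e. the integrand is evaluated at the earlier time of each subinterval (limit in probability). Standing assumptions: $U$ is sufficiently regular and confining. This is understood to guarantee that the Fokker-Planck equation has a (sufficiently regular) solution fully specified by its initial datum and integrable over $\mathbb{R}^d$; that the backward diffusion $d^\flat\mathscr{q}_s=\mu(\partial U_s)(\mathscr{q}_s)ds+\sqrt{2\mu/\beta}\,dw_s$ (i.e. $\mathscr{q}_s=q-\int_s^t\mu(\partial U_r)(\mathscr{q}_r)dr-\sqrt{2\mu/\beta}(w_t-w_s)$, adapted to the backward filtration generated by the increments $w_t-w_r$, $s\le r\le t$) is well posed, with path measure $\mathcal{P}^\flat$ absolutely continuous with respect to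 $\mathcal{Q}$ with Radon-Nikodym derivative given by Girsanov's formula; and the integrability needed for $s\mapsto e^{\beta\int_s^t\partial_rU_r(\mathscr{q}_r)dr}\,e^{\beta U_s(\mathscr{q}_s)}\,\mathtt{p}_s(\mathscr{q}_s)$ to be a true martingale under $\mathcal{P}^\flat$ with respect to the backward filtration. *)

(* Defs.v *)
From HB Require Import structures.
From mathcomp Require Import all_boot all_order all_algebra.
From mathcomp Require Import all_classical all_reals all_analysis.
Import Order.TTheory GRing.Theory Num.Theory.
Import numFieldNormedType.Exports.

Set Implicit Arguments.
Unset Strict Implicit.
Unset Printing Implicit Defensive.

Local Open Scope classical_set_scope.
Local Open Scope ring_scope.

(* Vector calculus on R^d = 'rV[R]_d. The library norm on 'rV[R]_d is the sup
   norm, so the Euclidean structure is spelled out. *)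
Section Calculus.
Context {R : realType} {d : nat}.
Implicit Types (f : 'rV[R]_d -> R) (F : 'rV[R]_d -> 'rV[R]_d) (x y : 'rV[R]_d).

Definition dotv x y : R := \sum_(i < d) x 0 i * y 0 i.

Definition enorm x : R := Num.sqrt (dotv x x).

Definition partial (i : 'I_d) f x : R := 'D_(delta_mx 0 i) f x.

Definition grad f x : 'rV[R]_d := \row_i partial i f x.

Definition divergence F x : R := \sum_(i < d) partial i (fun y => F y 0 i) x.

Definition laplacian f x : R := \sum_(i < d) partial i (partial i f) x.

End Calculus.

(* Integral over R^d against Lebesgue measure, as an iterated integral. It is
   applied below to nonnegative continuous functions only, for which it is the
   Lebesgue integral by Tonelli's theorem. *)
Fixpoint integral_rV {R : realType} (d : nat) :
    ('rV[R]_d -> \bar R) -> \bar R :=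
  match d return ('rV[R]_d -> \bar R) -> \bar R with
  | 0 => fun f => f 0
  | d'.+1 => fun f => (\int[lebesgue_measure]_x
      integral_rV (fun y : 'rV[R]_d' => f (row_mx (\row_(_ < 1) x) y)))%E
  end.

Definition probability_density {R : realType} {d : nat} (f : 'rV[R]_d -> R) :=
  (forall x, 0 <= f x) /\ integral_rV (fun x => (f x)%:E) = 1%E.

Section Regularity.
Context {R : realType} {d : nat}.
Implicit Types (T : set R) (f : R -> 'rV[R]_d -> R) (a : R).

Definition continuous_on T f :=
  {within T `*` [set: 'rV[R]_d],
    continuous (fun z : R * 'rV[R]_d => f z.1 z.2)}.

(* Class C^1 on [a, +oo) x R^d; the time derivative is only required to exist
   on (a, +oo) and to extend continuously to time a. *)
Definition C1_from a f :=
  [/\ continuous_on `[a, +oo[ f,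
      forall i, (forall s x, a <= s -> derivable (f s) x (delta_mx 0 i)) /\
                continuous_on `[a, +oo[ (fun s => partial i (f s)) &
      exists2 g : R -> 'rV[R]_d -> R, continuous_on `[a, +oo[ g &
        forall s x, a < s -> is_derive s 1 (f^~ x) (g s x)].

(* Class C^{1,2} on (a, +oo) x R^d and continuous on [a, +oo) x R^d. *)
Definition C12_after a f :=
  [/\ continuous_on `[a, +oo[ f,
      (forall s x, a < s -> derivable (f^~ x) s 1) /\
        continuous_on `]a, +oo[ (fun s x => derive1 (f^~ x) s),
      forall i, (forall s x, a < s -> derivable (f s) x (delta_mx 0 i)) /\
                continuous_on `]a, +oo[ (fun s => partial i (f s)) &
      forall i j,
        (forall s x, a < s -> derivable (partial i (f s)) x (delta_mx 0 j)) /\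
        continuous_on `]a, +oo[ (fun s => partial j (partial i (f s)))].

(* U, as well as each component of its spatial gradient, is jointly C^1. *)
Definition regular_potential a (U : R -> 'rV[R]_d -> R) :=
  [/\ forall s x, a <= s -> 0 <= U s x,
      C1_from a U &
      forall i, C1_from a (fun s => partial i (U s))].

Definition fokker_planck_solution (mu beta a : R)
    (U p : R -> 'rV[R]_d -> R) :=
  [/\ C12_after a p,
      forall s, a <= s -> (integral_rV (fun x => `|p s x|%:E) < +oo)%E &
      forall s x, a < s ->
        derive1 (p^~ x) s - mu * divergence (fun y => p s y *: grad (U s) y) x
          - mu / beta * laplacian (p s) x = 0].

(* Uniqueness is only asked among nonnegative competitors, as the evolution of
   a probability density is nonnegative. *)
Definition determined_by_initial_datum (mu beta a : R)
    (U p : R -> 'rV[R]_d -> R) :=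
  forall p', fokker_planck_solution mu beta a U p' ->
    (forall s x, a <= s -> 0 <= p' s x) ->
    (forall x, p' a x = p a x) ->
    forall s x, a <= s -> p' s x = p s x.

End Regularity.

Section Processes.
Context {R : realType} {d : nat} {dO : measure_display}
        {Omega : measurableType dO} (P : probability Omega R).
Implicit Types (X w : R -> Omega -> 'rV[R]_d) (a s t : R) (l : seq R).

Definition mutually_independent (I : finType) (Y : I -> Omega -> R) :=
  forall B : I -> set R, (forall i, measurable (B i)) ->
    P (\bigcap_i (Y i @^-1` B i)) = (\prod_i P (Y i @^-1` B i))%E.

(* Points of the partition a = s_0 < s_1 < ... given by l = [:: s_1; ...]. *)
Definition tick a l (i : nat) : R := nth a (a :: l) i.

(* Standard d-dimensional Wiener process on [a, +oo). The value at a is left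
   free, since only increments of w are ever used. *)
Definition wiener a w :=
  [/\ forall s i, a <= s -> measurable_fun setT (fun o => w s o 0 i),
      forall o, {within `[a, +oo[, continuous (w^~ o)} &
      forall r l, a <= r -> path <%R r l ->
        let incr (k : 'I_(size l) * 'I_d) (o : Omega) :=
          (w (tick r l k.1.+1) o - w (tick r l k.1) o) 0 k.2 in
        mutually_independent incr /\
        forall k A, measurable A ->
          P (incr k @^-1` A) =
          normal_prob 0 (Num.sqrt (tick r l k.1.+1 - tick r l k.1)) A].

Definition increments_sigma w t s : set (set Omega) :=
  <<s [set A | exists r i B, [/\ s <= r <= t, measurable B &
         A = [set o | B ((w t o - w r o) 0 i)]]] >>.

(* Backward filtration generated by the increments w_t - w_r, s <= r <= t,
   augmented as usual by the P-null events. *)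
Definition backward_filtration w t s : set (set Omega) :=
  [set A | measurable A /\ exists2 B, increments_sigma w t s B &
     P ((A `\` B) `|` (B `\` A)) = 0%E].

(* Time runs backward: tau is the random time at which a process started at
   time t and run down to time a is stopped. *)
Definition backward_stopping_time w a t (tau : Omega -> R) :=
  (forall o, a <= tau o <= t) /\
  forall s, a <= s <= t -> backward_filtration w t s [set o | s <= tau o].

(* S l converges to I in probability as the mesh of the partition l of [a, t]
   tends to 0. *)
Definition mesh_limit_in_probability a t
    (S : seq R -> Omega -> R) (I : Omega -> R) :=
  forall eps eta : R, 0 < eps -> 0 < eta -> exists2 delta : R, 0 < delta &
    forall l, itv_partition a t l ->
      (forall i, (i < size l)%N -> tick a l i.+1 - tick a l i < delta) ->
      (P [set o | (eps < `|S l o - I o|)%R] < eta%:E)%E.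

Definition prepoint_sum (F : R -> 'rV[R]_d -> 'rV[R]_d) X a l (o : Omega) :=
  \sum_(i < size l) let s := tick a l i in let s' := tick a l i.+1 in
    dotv (X s' o - X s o) (F s (X s o)).

Definition postpoint_sum (F : R -> 'rV[R]_d -> 'rV[R]_d) X a l (o : Omega) :=
  \sum_(i < size l) let s := tick a l i in let s' := tick a l i.+1 in
    dotv (X s' o - X s o) (F s' (X s' o)).

Definition is_prepoint_integral F X a t (I : Omega -> R) :=
  measurable_fun setT I /\
  mesh_limit_in_probability a t (prepoint_sum F X a) I.

(* As a function of backward time this is the non-anticipating integral. *)
Definition is_postpoint_integral F X a t (I : Omega -> R) :=
  measurable_fun setT I /\
  mesh_limit_in_probability a t (postpoint_sum F X a) I.

(* Under P, this process has the law of the driftless backward diffusion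
   conditioned on being at q at time t, so that E_Q( . | q_t = q) is the
   P-expectation along it. *)
Definition driftless_path (sigma : R) w t (q : 'rV[R]_d) s (o : Omega) :=
  q - sigma *: (w t o - w s o).

(* X is a strong solution on [a, t], ending at q at time t, of the backward
   equation with drift b and diffusion coefficient sigma driven by w. *)
Definition backward_solution (b : R -> 'rV[R]_d -> 'rV[R]_d) (sigma : R)
    w a t (q : 'rV[R]_d) X :=
  [/\ forall s i B, a <= s <= t -> measurable B ->
        backward_filtration w t s [set o | B (X s o 0 i)],
      forall o, {within `[a, t], continuous (X^~ o)} &
      {ae P, forall o, forall s, a <= s <= t ->
        X s o = q
          - \row_i (\int[lebesgue_measure]_(r in `[s, t]) b r (X r o) 0 i)%R
          - sigma *: (w t o - w s o)}].

Definition well_posed_solution b sigma w a t q X :=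
  backward_solution b sigma w a t q X /\
  forall X', backward_solution b sigma w a t q X' ->
    {ae P, forall o, forall s, a <= s <= t -> X' s o = X s o}.

Definition path_sigma a t : set (set (R -> 'rV[R]_d)) :=
  <<s [set A | exists s i B, [/\ a <= s <= t, measurable B &
         A = [set x : R -> 'rV[R]_d | B (x s 0 i)]]] >>.

Definition path_event X (A : set (R -> 'rV[R]_d)) : set Omega :=
  [set o | A (X^~ o)].

(* The law of X is absolutely continuous with respect to the law of the
   driftless process Y, with the Radon-Nikodym derivative
     exp (sigma^-2 \int <dY_s, b_s(Y_s)> - sigma^-2 / 2 \int |b_s(Y_s)|^2 ds)
   of Girsanov's formula, the stochastic integral being non-anticipating in
   backward time. *)
Definition girsanov (b : R -> 'rV[R]_d -> 'rV[R]_d) (sigma : R) a t X Y :=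
  exists2 J, is_postpoint_integral b Y a t J &
    forall A, path_sigma a t A ->
      P (path_event X A) =
      (\int[P]_(o in path_event Y A)
        (expR ((J o - (\int[lebesgue_measure]_(s in `[a, t])
                         (enorm (b s (Y s o)) ^+ 2))%R / 2) / sigma ^+ 2))%:E)%E.

(* The family of all M_tau, tau a backward stopping time, is uniformly
   integrable: the integrability that makes a continuous local martingale on
   [a, t] a true martingale. *)
Definition class_D w a t (M : R -> Omega -> R) :=
  forall eps : R, 0 < eps -> exists K : R,
    forall tau, backward_stopping_time w a t tau ->
      (\int[P]_(o in [set o | (K < `|M (tau o) o|)%R])
         `|M (tau o) o|%:E <= eps%:E)%E.

End Processes.

Definition work_process {R : realType} {d : nat} {dO : measure_display}
    {Omega : measurableType dO} (beta t : R) (U p : R -> 'rV[R]_d -> R)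
    (X : R -> Omega -> 'rV[R]_d) (s : R) (o : Omega) : R :=
  expR (beta *
    (\int[lebesgue_measure]_(r in `[s, t]) derive1 (U^~ (X r o)) r)%R) *
  expR (beta * U s (X s o)) * p s (X s o).

(* Main.v *)
Require Import Defs.
From HB Require Import structures.
From mathcomp Require Import all_boot all_order all_algebra.
From mathcomp Require Import all_classical all_reals all_analysis.
From mathcomp Require Import measurable_realfun ring lra.
Import Order.TTheory GRing.Theory Num.Theory.
Import numFieldNormedType.Exports.

Set Implicit Arguments.
Unset Strict Implicit.
Unset Printing Implicit Defensive.

Local Open Scope classical_set_scope.
Local Open Scope ring_scope.

(** Put [v = e^(beta U) p].  Along the backward diffusion [X] with drift [mu grad U],
    the Fokker-Planck equation says exactly that the drift of
    [exp(beta \int_s^t (d_r U)(X_r) dr) v_s(X_s)] vanishes.  This is shown without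
    Ito's formula: on a fine grid, the second-order Taylor expansion of the increment
    over a cell consists of terms that are centered given the later part of the path
    and of a remainder that is small relative to the length of the cell plus
    [|w_(s') - w_s|^2]; up to the exit time of a large ball everything is bounded, so
    the remainder vanishes in mean.  Uniform integrability removes the exit times,
    and Girsanov's density moves the resulting expectation of a functional of [X] to
    the driftless path.  In that density the integral is post-point; since the sum of
    the pre-point and post-point sums is twice a trapezoid sum, it converges to
    [2 (U_t - U_a - \int (d_r U)(q_r) dr)] and trades the one integral for the other. *)

(** * Taylor expansions from continuous partial derivatives *)

(** Time reversal decides which end of a cell matters: the past of the backward diffusion at time s
    is carried by the increments w_t - w_r with r at least s, so coefficients must be frozen at the
    later end s' of a cell for its Wiener increment to be independent of them. Exit times tau are
    compatible with this: the event tau < s' is known at s', so the whole increment over the cell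
    that contains tau may be kept, at the price of one extra error term. The equation and the
    derivatives of p are available after the initial time only; exit times are therefore cut off at
    some c above it, and c decreases to the initial time while the radius of the ball grows. Both
    limits are taken at once, and class D over all backward stopping times is what they cost. The
    remainder does not vanish uniformly in the sample path, because moduli of continuity depend on
    it; divided by one plus the quadratic variation it is bounded uniformly and small path by path,
    and a moment bound on the quadratic variation then gives convergence in mean or in
    probability. *)

Section Derivatives.
Context {R : realType}.

Lemma is_derive_line (V : normedModType R) (f : V -> R) (x v : V) (r D : R) :
  is_derive (r *: v + x) v f D -> is_derive r 1 (fun s : R => f (s *: v + x)) D.
Proof.
move=> [df Df]; have E : (fun h : R => h^-1 *: (((fun s : R => f (s *: v + x)) \o shift r) (h *: 1) - f (r *: v + x)))
   = (fun h : R => h^-1 *: ((f \o shift (r *: v + x)) (h *: v) - f (r *: v + x))).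
  by apply/funext => h /=; rewrite scalerDl addrA; congr (_ *: (f (_ *: _ + _ + _) - _)); rewrite /GRing.scale /= mulr1.
by split; rewrite /derivable /derive E.
Qed.

(** The sign of [c] is free, and the intermediate point is located only through |e| <= |c|: this is
    all that is needed when [c] tends to 0. *)
Lemma MVT_line (V : normedModType R) (f g : V -> R) (x v : V) (c : R) :
  (forall y, is_derive y v f (g y)) ->
  exists2 e : R, `|e| <= `|c| & f (c *: v + x) - f x = c * g (e *: v + x).
Proof.
move=> dfg; pose F := fun s : R => f (s *: v + x).
have dF (s : R) : is_derive s 1 F (g (s *: v + x)) by exact: is_derive_line.
have cF (a b : R) : {within `[a, b], continuous F}.
  by apply: derivable_within_continuous => s _; exact: (@ex_derive _ _ _ _ _ _ _ (dF s)).
have F0 : F 0 = f x by rewrite /F scale0r add0r.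
rewrite -F0; case: (lerP 0 c) => c0.
  have [e ein ->] := MVT_segment c0 (fun s _ => dF s) (cF _ _).
  exists e; last by rewrite subr0 mulrC.
  by move: ein; rewrite in_itv/= => /andP[e0 ec]; rewrite !ger0_norm.
have [e ein E] := MVT_segment (ltW c0) (fun s _ => dF s) (cF _ _).
exists e; last by rewrite -opprB E sub0r mulrN opprK mulrC.
move: ein; rewrite in_itv/= => /andP[ec e0].
by rewrite (ler0_norm e0) (ltr0_norm c0) lerN2.
Qed.

(** Move first by h u, then by h c v. The second leg is an exact mean value, taken at a point that
    tends to x with h, so continuity of [g] at x gives its contribution; along [u] a derivative at
    the single point x is enough. Adding one coordinate direction at a time then yields every
    directional derivative without a total differential. *)
Lemma is_derive_add_direction (V : normedModType R) (f g : V -> R) (x u v : V) (c D : R) :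
  (forall y, is_derive y v f (g y)) -> {for x, continuous g} ->
  is_derive x u f D -> is_derive x (u + c *: v) f (D + c * g x).
Proof.
move=> dfg cg [du Du].
have H : (fun h : R => h^-1 *: ((f \o shift x) (h *: (u + c *: v)) - f x))
    @ 0^' --> D + c * g x.
  have /choice[e He] : forall h : R, exists e : R, `|e| <= `|h * c| /\
      f ((h * c) *: v + (h *: u + x)) - f (h *: u + x)
      = h * c * g (e *: v + (h *: u + x)).
    move=> h; have [e e1 e2] := MVT_line (h *: u + x) (h * c) dfg.
    by exists e.
  have E : {near 0^', (fun h => h^-1 *: ((f \o shift x) (h *: u) - f x)
      + c * g (e h *: v + (h *: u + x)))
      =1 (fun h : R => h^-1 *: ((f \o shift x) (h *: (u + c *: v)) - f x))}.
    near=> h; have h0 : h != 0 by near: h; exact: nbhs_dnbhs_neq.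
    have := (He h).2 => /(congr1 (fun z => h^-1 * z)).
    rewrite -!mulrA mulKf// => <-.
    rewrite -[LHS]/(h^-1 * (f (h *: u + x) - f x) + h^-1 * (f ((h * c) *: v + (h *: u + x)) - f (h *: u + x))).
    rewrite -[RHS]/(h^-1 * (f (h *: (u + c *: v) + x) - f x)).
    rewrite -mulrDr scalerDr scalerA (addrC (h *: u) (_ *: v)) -[in RHS]addrA; congr (_ * _); ring.
  apply: cvg_trans (near_eq_cvg E) _; apply: cvgD.
    by rewrite -Du; exact: du.
  have h0 : (h @[h --> (0:R)^'] --> (0:R)) by apply: cvg_within.
  have e0 : (e h @[h --> (0:R)^'] --> (0:R)).
    apply/cvgr0Pnorm_le => eps eps0.
    have hc : (h * c @[h --> (0:R)^'] --> (0:R) * c) by apply: cvgMl.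
    rewrite mul0r in hc; move/cvgr0Pnorm_le: hc => /(_ _ eps0).
    by apply: filterS => h; apply: le_trans; exact: (He h).1.
  have Hx : (e h *: v + (h *: u + x) @[h --> (0:R)^'] --> x).
    have E0 : (0 : R) *: v + ((0 : R) *: u + x) = x by rewrite !scale0r !add0r.
    rewrite -[in X in _ --> X]E0; apply: cvgD; first exact: cvgZr_tmp.
    by apply: cvgD; [exact: cvgZr_tmp|exact: cvg_cst].
  by apply: cvgMr; apply: (cvg_comp _ _ Hx cg).
by split; [apply/cvg_ex; eexists; exact: H | exact: cvg_lim H].
Unshelve. all: end_near. Qed.

Lemma is_derive_direction (d : nat) (f : 'rV[R]_d -> R) (g : 'I_d -> 'rV[R]_d -> R)
    (x u : 'rV[R]_d) :
  (forall i y, is_derive y (delta_mx 0 i) f (g i y)) ->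
  (forall i, continuous (g i)) ->
  is_derive x u f (\sum_i u 0 i * g i x).
Proof.
move=> dfg cg; rewrite [u in is_derive x u](row_sum_delta u).
elim/big_rec2: _ => [|i y1 y2 _ IH].
  by split; [exact: derivable0 | exact: derive0].
rewrite addrC (addrC _ y1).
by apply: is_derive_add_direction => //; exact: cg.
Qed.

Lemma MVT_cont (f df : R -> R) (a b : R) :
  a <= b -> (forall x, a < x < b -> is_derive x 1 f (df x)) ->
  {within `[a, b], continuous f} ->
  exists2 c, a <= c <= b & f b - f a = df c * (b - a).
Proof.
move=> ab H cf; have H' x : x \in `]a, b[ -> is_derive x 1 f (df x).
  by rewrite in_itv; exact: H.
by have [c] := MVT_segment ab H' cf; rewrite in_itv; exists c.
Qed.

Lemma taylor2_unit (f f1 f2 : R -> R) :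
  (forall x : R, is_derive x 1 f (f1 x)) -> (forall x : R, is_derive x 1 f1 (f2 x)) ->
  exists2 c, 0 <= c <= 1 & f 1 = f 0 + f1 0 + f2 c / 2.
Proof.
move=> d1 d2; pose K := f 1 - f 0 - f1 0.
(* [K] makes g 0 and g 1 both equal to f 1, so the mean value theorem gives a zero of g' = (1 -
   s)(f2 s - 2 K) in the open interval, where 1 - s does not vanish. *)
pose g (s : R) := f s + f1 s * (1 - s) + K * (1 - s) ^+ 2.
have dg (x : R) : is_derive x 1 g ((1 - x) * (f2 x - 2 * K)).
  have := d1 x; have := d2 x => ? ?.
  apply: is_derive_eq; rewrite /GRing.scale /=; ring.
have cg : {within `[0, 1], continuous g}.
  by apply: derivable_within_continuous => x _; case: (dg x).
have [c] := MVT (@ltr01 R) (fun x _ => dg x) cg; rewrite in_itv /= => /andP[c0 c1] E; exists c; first by rewrite !ltW.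
have /eqP : (1 - c) * (f2 c - 2 * K) = 0.
  have <- : g 1 - g 0 = 0 by rewrite /g /K; ring.
  by rewrite E; ring.
rewrite mulf_eq0 subr_eq0 gt_eqF//= subr_eq0 => /eqP E2.
have -> : f2 c = 2 * K by [].
by rewrite /K; field.
Qed.

Section Taylor.
Variables (d : nat) (f : 'rV[R]_d -> R) (g : 'I_d -> 'rV[R]_d -> R)
  (h : 'I_d -> 'I_d -> 'rV[R]_d -> R).
Hypothesis dfg : forall i y, is_derive y (delta_mx 0 i) f (g i y).
Hypothesis dgh : forall i j y, is_derive y (delta_mx 0 j) (g i) (h i j y).
Hypothesis cg : forall i, continuous (g i).
Hypothesis ch : forall i j, continuous (h i j).

Let dline (x u : 'rV[R]_d) (s : R) : is_derive s 1 (fun s : R => f (s *: u + x)) (\sum_i u 0 i * g i (s *: u + x)).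
Proof. by apply: is_derive_line; exact: is_derive_direction. Qed.

Let ddline (x u : 'rV[R]_d) (s : R) : is_derive s 1 (fun s : R => \sum_i u 0 i * g i (s *: u + x))
  (\sum_i \sum_j u 0 i * u 0 j * h i j (s *: u + x)).
Proof.
have -> : (fun s : R => \sum_i u 0 i * g i (s *: u + x)) = \sum_i (fun s : R => u 0 i * g i (s *: u + x)).
  by apply/funext => r; rewrite fct_sumE.
apply: is_derive_sum => i.
have := is_derive_line (@is_derive_direction d _ _ (s *: u + x) u (@dgh i) (@ch i)) => ?.
apply: is_derive_eq; rewrite scaler_sumr; apply: eq_bigr => j _.
by rewrite /GRing.scale /= mulrA.
Qed.

Lemma taylor2 (x u : 'rV[R]_d) : exists2 c : R, 0 <= c <= 1 &
  f (u + x) = f x + \sum_i u 0 i * g i x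
    + (\sum_i \sum_j u 0 i * u 0 j * h i j (c *: u + x)) / 2.
Proof.
have [c c01] := taylor2_unit (dline x u) (ddline x u).
rewrite /= scale1r scale0r add0r => E; exists c => //; rewrite E.
Qed.

Lemma gradient_increment (x u : 'rV[R]_d) : exists2 c : R, 0 <= c <= 1 &
  \sum_i u 0 i * g i (u + x) = \sum_i u 0 i * g i x
    + \sum_i \sum_j u 0 i * u 0 j * h i j (c *: u + x).
Proof.
have cl : {within `[0, 1], continuous (fun s : R => \sum_i u 0 i * g i (s *: u + x))}.
  by apply: derivable_within_continuous => s _; case: (ddline x u s).
have [c c01 E] := MVT_cont (@ler01 R) (fun s _ => ddline x u s) cl.
exists c => //; move: E; rewrite /= scale1r subr0 mulr1 => /eqP.
rewrite subr_eq => /eqP ->; rewrite [LHS]addrC; congr (_ + _).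
by apply: eq_bigr => i _; rewrite scale0r add0r.
Qed.
End Taylor.
End Derivatives.

(** * Integrals of continuous functions over segments *)

Section Integrals.
Context {R : realType}.
Local Notation mu := (@lebesgue_measure R).

Lemma continuous_itv_integrable (k : R -> R) (s t : R) :
  {within `[s, t], continuous k} -> mu.-integrable `[s, t] (EFin \o k).
Proof. exact/continuous_compact_integrable/segment_compact. Qed.

Lemma Rintegral_split (k : R -> R) (a s t : R) : a <= s <= t ->
  {within `[a, t], continuous k} ->
  (\int[mu]_(r in `[a, t]) k r = \int[mu]_(r in `[a, s]) k r + \int[mu]_(r in `[s, t]) k r)%R.
Proof.
move=> /andP[as_ st] ck; have ik := continuous_itv_integrable ck.
have := Rintegral_itvB ik; move=> /(_ s); rewrite !bnd_simp => /(_ as_ st) E.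
apply/eqP; rewrite addrC -subr_eq E Rintegral_itv_obnd_cbnd//.
apply: integrableS ik => // r /=; rewrite !in_itv/= => /andP[sr ->].
by rewrite (le_trans as_ (ltW sr)).
Qed.

Lemma Rintegral_close (k : R -> R) (s t c e : R) : s <= t ->
  {within `[s, t], continuous k} -> (forall r, s <= r <= t -> `|k r - c| <= e) ->
  `|(\int[mu]_(r in `[s, t]) k r)%R - (t - s) * c| <= e * (t - s).
Proof.
move=> st ck H; have ik := continuous_itv_integrable ck.
have mE : fine (mu `[s, t]) = t - s.
  by rewrite lebesgue_measure_itv/= lte_fin; case: ltgtP st => //= ->; rewrite subrr.
have ic c' : mu.-integrable `[s, t] (EFin \o (fun=> c')).
  by apply: continuous_itv_integrable; apply: continuous_subspaceT => ?; exact: cvg_cst.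
have cE (c' : R) : (\int[mu]_(r in `[s, t]) c')%R = c' * (t - s).
  by rewrite Rintegral_cst// mE.
rewrite ler_distl; apply/andP; split.
  rewrite mulrC -mulrBl -cE; apply: le_Rintegral => // r; rewrite /= in_itv/= => /H.
  by rewrite ler_distl => /andP[].
rewrite mulrC -mulrDl -cE; apply: le_Rintegral => // r; rewrite /= in_itv/= => /H.
by rewrite ler_distl => /andP[].
Qed.
End Integrals.

(** * Continuous fields on space-time *)

Section Compactness.
Context {R : realType}.

(** Continuity is within [K] only, so both points have to lie in [K]. Thresholds run along the
    filter of small positive numbers: around each z half the radius of continuity works, and
    compactness as a near covering makes one threshold serve all of [K]. *)
Lemma uniform_continuity_on_compact (V W : normedModType R) (K : set V) (f : V -> W) :
  compact K -> {within K, continuous f} -> forall e : R, 0 < e ->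
  exists2 r : R, 0 < r & forall z z', K z -> K z' -> `|z - z'| < r -> `|f z - f z'| < e.
Proof.
move=> /compact_near_coveringP cK /subspace_continuousP cf e e0.
pose Q (r : R) (z : V) := forall z', K z -> K z' -> `|z - z'| < r -> `|f z - f z'| < e.
have := @cK R (0 : R)^'+ Q _; case.
  move=> z Kz; have /cvgr_dist_lt/(_ (e / 2)) := cf z Kz.
  rewrite divr_gt0// => /(_ isT); rewrite /within /= => /nbhs_ballP[r /= r0 Hr].
  exists (ball z (r / 2), [set d : R | 0 < d < r / 2]) => /=.
    split; first by apply: nbhsx_ballx; rewrite divr_gt0.
    near=> d; apply/andP; split; near: d; first exact: nbhs_right_gt.
    by apply: nbhs_right_lt; rewrite divr_gt0.
  move=> [y d] /= [zy /andP[d0 dr]] z' Ky Kz' yz'.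
  have B y' : K y' -> `|z - y'| < r -> `|f z - f y'| < e / 2.
    by move=> Ky' zy'; apply: Hr => //; rewrite -ball_normE.
  rewrite -ball_normE /= in zy.
  rewrite (splitr e) -(subrK (f z) (f y)) -addrA (le_lt_trans (ler_normD _ _))//.
  rewrite ltrD//.
    by rewrite distrC; apply: B => //; apply: lt_le_trans zy _; lra.
  apply: B => //; rewrite -(subrK y z) -addrA (le_lt_trans (ler_normD _ _))// (splitr r) ltrD//.
  exact: lt_trans dr.
move=> r /= r0 Hr; exists (r / 2); first by rewrite divr_gt0.
move=> z z' Kz Kz' zz'; apply: (Hr (r / 2)) => //=; last by rewrite divr_gt0.
  by rewrite /= sub0r normrN gtr0_norm ?divr_gt0//; lra.
Unshelve. all: end_near. Qed.

Section TimeSpace.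
Context {d : nat}.
Implicit Types (f g : R -> 'rV[R]_d -> R) (T : set R).

Lemma compact_closed_ball_rV (M : R) : compact [set x : 'rV[R]_d | `|x| <= M].
Proof.
apply: bounded_closed_compact.
  by exists M; split; rewrite ?num_real// => y My x /= /le_trans; apply; exact: ltW.
apply: (@closed_comp _ _ (fun x : 'rV[R]_d => `|x|) [set y | y <= M]); last exact: closed_le.
by move=> x _; exact: norm_continuous.
Qed.

Let K (c t M : R) : set (R * 'rV[R]_d) := `[c, t] `*` [set x | `|x| <= M].

Let cK c t M : compact (K c t M).
Proof. by apply: compact_setX; [exact: segment_compact|exact: compact_closed_ball_rV]. Qed.

Lemma continuous_on_subset T T' f : T' `<=` T -> continuous_on T f -> continuous_on T' f.
Proof. by move=> TT'; apply: continuous_subspaceW => z [/= /TT' ? _]. Qed.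

Let fK T f c t M : `[c, t] `<=` T -> continuous_on T f ->
  {within K c t M, continuous (fun z => f z.1 z.2)}.
Proof. by move=> cT; apply: continuous_subspaceW => z [/= /cT ? _]. Qed.

Lemma continuous_on_uniform T f c t M : `[c, t] `<=` T -> continuous_on T f ->
  forall e : R, 0 < e -> exists2 r : R, 0 < r & forall s s' x x',
    c <= s <= t -> c <= s' <= t -> `|x| <= M -> `|x'| <= M ->
    `|s - s'| < r -> `|x - x'| < r -> `|f s x - f s' x'| < e.
Proof.
move=> cT /(@fK T f c t M cT) cf e e0.
have [r r0 H] := uniform_continuity_on_compact (@cK c t M) cf e0.
exists r => // s s' x x' cs cs' xM xM' ss xx.
apply: (H (s, x) (s', x')); rewrite /K /= ?in_itv//.
by rewrite prod_normE /= gt_max ss.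
Qed.

Lemma continuous_on_bounded T f c t M : `[c, t] `<=` T -> continuous_on T f ->
  exists2 C : R, 0 <= C & forall s x, c <= s <= t -> `|x| <= M -> `|f s x| <= C.
Proof.
move=> cT /(@fK T f c t M cT) cf.
have /compact_bounded[C [_ H]] := continuous_compact cf (@cK c t M).
exists (`|C| + 1); first by rewrite addr_ge0.
move=> s x cs xM; apply: (H (`|C| + 1)); first by rewrite ltr_pwDr// ler_norm.
by exists (s, x) => //; rewrite /K /= in_itv.
Qed.

Lemma continuous_on_path T T' f (x : R -> 'rV[R]_d) : T' `<=` T -> continuous_on T f ->
  {within T', continuous x} -> {within T', continuous (fun r => f r (x r))}.
Proof.
move=> TT /subspace_continuousP cf /subspace_continuousP cx.
apply/subspace_continuousP => s Ts.
have P : (r, x r) @[r --> within T' (nbhs s)] --> (s, x s).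
  by apply: (@cvg_pair _ _ _ _ (nbhs s) (nbhs (x s))) => /=; [exact: cvg_within|exact: cx].
have P' : (r, x r) @[r --> within T' (nbhs s)] --> within (T `*` setT) (nbhs (s, x s)).
  move=> A HA.
  have : nbhs s [set r | T' r -> (T `*` setT) (r, x r) -> A (r, x r)] by exact: P _ HA.
  by apply: filterS => r H Tr; apply: H => //; split => //; exact: TT.
exact: (cvg_comp _ _ P' (cf (s, x s) (conj (TT _ Ts) I))).
Qed.

Lemma continuous_on_time T T' f (x : 'rV[R]_d) : T' `<=` T -> continuous_on T f ->
  {within T', continuous (f^~ x)}.
Proof.
move=> TT cf; apply: (continuous_on_path TT cf (x := fun=> x)).
by apply: continuous_subspaceT => ?; exact: cvg_cst.
Qed.

Lemma continuous_on_space T f s : T s -> continuous_on T f -> continuous (f s).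
Proof.
move=> Ts /subspace_continuousP cf; suff H (x : 'rV[R]_d) : f s y @[y --> x] --> f s x.
  exact: H.
have P : (s, y) @[y --> x] --> (s, x).
  have h1 : ((fun _ : 'rV[R]_d => s) y @[y --> x] --> s).
    by apply: cvg_cst; exact: (nbhs_filter x).
  have h2 : ((fun y : 'rV[R]_d => y) y @[y --> x] --> x) by exact: cvg_id.
  exact: (cvg_pair h1 h2).
have P' : (s, y) @[y --> x] --> within (T `*` setT) (nbhs (s, x)).
  move=> A HA; have : nbhs x [set y | (T `*` setT) (s, y) -> A (s, y)] by exact: P _ HA.
  by apply: filterS => y; apply.
exact: (cvg_comp _ _ P' (cf (s, x) (conj Ts I))).
Qed.

Lemma continuous_onD T f g : continuous_on T f -> continuous_on T g ->
  continuous_on T (fun s x => f s x + g s x).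
Proof. by move=> cf cg z; apply: cvgD; [exact: cf|exact: cg]. Qed.

Lemma continuous_onM T f g : continuous_on T f -> continuous_on T g ->
  continuous_on T (fun s x => f s x * g s x).
Proof. by move=> cf cg z; apply: cvgM; [exact: cf|exact: cg]. Qed.

Lemma continuous_on_cst T (k : R) : continuous_on T (fun (_ : R) (_ : 'rV[R]_d) => k).
Proof. by move=> z; exact: cvg_cst. Qed.

Lemma continuous_on_comp T f (h : R -> R) : continuous h -> continuous_on T f ->
  continuous_on T (fun s x => h (f s x)).
Proof. by move=> ch cf z; apply: (cvg_comp _ _ (cf z)); exact: ch. Qed.

Lemma continuous_on_sum (I : finType) T (F : I -> R -> 'rV[R]_d -> R) :
  (forall i, continuous_on T (F i)) -> continuous_on T (fun s x => \sum_i F i s x).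
Proof.
move=> cF; have : forall r, continuous_on T (fun s x => \sum_(i <- r) F i s x).
  elim=> [|i r IH].
    have -> : (fun s x => \sum_(i <- [::]) F i s x) = (fun _ _ => 0).
      by apply/funext => s; apply/funext => x; rewrite big_nil.
    exact: continuous_on_cst.
  have -> : (fun s x => \sum_(i <- i :: r) F i s x) = (fun s x => F i s x + \sum_(i <- r) F i s x).
    by apply/funext => s; apply/funext => x; rewrite big_cons.
  by apply: continuous_onD => //; exact: cF.
exact.
Qed.

End TimeSpace.
End Compactness.

(** * Riemann sums on uniform grids *)

Section MeasurablePaths.
Context {R : realType}.
Local Notation mu := (@lebesgue_measure R).

(** Only the coordinates of [Z] are known to be measurable. Rounded down to the lattice of mesh
    1/(m+1), [Z] takes countably many values, so [f] of the rounded point is measurable; continuity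
    of [f] passes this to the limit. *)
Lemma measurable_continuous_coord d (T : measurableType d) (n : nat)
    (f : 'rV[R]_n -> R) (Z : T -> 'rV[R]_n) : continuous f ->
  (forall i, measurable_fun setT (fun o => Z o 0 i)) ->
  measurable_fun setT (fun o => f (Z o)).
Proof.
move=> cf mZ.
pose fl (m : nat) (o : T) : 'rV[int]_n := \row_i Num.floor (m.+1%:R * Z o 0 i).
pose pt (m : nat) (k : 'rV[int]_n) : 'rV[R]_n := \row_i (m.+1%:R^-1 * (k 0 i)%:~R).
apply: (@measurable_fun_cvg _ _ _ setT (fun m o => f (pt m (fl m o)))) => [m _ B mB|o _].
  have -> : [set: T] `&` (fun o => f (pt m (fl m o))) @^-1` B
      = \bigcup_(k in [set k | B (f (pt m k))]) [set o | fl m o = k].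
    rewrite setTI; apply/seteqP; split => [x /= Bo|x [k /= Bk E]]; last by rewrite /= E.
    by exists (fl m x).
  rewrite bigcup_mkcond; apply: countable_bigcupT_measurable => //.
  move=> k; case: ifP => // _.
  have -> : [set o | fl m o = k] = \bigcap_(i in [set: 'I_n])
     ((fun o => m.+1%:R * Z o 0 i) @^-1` `[(k 0 i)%:~R, (k 0 i + 1)%:~R[).
    apply/seteqP; split => [x /= <- i _ /=|x /= H].
      by rewrite in_itv/= mxE -real_floor_eq ?num_real// eqxx.
    apply/rowP => i; rewrite mxE; apply/eqP; rewrite real_floor_eq ?num_real//.
    by have := H i I; rewrite /= in_itv.
  apply: fin_bigcap_measurable => [|i _]; first exact: finite_finset.
  rewrite -[X in measurable X]setTI; apply: measurable_funM => //.
suff H : pt m (fl m o) @[m --> \oo] --> Z o by exact: (cvg_comp _ _ H (cf _)).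
apply/cvgrPdist_lt => e e0.
have := @near_infty_natSinv_lt R (PosNum e0) => /=; apply: filterS => m me.
rewrite /Num.norm /= mx_normrE; apply/bigmax_ltP; split => // -[i j] _ /=.
rewrite !mxE ord1; have m0 : 0 < m.+1%:R :> R by rewrite ltr0Sn.
have /andP[f1 f2] := real_floor_itv (num_real (m.+1%:R * Z o 0 j)).
apply: le_lt_trans me; rewrite -[X in `|X - _|](mulKf (lt0r_neq0 m0)) -mulrBr.
rewrite normrM gtr0_norm ?invr_gt0// ler_piMr ?invr_ge0 ?(ltW m0)//.
rewrite ger0_norm ?subr_ge0// lerBlDl; apply/ltW.
by rewrite intrD in f2; rewrite addrC in f2; rewrite addrC.
Qed.

(* The uniform grid of [[a, t]] with [N.+1] cells, so that the division is never by 0. *)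
Definition grid (a t : R) (N i : nat) : R := a + (t - a) * (i%:R / N.+1%:R).

Lemma grid0 a t N : grid a t N 0 = a.
Proof. by rewrite /grid mul0r mulr0 addr0. Qed.

Lemma gridN a t N : grid a t N N.+1 = t.
Proof. by rewrite /grid divff ?pnatr_eq0// mulr1 addrC subrK. Qed.

Lemma gridS a t N i : grid a t N i.+1 - grid a t N i = (t - a) / N.+1%:R.
Proof.
have -> : grid a t N i.+1 = a + (t - a) * ((i%:R + 1) / N.+1%:R) by rewrite natr1.
by rewrite /grid; move: (N.+1%:R^-1 : R) => v; ring.
Qed.

Lemma grid_le a t N i j : a <= t -> (i <= j)%N -> grid a t N i <= grid a t N j.
Proof.
move=> at_ ij; rewrite lerD2l ler_wpM2l ?subr_ge0// ler_wpM2r ?invr_ge0//.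
by rewrite ler_nat.
Qed.

Lemma grid_lt a t N i j : a < t -> (i < j)%N -> grid a t N i < grid a t N j.
Proof.
move=> at_ ij; rewrite ltrD2l ltr_pM2l ?subr_gt0// ltr_pM2r ?invr_gt0 ?ltr0Sn//.
by rewrite ltr_nat.
Qed.

Lemma grid_itv a t N i : a <= t -> (i <= N.+1)%N -> a <= grid a t N i <= t.
Proof.
move=> at_ iN; have := grid_le N at_ (leq0n i); have := grid_le N at_ iN.
by rewrite grid0 gridN => -> ->.
Qed.

Lemma grid_mesh_cvg (a t : R) : (t - a) / N.+1%:R @[N --> \oo] --> 0.
Proof.
have : (t - a) * N.+1%:R^-1 @[N --> \oo] --> (t - a) * 0.
  by apply: cvgMr; apply: cvg_harmonic.
by rewrite mulr0.
Qed.

Lemma Rintegral_grid (k : R -> R) a t N m : a <= t -> (m <= N.+1)%N ->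
  {within `[a, t], continuous k} ->
  (\int[mu]_(r in `[a, grid a t N m]) k r)%R
    = \sum_(i < m) (\int[mu]_(r in `[grid a t N i, grid a t N i.+1]) k r)%R.
Proof.
move=> at_ + ck; elim: m => [|m IH] mN.
  by rewrite big_ord0 grid0 set_itv1 Rintegral_set1.
rewrite big_ord_recr /= -IH; last exact: ltnW.
apply: Rintegral_split.
  by rewrite grid_le// andbT; have /andP[] := grid_itv at_ (ltnW mN).
apply: continuous_subspaceW ck => r /=; rewrite !in_itv/= => /andP[-> /le_trans->//].
by have /andP[] := grid_itv at_ mN.
Qed.

Lemma Riemann_sum_cvg (k : R -> R) a t : a <= t -> {within `[a, t], continuous k} ->
  \sum_(i < N.+1) (t - a) / N.+1%:R * k (grid a t N i.+1) @[N --> \oo]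
    --> (\int[mu]_(r in `[a, t]) k r)%R.
Proof.
move=> at_ ck; apply/cvgrPdist_le => e e0.
(* The added 1 keeps the denominator positive when t = a. *)
pose e' := e / (t - a + 1).
have ta1 : 0 < t - a + 1 by rewrite ltr_wpDl// subr_ge0.
have e'0 : 0 < e' by rewrite divr_gt0.
have [r r0 H] := uniform_continuity_on_compact (@segment_compact _ a t) ck e'0.
have /cvgrPdist_lt/(_ _ r0) := grid_mesh_cvg a t; apply: filterS => N.
rewrite sub0r normrN => hN.
have h0 : 0 <= (t - a) / N.+1%:R by rewrite divr_ge0 ?subr_ge0.
rewrite ger0_norm// in hN.
rewrite -[X in `[a, X]](gridN a t N) Rintegral_grid// -sumrB.
apply: le_trans (ler_norm_sum _ _ _) _.
apply: (@le_trans _ _ (\sum_(i < N.+1) e' * ((t - a) / N.+1%:R))).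
  apply: ler_sum => i _; rewrite -(gridS a t N i).
  have iN := ltn_ord i.
  have /andP[g1 g2] := grid_itv at_ iN; have /andP[g3 g4] := grid_itv at_ (ltnW iN).
  apply: Rintegral_close; first exact: grid_le.
    apply: continuous_subspaceW ck => x /=; rewrite !in_itv/= => /andP[].
    by move=> /(le_trans g3) -> /le_trans ->.
  move=> x /andP[x1 x2]; apply/ltW/H; rewrite /= ?in_itv/=.
  - by rewrite (le_trans g3 x1) (le_trans x2 g2).
  - by rewrite g1 g2.
  apply: le_lt_trans hN; rewrite -(gridS a t N i) distrC ger0_norm ?subr_ge0//.
  by rewrite lerD2l lerN2.
rewrite sumr_const card_ord -[X in X <= _]mulr_natr -[X in X <= _]mulrA divfK ?pnatr_eq0//.
by rewrite /e' mulrAC ler_pdivrMr// ler_pM2l// lerDl.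
Qed.

Lemma measurable_path_integral d (T : measurableType d) (k : R -> T -> R) a t :
  a <= t -> (forall s, a < s <= t -> measurable_fun setT (k s)) ->
  (forall o, {within `[a, t], continuous (k^~ o)}) ->
  measurable_fun setT (fun o => \int[mu]_(r in `[a, t]) k r o)%R.
Proof.
rewrite le_eqVlt => /predU1P[<- _ _|at_ mk ck].
  by rewrite set_itv1; under eq_fun do rewrite Rintegral_set1; exact: measurable_cst.
apply: (@measurable_fun_cvg _ _ _ setT
    (fun N o => \sum_(i < N.+1) (t - a) / N.+1%:R * k (grid a t N i.+1) o)).
  move=> N; apply: measurable_sum => i; apply: measurable_funM => //; apply: mk.
  have /andP[_ ->] := grid_itv (ltW at_) (ltn_ord i).
  by have := grid_lt N at_ (ltn0Sn i); rewrite grid0 => ->.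
by move=> o _; exact: Riemann_sum_cvg (ltW at_) (ck o).
Qed.
End MeasurablePaths.

(** * Change of density and Gaussian moments *)

Section Density.
Context d d' (T : measurableType d) (T' : measurableType d') (R : realType).
Variables (m : {measure set T -> \bar R}) (n : {measure set T' -> \bar R}).
Variables (Y : T -> T') (D : T -> R).
Hypothesis mY : measurable_fun setT Y.
Hypothesis mD : measurable_fun setT D.
Hypothesis D0 : forall x, 0 <= D x.
Hypothesis nE : forall A, measurable A -> n A = (\int[m]_(x in Y @^-1` A) (D x)%:E)%E.

Import HBNNSimple.

Let mDE : measurable_fun setT (fun x => (D x)%:E). Proof. exact/measurable_EFinP. Qed.

Let mYA A : measurable A -> measurable (Y @^-1` A).
Proof. by move=> mA; rewrite -[X in measurable X]setTI; exact: mY. Qed.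

Let density_nnsfun (f : {nnsfun T' >-> R}) :
  (\int[n]_x (f x)%:E = \int[m]_x ((f (Y x))%:E * (D x)%:E))%E.
Proof.
under [LHS]eq_integral do rewrite fimfunE -fsumEFin//.
rewrite [LHS]ge0_integral_fsum//; last 2 first.
  - by move=> r; exact/measurable_EFinP/measurableT_comp.
  - by move=> k x _; rewrite EFinM nnfun_muleindic_ge0.
under [RHS]eq_integral.
  move=> x xD; rewrite fimfunE -fsumEFin// ge0_mule_fsuml; last first.
    by move=> r; rewrite EFinM nnfun_muleindic_ge0.
  over.
rewrite [RHS]ge0_integral_fsum//; last 2 first.
  - move=> r; apply: emeasurable_funM => //; apply/measurable_EFinP.
    by apply: measurable_funM => //; apply: measurableT_comp.
  - by move=> k x _; apply: mule_ge0; rewrite ?EFinM ?nnfun_muleindic_ge0 ?lee_fin.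
apply: eq_fsbigr => r /set_mem -[x _ fxr].
have r0 : (0 <= r)%R by rewrite -fxr.
have mfr : measurable (f @^-1` [set r]) by exact: measurable_sfunP.
rewrite integralZl_indic_nnsfun//= integral_indic// setIT nE//.
transitivity (\int[m]_x (r%:E * ((\1_(f @^-1` [set r]) (Y x))%:E * (D x)%:E)))%E; last first.
  by apply: eq_integral => y _; rewrite muleA -EFinM.
rewrite ge0_integralZl//.
- congr (_ * _)%E; rewrite [LHS]integral_mkcond; apply: eq_integral => y _.
  rewrite patchE indicE -[Y y \in _]/(y \in Y @^-1` (f @^-1` [set r])).
  by case: ifPn; rewrite ?mul1e ?mul0e.
- apply: emeasurable_funM => //; apply/measurable_EFinP.
  by apply: (@measurableT_comp _ _ _ _ _ _ (\1_(f @^-1` [set r]) : T' -> R)).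
- by move=> y _; rewrite mule_ge0 ?lee_fin.
Qed.

(** The density [D] lives on the source space and need not be a function of [Y]. With [D] constantly
    1 this is an image measure, with [Y] the identity an ordinary density, and on path space it is
    Girsanov's formula. *)
Lemma integral_density (f : T' -> \bar R) :
  measurable_fun setT f -> (forall x, 0 <= f x)%E ->
  (\int[n]_x f x = \int[m]_x (f (Y x) * (D x)%:E))%E.
Proof.
move=> mf f0; pose f_ := nnsfun_approx measurableT mf.
have fc x : (f_ k x)%:E @[k --> \oo] --> f x by exact: cvg_nnsfun_approx.
transitivity (lim (\int[n]_x (f_ k x)%:E @[k --> \oo])%E).
  rewrite -monotone_convergence//=.
  - by apply: eq_integral => x _; apply/esym/cvg_lim => //; exact: fc.
  - by move=> k; exact/measurable_EFinP/measurable_funTS.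
  - by move=> k ? _; rewrite lee_fin.
  - by move=> ? _ ? ? mn; rewrite lee_fin; exact/lefP/nd_nnsfun_approx.
transitivity (lim (\int[m]_x ((f_ k (Y x))%:E * (D x)%:E) @[k --> \oo])%E).
  by under eq_fun do rewrite density_nnsfun.
rewrite -monotone_convergence//=.
- apply: eq_integral => x _; apply/cvg_lim => //.
  by apply: cvgeZr => //; exact: fc.
- move=> k; apply: emeasurable_funM => //; apply/measurable_EFinP; exact: measurableT_comp.
- by move=> k ? _; rewrite mule_ge0 ?lee_fin.
- move=> x _ ? ? mn; by apply: lee_wpmul2r; rewrite lee_fin//; exact/lefP/nd_nnsfun_approx.
Qed.
End Density.

Section GaussianMoments.
Context {R : realType}.
Local Notation mu := (@lebesgue_measure R).
Variable s : R.
Hypothesis s0 : 0 < s.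

Let phi (x : R) : R := normal_fun 0 s x.

Let phi_ge0 x : 0 <= phi x. Proof. exact: normal_fun_ge0. Qed.

Let dphi (x : R) : is_derive x 1 phi (- (x / s ^+ 2) * phi x).
Proof.
pose g (y : R) := (- (s ^+ 2 *+ 2)^-1) *: y ^+ 2.
have -> : phi = expR \o g.
  by apply/funext => y; rewrite /phi /normal_fun /g /= subr0 /GRing.scale /= mulNr mulrC mulNr.
have dg : is_derive x 1 g (- (x / s ^+ 2)).
  apply: is_derive_eq; rewrite /GRing.scale /=.
  by field; rewrite gt_eqF.
by rewrite mulrC; exact: is_derive1_comp (is_derive_expR (g x)) dg.
Qed.

Let cphi : continuous phi.
Proof.
by move=> x; apply: differentiable_continuous; apply/derivable1_diffP; case: (dphi x).
Qed.

(** A primitive of phi(x) - (x^2 / s^2) phi(x). It vanishes at 0 and at infinity, which equates the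
    mass of phi with its normalised second moment. *)
Let G (x : R) := x * phi x.

Let dG (x : R) : is_derive x 1 G ((1 - x ^+ 2 / s ^+ 2) * phi x).
Proof.
have := dphi x => ?; apply: is_derive_eq; rewrite /GRing.scale /=; ring.
Qed.

Let cG : continuous G.
Proof. by move=> x; apply: cvgM; [exact: cvg_id|exact: cphi]. Qed.

Let cvgG : G x @[x --> +oo] --> 0.
Proof.
have H : (2 * s ^+ 2) * x^-1 @[x --> +oo] --> (2 * s ^+ 2) * 0.
  apply: cvgMr; apply/cvgrPdist_lt => e e0.
  near=> x; have x0 : e^-1 < x by near: x; apply: nbhs_pinfty_gt; exact: num_real.
  have x1 : 0 < x by apply: lt_trans x0; rewrite invr_gt0.
  by rewrite sub0r normrN gtr0_norm ?invr_gt0// invf_plt.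
rewrite mulr0 in H.
apply: (squeeze_cvgr _ (cvg_cst 0) H); near=> x.
have x0 : 0 < x by near: x; apply: nbhs_pinfty_gt; exact: num_real.
rewrite /G mulr_ge0 ?(ltW x0)//=.
have y0 : 0 < x ^+ 2 / (s ^+ 2 *+ 2) by rewrite divr_gt0 ?exprn_gt0// mulrn_wgt0// exprn_gt0.
have -> : phi x = (expR (x ^+ 2 / (s ^+ 2 *+ 2)))^-1.
  by rewrite /phi /normal_fun subr0 mulNr expRN.
rewrite ler_pdivrMr ?expR_gt0//.
(* With y = x^2 / (2 s^2), e^y is at least 1 + y, and 2 s^2 / x times 1 + y equals 2 s^2 / x + x,
   which is at least x; hence x phi(x) is at most 2 s^2 / x. *)
apply: le_trans (_ : (2 * s ^+ 2) / x * (1 + x ^+ 2 / (s ^+ 2 *+ 2)) <= _); last first.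
  by rewrite ler_wpM2l ?expR_ge1Dx// divr_ge0 ?(ltW x0)// mulr_ge0// exprn_ge0// ltW.
have -> : 2 * s ^+ 2 / x * (1 + x ^+ 2 / (s ^+ 2 *+ 2)) = 2 * s ^+ 2 / x + x.
  by field; rewrite !gt_eqF.
by rewrite lerDr divr_ge0 ?(ltW x0)// mulr_ge0// exprn_ge0// ltW.
Unshelve. all: end_near. Qed.

Let q (x : R) := x ^+ 2 / s ^+ 2 * phi x.

Let q_ge0 x : 0 <= q x.
Proof. by rewrite mulr_ge0// divr_ge0 ?sqr_ge0. Qed.

Let cq : continuous q.
Proof.
move=> x; apply: cvgM; last exact: cphi.
by apply: cvgMl; apply: (@exprn_continuous R 2).
Qed.

Let measurable_cont (f : R -> R) D : continuous f -> measurable_fun D (fun x => (f x)%:E).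
Proof. by move=> cf; apply/measurable_EFinP; apply: measurable_funTS; apply: continuous_measurable_fun. Qed.

(** The half line is cut at s, where the derivative of [G] changes sign, so that on each piece only
    integrals of non-negative functions are added and no integrability of [q] is presupposed. *)
Let left_part : (\int[mu]_(x in `[0%R, s]) (phi x)%:E = \int[mu]_(x in `[0%R, s]) (q x)%:E + (G s)%:E)%E.
Proof.
have F : (\int[mu]_(x in `[0%R, s]) ((1 - x ^+ 2 / s ^+ 2) * phi x)%:E = (G s)%:E - (G 0)%:E)%E.
  apply: continuous_FTC2 => //.
  - apply: continuous_subspaceT => x; apply: cvgM; last exact: cphi.
    by apply: cvgB; [exact: cvg_cst|apply: cvgMl; apply: (@exprn_continuous R 2)].
  - split; [by move=> x _; case: (dG x)|apply: cvg_at_right_filter; exact: cG|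
      apply: cvg_at_left_filter; exact: cG].
  - by move=> x _; rewrite derive1E; case: (dG x) => _ ->.
rewrite /G mul0r sube0 -/(G s) in F; rewrite -F -ge0_integralD//=.
- by apply: eq_integral => x _; rewrite -EFinD /q; congr EFin; ring.
- by move=> x _; rewrite lee_fin.
- exact: measurable_cont.
- move=> x; rewrite in_itv/= => /andP[x0 xs]; rewrite lee_fin mulr_ge0// subr_ge0.
  by rewrite ler_pdivrMr ?exprn_gt0// mul1r lerXn2r// nnegrE ltW.
- apply: measurable_cont => x; apply: cvgM; last exact: cphi.
  by apply: cvgB; [exact: cvg_cst|apply: cvgMl; apply: (@exprn_continuous R 2)].
Qed.

Let right_part : (\int[mu]_(x in `[s, +oo[) (q x)%:E = \int[mu]_(x in `[s, +oo[) (phi x)%:E + (G s)%:E)%E.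
Proof.
have c1 : continuous (fun x : R => (x ^+ 2 / s ^+ 2 - 1) * phi x).
  move=> x; apply: cvgM; last exact: cphi.
  by apply: cvgB; [apply: cvgMl; apply: (@exprn_continuous R 2)|exact: cvg_cst].
have p x : s <= x -> 0 <= (x ^+ 2 / s ^+ 2 - 1) * phi x.
  move=> sx; rewrite mulr_ge0// subr_ge0 ler_pdivlMr ?exprn_gt0// mul1r lerXn2r// nnegrE ?ltW//.
  exact: lt_le_trans sx.
have dNG (x : R) : is_derive x 1 (fun x => - G x) ((x ^+ 2 / s ^+ 2 - 1) * phi x).
  by have := dG x => ?; apply: is_derive_eq; ring.
have F : (\int[mu]_(x in `[s, +oo[) ((x ^+ 2 / s ^+ 2 - 1) * phi x)%:E = 0%:E - (- G s)%:E)%E.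
  apply: (@ge0_continuous_FTC2y _ _ (fun x => - G x)) => //.
  - exact: continuous_subspaceT.
  - by rewrite -oppr0; apply: cvgN.
  - by apply: cvg_at_right_filter; apply: cvgN; exact: cG.
  - by move=> x _; rewrite derive1E; case: (dNG x) => _ ->.
rewrite -EFinB sub0r opprK in F; rewrite -F -ge0_integralD//=.
- by apply: eq_integral => x _; rewrite -EFinD /q; congr EFin; ring.
- by move=> x _; rewrite lee_fin.
- exact: measurable_cont.
- by move=> x; rewrite in_itv/= andbT => /p; rewrite lee_fin.
- exact: measurable_cont.
Qed.

Let half (f : R -> R) : continuous f -> (forall x, 0 <= f x) ->
  (\int[mu]_(x in [set x | (0 <= x)%R]) (f x)%:E
   = \int[mu]_(x in `[0%R, s]) (f x)%:E + \int[mu]_(x in `[s, +oo[) (f x)%:E)%E.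
Proof.
move=> cf f0; rewrite -set_itvcy (@itv_bndbnd_setU _ _ _ (BRight s)) ?bnd_simp ?ltW//.
rewrite ge0_integral_setU//=.
- congr (_ + _)%E; rewrite integral_itv_obnd_cbnd//; exact: measurable_cont.
- exact: measurable_cont.
- by move=> x _; rewrite lee_fin.
- by apply/disj_setPRL => x /=; rewrite !in_itv/= andbT => sx /andP[_]; rewrite leNgt sx.
Qed.

Lemma gaussian_second_moment :
  (\int[mu]_x (x ^+ 2 / s ^+ 2 * normal_fun 0 s x)%:E = \int[mu]_x (normal_fun 0 s x)%:E)%E.
Proof.
rewrite (ge0_symfun_integralT q_ge0 cq); last first.
  by move=> x; rewrite /= /q /phi /normal_fun !subr0 sqrrN.
rewrite (ge0_symfun_integralT phi_ge0 cphi); last first.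
  by move=> x; rewrite /= /phi /normal_fun !subr0 sqrrN.
congr (_ * _)%E; rewrite !half//.
by rewrite left_part right_part -addeA (addeC (G s)%:E).
Qed.
End GaussianMoments.

Section NormalLaw.
Context d (T : measurableType d) (R : realType) (P : probability T R).
Local Notation mu := (@lebesgue_measure R).
Variables (X : T -> R) (s : R).
Hypothesis mX : measurable_fun setT X.
Hypothesis s0 : 0 < s.
Hypothesis lawX : forall A, measurable A -> P (X @^-1` A) = normal_prob 0 s A.

Let sn0 : s != 0. Proof. by rewrite gt_eqF. Qed.

Let integral_law (f : R -> \bar R) : measurable_fun setT f -> (forall x, 0 <= f x)%E ->
  (\int[P]_o f (X o) = \int[mu]_x (f x * (normal_pdf 0 s x)%:E))%E.
Proof.
move=> mf f0.
have <- := @integral_density _ _ _ _ R mu (normal_prob 0 s) id (normal_pdf 0 s)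
  (@measurable_id _ _ _) (measurable_normal_pdf 0 s) (normal_pdf_ge0 0 s)
  (fun A _ => erefl) f mf f0.
rewrite (@integral_density _ _ _ _ R P (normal_prob 0 s) X (fun=> 1) mX _ _ _ f mf f0)//.
  by apply: eq_integral => x _; rewrite mule1.
move=> A mA; transitivity (P (X @^-1` A)); first by rewrite lawX.
rewrite integral_cst// ?mul1e//.
by rewrite -[X in measurable X]setTI; exact: mX.
Qed.

Lemma normal_second_moment : (\int[P]_o (X o ^+ 2)%:E = (s ^+ 2)%:E)%E.
Proof.
rewrite (integral_law (f := fun x => (x ^+ 2)%:E))//; last 2 first.
- by apply/measurable_EFinP; exact: exprn_measurable.
- by move=> x; rewrite lee_fin sqr_ge0.
have c : 0 <= s ^+ 2 * normal_peak s by rewrite mulr_ge0 ?sqr_ge0// normal_peak_ge0.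
transitivity (\int[mu]_x ((s ^+ 2 * normal_peak s)%:E * (x ^+ 2 / s ^+ 2 * normal_fun 0 s x)%:E))%E.
  apply: eq_integral => x _; rewrite normal_pdfE// -!EFinM; congr EFin; field.
  exact: sn0.
rewrite ge0_integralZl//; last 2 first.
- apply/measurable_EFinP; apply: measurable_funM; last exact: measurable_normal_fun.
  by apply: measurable_funM => //; exact: exprn_measurable.
- by move=> x _; rewrite lee_fin mulr_ge0 ?normal_fun_ge0// divr_ge0 ?sqr_ge0.
rewrite gaussian_second_moment// EFinM -muleA -ge0_integralZl//; last 3 first.
- by apply/measurable_EFinP; exact: measurable_normal_fun.
- by move=> x _; rewrite lee_fin normal_fun_ge0.
- by rewrite lee_fin normal_peak_ge0.
under eq_integral do rewrite -EFinM.
have := integral_normal_pdf 0 s; rewrite normal_pdfE// => ->.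
by rewrite mule1.
Qed.

(* With y = x^2 / (4 s^2), y^2 exp(- 2 y) <= exp(- y), and exp(- y) is, up to normalisation, the density with deviation s * sqrt 2. *)
Lemma normal_fourth_moment : (\int[P]_o (X o ^+ 4)%:E <= (64 * s ^+ 4)%:E)%E.
Proof.
rewrite (integral_law (f := fun x => (x ^+ 4)%:E))//; last 2 first.
- by apply/measurable_EFinP; exact: exprn_measurable.
- by move=> x; rewrite lee_fin exprn_even_ge0.
pose s' := Num.sqrt 2 * s.
have r2 : Num.sqrt 2 != 0 :> R by rewrite gt_eqF// sqrtr_gt0.
have s'0 : s' != 0 by rewrite mulf_neq0.
have s'2 : s' ^+ 2 = 2 * s ^+ 2 by rewrite exprMn sqr_sqrtr.
have pk : normal_peak s = Num.sqrt 2 * normal_peak s'.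
  rewrite /normal_peak s'2.
  have -> : 2 * s ^+ 2 * pi *+ 2 = 2 * (s ^+ 2 * pi *+ 2) by rewrite -mulrA -mulrnAr.
  by rewrite sqrtrM// invfM mulrA divff// mul1r.
apply: (@le_trans _ _ (\int[mu]_x ((64 * s ^+ 4)%:E * (normal_pdf 0 s' x)%:E))%E).
  apply: ge0_le_integral => //=.
  - by move=> x _; rewrite -EFinM lee_fin mulr_ge0 ?normal_pdf_ge0// exprn_even_ge0.
  - apply: emeasurable_funM; apply/measurable_EFinP; last exact: measurable_normal_pdf.
    exact: exprn_measurable.
  - by apply: emeasurable_funM; apply/measurable_EFinP => //; exact: measurable_normal_pdf.
  move=> x _; rewrite -!EFinM lee_fin !normal_pdfE// pk.
  have np0 : 0 <= normal_peak s' by exact: normal_peak_ge0.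
  pose y := x ^+ 2 / (4 * s ^+ 2).
  have y0 : 0 <= y by rewrite divr_ge0 ?sqr_ge0// mulr_ge0 ?sqr_ge0.
  have -> : normal_fun 0 s x = expR (- y) * expR (- y).
    by rewrite -expRD /normal_fun; congr expR; rewrite /y; field.
  have -> : normal_fun 0 s' x = expR (- y).
    by rewrite /normal_fun s'2; congr expR; rewrite /y; field.
  (* The constant 64 is the 16 of this identity, times 2 from y^2 e^(-y) <= 2, times 2 as a bound
     for the square root of 2 that relates the two peaks. *)
  have -> : x ^+ 4 = 16 * s ^+ 4 * y ^+ 2 by rewrite /y; field.
  have e0 := expR_ge0 (- y).
  have ye : y ^+ 2 * expR (- y) <= 2.
    rewrite expRN ler_pdivrMr ?expR_gt0//.
    have := expR_ge1Dxn 1 y0; rewrite /= => H; rewrite mulrC -ler_pdivrMr//.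
    by apply: le_trans H; rewrite lerDr.
  have sq : Num.sqrt 2 <= 2 :> R.
    by rewrite -[leLHS]ger0_norm ?sqrtr_ge0// -(@ler_pXn2r _ 2)// ?nnegrE// ger0_norm ?sqrtr_ge0// sqr_sqrtr//; lra.
  have := ler_pM (mulr_ge0 (sqr_ge0 y) e0) (sqrtr_ge0 2) ye sq => H.
  have := ler_wpM2l (mulr_ge0 (mulr_ge0 (exprn_even_ge0 s (isT : ~~ odd 4)) np0) e0) H.
  by move: (Num.sqrt 2) (normal_peak s') (expR (- y)) => a b c; lra.
rewrite ge0_integralZl//; last 3 first.
- by apply/measurable_EFinP; exact: measurable_normal_pdf.
- by move=> x _; rewrite lee_fin normal_pdf_ge0.
- by rewrite lee_fin mulr_ge0 ?exprn_even_ge0.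
by rewrite integral_normal_pdf mule1.
Qed.

(** The moments used later concern functions dominated by 1 + x^4, so the fourth moment alone
    supplies the integrability. *)
Let integrable_bound (f : R -> R) : measurable_fun setT f ->
  (forall x, `|f x| <= 1 + x ^+ 4) -> P.-integrable setT (fun o => (f (X o))%:E).
Proof.
move=> mf Hf; have mfX : measurable_fun setT (fun o => f (X o)) by apply: (measurableT_comp mf).
apply/integrableP; split; first exact/measurable_EFinP.
apply: (@le_lt_trans _ _ (\int[P]_o (1 + (X o ^+ 4)%:E))%E).
  apply: ge0_le_integral => //=.
  - by apply/measurable_EFinP; apply: measurableT_comp.
  - by apply: emeasurable_funD => //; apply/measurable_EFinP; exact: measurable_funX.
  - by move=> x _; rewrite -EFinD lee_fin; exact: Hf.
rewrite ge0_integralD//; last 2 first.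
- by move=> x _; rewrite lee_fin exprn_even_ge0.
- by apply/measurable_EFinP; exact: measurable_funX.
apply: lte_add_pinfty; first by rewrite integral_cst//= mul1e; apply: le_lt_trans (probability_le1 _ _) _ => //; rewrite ltry.
by apply: le_lt_trans normal_fourth_moment _; rewrite ltry.
Qed.

Let norm_le_fourth (x : R) : `|x| <= 1 + x ^+ 4.
Proof.
rewrite -[x ^+ 4]/(x ^+ (2 * 2)) exprM -[x ^+ 2]ger0_norm ?sqr_ge0// normrX; move: `|x| => y.
have := sqr_ge0 (y ^+ 2 - 1 / 2); have := sqr_ge0 (y - 1 / 2); lra.
Qed.

Lemma normal_integrable : P.-integrable setT (fun o => (X o)%:E).
Proof.
exact: (integrable_bound (f := id) _ norm_le_fourth).
Qed.
Lemma normal_sqr_integrable : P.-integrable setT (fun o => (X o ^+ 2)%:E).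
Proof.
apply: (integrable_bound (f := fun x => x ^+ 2)) => [|x]; first exact: exprn_measurable.
by rewrite ger0_norm ?sqr_ge0// -[x ^+ 4]/(x ^+ (2 * 2)) exprM; move: (sqr_ge0 (x ^+ 2 - 1 / 2)); lra.
Qed.

(** The positive and the negative part are computed apart, since [integral_law] needs a non-negative
    integrand; the substitution x to -x and the symmetry of the density show that they have the same
    integral, which is finite. *)
Lemma normal_mean : (\int[P]_o (X o)%:E = 0)%E.
Proof.
have pN x : normal_pdf 0 s (- x) = normal_pdf 0 s x.
  by rewrite normal_pdfE//= /normal_fun !subr0 sqrrN.
have p0 := normal_pdf_ge0 0 s.
have cp : continuous (normal_pdf 0 s) by exact: continuous_normal_pdf.
have pos : (\int[P]_o (Num.max (X o) 0)%:E = \int[mu]_(x in `[0%R, +oo[) (x * normal_pdf 0 s x)%:E)%E.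
  rewrite (integral_law (f := fun x => (Num.max x 0)%:E)).
  - rewrite [RHS]integral_mkcond; apply: eq_integral => x _.
    rewrite patchE -EFinM; case: ifPn; rewrite ?(inE, notin_setE)/= in_itv/= andbT.
      by move=> x0; rewrite max_l.
    by move=> /negP; rewrite -ltNge => /ltW x0; rewrite max_r// mul0r.
  - by apply/measurable_EFinP; exact: measurable_maxr.
  - by move=> x; rewrite lee_fin le_max lexx orbT.
have neg : (\int[P]_o (Num.max (- X o) 0)%:E = \int[mu]_(x in `[0%R, +oo[) (x * normal_pdf 0 s x)%:E)%E.
  rewrite (integral_law (f := fun x => (Num.max (- x) 0)%:E)).
  - transitivity (\int[mu]_(x in `]-oo, (- 0)%R]) (- x * normal_pdf 0 s x)%:E)%E; last first.
      rewrite (@ge0_integration_by_substitutionNy _ (fun x => - x * normal_pdf 0 s x) 0).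
      + by apply: eq_integral => x _ /=; rewrite opprK pN.
      + apply: continuous_subspaceT => x; apply: cvgM; last exact: cp.
        by apply: cvgN; exact: cvg_id.
      + by move=> x; rewrite in_itv/= oppr0 => x0; rewrite mulr_ge0// oppr_ge0 ltW.
    rewrite [RHS]integral_mkcond; apply: eq_integral => x _.
    rewrite patchE -EFinM; case: ifPn; rewrite ?(inE, notin_setE)/= in_itv/= oppr0.
      by move=> x0; rewrite max_l// oppr_ge0.
    by move=> /negP; rewrite -ltNge => /ltW x0; rewrite max_r ?mul0r// oppr_le0.
  - by apply/measurable_EFinP; apply: measurable_maxr => //; exact: oppr_measurable.
  - by move=> x; rewrite lee_fin le_max lexx orbT.
have iX := normal_integrable.
have ip : P.-integrable setT (fun o => (Num.max (X o) 0)%:E).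
  apply: (integrable_bound (f := fun x => Num.max x 0)) => [|x]; first exact: measurable_maxr.
  apply: le_trans (norm_le_fourth x).
  by case: (lerP x 0) => x0; rewrite ?normr0.
have fin : ((\int[P]_o (Num.max (X o) 0)%:E)%E \is a fin_num) by apply: integrable_fin_num.
rewrite integralE (_ : _ - _ = \int[P]_o (Num.max (X o) 0)%:E - \int[P]_o (Num.max (- X o) 0)%:E)%E.
  by rewrite neg -pos subee.
by congr (_ - _)%E; apply: eq_integral => x _; rewrite ?funeposE ?funenegE EFin_max.
Qed.
End NormalLaw.

(** * Independence *)

Section Independence.
Context d (T : measurableType d) (R : realType) (P : probability T R).

Lemma preimage_measurable (f : T -> R) A : measurable_fun setT f -> measurable A ->
  measurable (f @^-1` A).
Proof. by move=> mf mA; rewrite -[X in measurable X]setTI; exact: mf. Qed.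

(** Both sides are finite measures in A and agree on the pi-system [G], hence on the sigma-algebra
    it generates. The event [W] stays fixed, so independence is extended in one argument only. *)
Lemma independent_g_sigma_algebra (G : set (set T)) (W : set T) :
  G `<=` measurable -> setI_closed G -> G setT -> measurable W ->
  (forall A, G A -> P (A `&` W) = (P A * P W)%E) ->
  forall A, <<s G >> A -> P (A `&` W) = (P A * P W)%E.
Proof.
move=> Gm GI GT mW H A sA.
have pW : 0 <= fine (P W) by exact: fine_ge0.
have PWE : (fine (P W))%:E = P W by rewrite fineK// fin_num_measure.
transitivity ((fine (P W))%:E * P A)%E; last by rewrite PWE muleC.
apply: (@g_sigma_algebra_measure_unique _ R T G Gm (fun=> setT) (fun=> GT) _
  (mrestr P mW) (mscale (NngNum pW) P)) => //.
- by apply/seteqP; split => // x _; exists 0%N.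
- by move=> B GB; transitivity (P B * P W)%E; [exact: H|rewrite muleC -[in LHS]PWE].
- move=> _; rewrite -[X in (X < _)%E]/(P (setT `&` W)) setTI.
  by apply: le_lt_trans (probability_le1 _ mW) _; rewrite ltry.
Qed.

Section Expectations.
Variables X Y : T -> R.
Hypothesis mX : measurable_fun setT X.
Hypothesis mY : measurable_fun setT Y.
Hypothesis XY : forall A B, measurable A -> measurable B ->
  P (X @^-1` A `&` Y @^-1` B) = (P (X @^-1` A) * P (Y @^-1` B))%E.

(** Independence makes the joint law of (X, Y) the product of the two laws; Fubini for x y then
    gives integrability of the product and the factorisation together. *)
Lemma independent_expectationM :
  P.-integrable setT (EFin \o X) -> P.-integrable setT (EFin \o Y) ->
  P.-integrable setT (fun o => (X o * Y o)%:E) /\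
  (\int[P]_o (X o * Y o)%:E = \int[P]_o (X o)%:E * \int[P]_o (Y o)%:E)%E.
Proof.
move=> iX iY.
pose X' : {mfun T >-> R} := HB.pack X (isMeasurableFun.Build _ _ _ _ X mX).
pose Y' : {mfun T >-> R} := HB.pack Y (isMeasurableFun.Build _ _ _ _ Y mY).
pose Z o := (X o, Y o).
have mZ : measurable_fun setT Z by exact: measurable_fun_pair.
pose Z' : {mfun T >-> (R * R)%type} := HB.pack Z (isMeasurableFun.Build _ _ _ _ Z mZ).
pose mu1 := distribution P X'; pose mu2 := distribution P Y'.
have law S : measurable S -> (mu1 \x mu2)%E S = distribution P Z' S.
  by apply: product_measure_unique => A B mA mB; exact: XY.
pose f (z : R * R) : \bar R := (z.1 * z.2)%:E.
have mf : measurable_fun setT f by apply/measurable_EFinP; exact: measurable_funM.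
have iX' : mu1.-integrable setT EFin.
  apply/integrableP; split; first exact: EFin_measurable.
  by case/integrableP: iX => _; rewrite ge0_integral_distribution//; exact: measurableT_comp.
have iY' : mu2.-integrable setT EFin.
  apply/integrableP; split; first exact: EFin_measurable.
  by case/integrableP: iY => _; rewrite ge0_integral_distribution//; exact: measurableT_comp.
have EX : (\int[mu1]_x x%:E = \int[P]_o (X o)%:E)%E by rewrite integral_distribution.
have EY : (\int[mu2]_x x%:E = \int[P]_o (Y o)%:E)%E by rewrite integral_distribution.
have if_ : (mu1 \x mu2)%E.-integrable setT f.
  apply/(integrable12ltyP _ _ mf).
  under eq_integral => x _.
    under eq_integral do rewrite /f /= normrM EFinM.
    rewrite ge0_integralZl//; last exact: measurableT_comp.
    over.
  have fY : (\int[mu2]_y (`|y|%:E) < +oo)%E by case/integrableP : iY'.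
  rewrite ge0_integralZr//; last 2 first.
  - exact: measurableT_comp.
  - exact: integral_ge0.
  have fX : (\int[mu1]_y (`|y|%:E) < +oo)%E by case/integrableP : iX'.
  by apply: lte_mul_pinfty => //; [exact: integral_ge0|rewrite ge0_fin_numE//; exact: integral_ge0].
have iXY : P.-integrable setT (fun o => (X o * Y o)%:E).
  apply/integrableP; split; first by apply/measurable_EFinP; exact: measurable_funM.
  case/integrableP : if_ => _; rewrite (eq_measure_integral (distribution P Z')); last by move=> A mA _; exact: law.
  by rewrite ge0_integral_distribution//; exact: measurableT_comp.
split=> //; transitivity (\int[distribution P Z']_z f z)%E; first by rewrite integral_distribution.
rewrite (eq_measure_integral (mu1 \x mu2)%E); last by move=> A mA _; apply/esym; exact: law.
rewrite -fubini1// -EX -EY.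
under eq_integral => x _.
  rewrite /fubini_F /f /=; under eq_integral do rewrite EFinM.
  rewrite integralZl//.
  over.
have fY : ((\int[mu2]_y y%:E)%E \is a fin_num) by apply: integrable_fin_num.
by rewrite /= -(fineK fY) integralZr.
Qed.
End Expectations.

(** Meant for the mixed second-order terms: [X] is a coefficient known from the past, [Y] and [Z]
    are two coordinates of one increment. The events X in A, Y in B form a pi-system, and X Y is
    measurable for the sigma-algebra they generate. *)
Lemma independentM (X Y Z : T -> R) :
  measurable_fun setT X -> measurable_fun setT Y -> measurable_fun setT Z ->
  (forall A B C, measurable A -> measurable B -> measurable C ->
    P (X @^-1` A `&` Y @^-1` B `&` Z @^-1` C) =
    (P (X @^-1` A `&` Y @^-1` B) * P (Z @^-1` C))%E) ->
  forall A C, measurable A -> measurable C ->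
    P ((fun o => X o * Y o) @^-1` A `&` Z @^-1` C) =
    (P ((fun o => X o * Y o)%R @^-1` A) * P (Z @^-1` C))%E.
Proof.
move=> mX mY mZ H A C mA mC.
pose G := [set E | exists A B, [/\ measurable A, measurable B & E = X @^-1` A `&` Y @^-1` B]].
apply: (@independent_g_sigma_algebra G).
- move=> _ [B1 [B2 [m1 m2 ->]]]; apply: measurableI; exact: preimage_measurable.
- move=> _ _ [B1 [B2 [m1 m2 ->]]] [B3 [B4 [m3 m4 ->]]].
  exists (B1 `&` B3), (B2 `&` B4); split; [exact: measurableI..|].
  by rewrite !preimage_setI setIACA.
- by exists setT, setT; split => //; rewrite !preimage_setT setIT.
- exact: preimage_measurable.
- by move=> _ [B1 [B2 [m1 m2 ->]]]; exact: H.
have gX : measurable_fun setT (X : g_sigma_algebraType G -> R).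
  move=> _ B mB; rewrite setTI; apply: sub_sigma_algebra.
  by exists B, setT; split => //; rewrite preimage_setT setIT.
have gY : measurable_fun setT (Y : g_sigma_algebraType G -> R).
  move=> _ B mB; rewrite setTI; apply: sub_sigma_algebra.
  by exists setT, B; split => //; rewrite preimage_setT setTI.
have := measurable_funM gX gY => /(_ measurableT _ mA).
by rewrite setTI.
Qed.
End Independence.

(** * Wiener increments and the backward filtration *)

Section WienerIncrements.
Context {R : realType} {d : nat} {dO : measure_display}
        {Omega : measurableType dO} (P : probability Omega R).
Variables (a : R) (w : R -> Omega -> 'rV[R]_d).
Hypothesis wW : wiener P a w.

Lemma wiener_measurable s i : a <= s -> measurable_fun setT (fun o => w s o 0 i).
Proof. by case: wW => + _ _; apply. Qed.

Lemma wiener_increment_measurable s s' i : a <= s -> a <= s' ->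
  measurable_fun setT (fun o => (w s' o - w s o) 0 i).
Proof.
move=> as_ as'; have -> : (fun o => (w s' o - w s o) 0 i) = (fun o => w s' o 0 i - w s o 0 i).
  by apply/funext => o; rewrite !mxE.
by apply: measurable_funB; exact: wiener_measurable.
Qed.

Lemma wiener_increment_law s s' i A : a <= s -> s < s' -> measurable A ->
  P ((fun o => (w s' o - w s o) 0 i) @^-1` A) = normal_prob 0 (Num.sqrt (s' - s)) A.
Proof.
move=> as_ ss' mA; case: wW => _ _ /(_ s [:: s'] as_); rewrite /= ss' => /(_ isT) [_].
by move=> /(_ (ord0, i) A mA).
Qed.

Section PastIndependence.
Variables (s s' t : R).
Hypothesis as_ : a <= s.
Hypothesis ss' : s < s'.
Hypothesis s't : s' <= t.

Let box (B : 'I_d -> set R) : set Omega :=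
  \bigcap_(i in [set: 'I_d]) ((fun o => (w s' o - w s o) 0 i) @^-1` B i).

Let mbox B : (forall i, measurable (B i)) -> measurable (box B).
Proof.
move=> mB; apply: fin_bigcap_measurable; first exact: finite_finset.
move=> i _; apply: preimage_measurable => //.
by apply: wiener_increment_measurable => //; exact: le_trans (ltW ss').
Qed.

Section Partition.
Variable rest : seq R.
Hypothesis prest : path <%R s' rest.
Let l := s' :: rest.
Let incr (k : 'I_(size l) * 'I_d) (o : Omega) : R :=
  (w (tick s l k.1.+1) o - w (tick s l k.1) o) 0 k.2.

Let tick_ge k : (k <= size l)%N -> a <= tick s l k.
Proof.
move=> kl; apply: le_trans as_ _; rewrite /tick; case: k kl => // k kl /=.
have pl : path <%R s l by rewrite /= ss'.
have /allP H := order_path_min lt_trans pl.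
by apply/ltW/H/mem_nth.
Qed.

Let mincr k : measurable_fun setT (incr k).
Proof.
by apply: wiener_increment_measurable; apply: tick_ge; [exact/ltnW/ltn_ord|exact: ltn_ord].
Qed.

(** The past is that of backward time, so it is made of the cells after s'. Index 0 is the cell from
    s to s' itself and is left free. *)
Let past_rect : set (set Omega) := [set A | exists C : 'I_(size l) * 'I_d -> set R,
  [/\ forall k, measurable (C k), forall k : 'I_(size l) * 'I_d, nat_of_ord k.1 = 0%N -> C k = setT &
      A = \bigcap_(k in setT) (incr k @^-1` C k)]].

Let past_rect_measurable : past_rect `<=` measurable.
Proof.
move=> _ [C [mC _ ->]]; apply: fin_bigcap_measurable; first exact: finite_finset.
by move=> k _; exact: preimage_measurable.
Qed.

Let past_rect_indep A B : past_rect A -> (forall i, measurable (B i)) ->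
  P (A `&` box B) = (P A * P (box B))%E.
Proof.
move=> [C [mC C0 ->]] mB.
have [|ind _] := (let: And3 _ _ h := wW in h) s l as_; first by rewrite /= ss'.
pose D (k : 'I_(size l) * 'I_d) := if nat_of_ord k.1 == 0%N then B k.2 else setT.
have mD k : measurable (D k) by rewrite /D; case: ifP.
have boxE : box B = \bigcap_(k in setT) (incr k @^-1` D k).
  apply/seteqP; split => x H.
    move=> [[[|k] ki] i] _ //=; rewrite /D/=; exact: H.
  by move=> i _; apply: (H (ord0, i)).
have -> : \bigcap_(k in setT) (incr k @^-1` C k) `&` box B =
    \bigcap_(k in setT) (incr k @^-1` (C k `&` D k)).
  rewrite boxE; apply/seteqP; split => x.
    by move=> [H1 H2] k _; split; [exact: H1|exact: H2].
  by move=> H; split => k _; case: (H k I).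
rewrite boxE (ind C mC) (ind D mD) ind; last by move=> k; exact: measurableI.
rewrite -big_split; apply: eq_bigr => k _ /=.
rewrite /D; case: ifPn => [/eqP k0|_].
  by rewrite C0// setTI preimage_setT probability_setT mul1e.
by rewrite setIT preimage_setT probability_setT mule1.
Qed.

Let past_indep A B : <<s past_rect >> A -> (forall i, measurable (B i)) ->
  P (A `&` box B) = (P A * P (box B))%E.
Proof.
move=> pA mB; apply: (@independent_g_sigma_algebra _ _ _ _ past_rect) => //.
- move=> _ _ [C [mC C0 ->]] [D [mD D0 ->]]; exists (fun k => C k `&` D k); split.
  + by move=> k; exact: measurableI.
  + by move=> k k0; rewrite C0// D0// setIT.
  + apply/seteqP; split => x.
      by move=> [H1 H2] k _; split; [exact: H1|exact: H2].
    by move=> H; split => k _; case: (H k I).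
- by exists (fun=> setT); split => //; apply/seteqP; split.
- exact: mbox.
- by move=> E rE; exact: past_rect_indep.
Qed.

(** The value of w at a later tick minus its value at s' is the sum of the increments over the cells
    in between, whence the induction. *)
Let measurable_past k i : (k < size l)%N ->
  measurable_fun setT ((fun o => (w (nth s l k) o - w s' o) 0 i) : g_sigma_algebraType past_rect -> R).
Proof.
elim: k => [|k IH] kl.
  rewrite [X in measurable_fun _ X](_ : _ = cst 0); first exact: measurable_cst.
  by apply/funext => o /=; rewrite subrr mxE.
pose K : 'I_(size l) * 'I_d := (Ordinal kl, i).
rewrite [X in measurable_fun _ X](_ : _ = (fun o => (w (nth s l k) o - w s' o) 0 i + incr K o)).
  apply: measurable_funD; first exact: (IH (ltnW kl)).
  move=> _ B mB; rewrite setTI; apply: sub_sigma_algebra.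
  exists (fun k => if k == K then B else setT); split.
  - by move=> k'; case: ifP.
  - by move=> k' k0; case: eqP => // kK; move: k0; rewrite kK.
  - apply/seteqP; split => x.
      by move=> Bx k' _ /=; case: eqP => // ->.
    by move=> /(_ K I) /=; rewrite eqxx.
by apply/funext => o; rewrite /incr /tick /= !mxE; ring.
Qed.

Lemma cylinder_independent n (r : 'I_n -> R) (c : 'I_n -> 'I_d) (C : 'I_n -> set R) B :
  t \in l -> (forall k, r k \in l) -> (forall k, measurable (C k)) ->
  (forall i, measurable (B i)) ->
  let A := \bigcap_(k in setT) [set o | C k ((w t o - w (r k) o) 0 (c k))] in
  P (A `&` box B) = (P A * P (box B))%E.
Proof.
move=> tl rl mC mB A; apply: past_indep => //.
have : @measurable _ (g_sigma_algebraType past_rect) A.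
  apply: fin_bigcap_measurable; first exact: finite_finset.
  move=> k _; rewrite -[X in measurable X]setTI.
  have -> : [set o | C k ((w t o - w (r k) o) 0 (c k))] =
     (fun o => (w t o - w s' o) 0 (c k) - (w (r k) o - w s' o) 0 (c k)) @^-1` C k.
    apply/seteqP; split => x /=; rewrite !mxE; move: (w t x 0 (c k)) (w s' x 0 (c k)) (w (r k) x 0 (c k)) => u v z;
     by have -> : u - v - (z - v) = u - z by ring.
  have H x i : x \in l -> measurable_fun setT ((fun o => (w x o - w s' o) 0 i) : g_sigma_algebraType past_rect -> R).
    by move=> xl; rewrite -{1}(nth_index s xl); apply: measurable_past; rewrite index_mem.
  by apply: (measurable_funB (H _ _ tl) (H _ _ (rl k))).
by [].
Qed.
End Partition.

Let cylinders : set (set Omega) := [set A | exists n (r : 'I_n -> R) (c : 'I_n -> 'I_d) (C : 'I_n -> set R),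
  [/\ forall k, s' <= r k <= t, forall k, measurable (C k) &
     A = \bigcap_(k in setT) [set o | C k ((w t o - w (r k) o) 0 (c k))]]].

Let cylinders_indep A B : cylinders A -> (forall i, measurable (B i)) ->
  P (A `&` box B) = (P A * P (box B))%E.
Proof.
move=> [n [r [c [C [rs mC ->]]]]] mB.
(* Finitely many times are turned into a partition: those strictly after s' are sorted without
   repetition, so that they increase strictly, and s' is put in front of them. *)
pose rest := sort <=%R (undup [seq x <- t :: codom r | s' < x]).
have inl x : x \in t :: codom r -> s' <= x -> x \in s' :: rest.
  rewrite le_eqVlt => xr /predU1P[->|sx]; first by rewrite mem_head.
  by rewrite inE mem_sort mem_undup mem_filter sx xr orbT.
apply: (@cylinder_independent rest) => //.
- rewrite path_min_sorted; first by rewrite sort_lt_sorted undup_uniq.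
  by apply/allP => x; rewrite mem_sort mem_undup mem_filter => /andP[].
- by apply: inl => //; rewrite mem_head.
- move=> k; apply: inl; last by case/andP: (rs k).
  by rewrite inE codom_f orbT.
Qed.

(** The generators of [increments_sigma] are not closed under intersection; finite cylinders are,
    and the sigma-algebra they generate contains [increments_sigma]. *)
Lemma past_increments_independent A B : increments_sigma w t s' A ->
  (forall i, measurable (B i)) -> P (A `&` box B) = (P A * P (box B))%E.
Proof.
move=> iA mB; apply: (@independent_g_sigma_algebra _ _ _ _ cylinders).
- move=> _ [n [r [c [C [rs mC ->]]]]]; apply: fin_bigcap_measurable; first exact: finite_finset.
  move=> k _; apply: (@preimage_measurable _ _ _ (fun o => (w t o - w (r k) o) 0 (c k)) (C k)) => //.
  have /andP[sr rt] := rs k; have as' := le_trans as_ (ltW ss').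
  by apply: wiener_increment_measurable; [exact: le_trans sr|exact: le_trans s't].
- move=> _ _ [n1 [r1 [c1 [C1 [rs1 m1 ->]]]]] [n2 [r2 [c2 [C2 [rs2 m2 ->]]]]].
  pose g T (f1 : 'I_n1 -> T) (f2 : 'I_n2 -> T) k := match fintype.split k with inl i => f1 i | inr j => f2 j end.
  exists (n1 + n2)%N, (g _ r1 r2), (g _ c1 c2), (g _ C1 C2); split.
  + by move=> k; rewrite /g; case: fintype.split.
  + by move=> k; rewrite /g; case: fintype.split.
  + apply/seteqP; split => x.
      by move=> [H1 H2] k _; rewrite /g /=; case: fintype.split => j; [exact: H1|exact: H2].
    move=> H; split => k _.
      have := H (lshift n2 k) I; rewrite /g /= (unsplitK (inl k)); exact.
    have := H (rshift n1 k) I; rewrite /g /= (unsplitK (inr k)); exact.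
- have c0 : 'I_0 -> 'I_d by case=> m; rewrite ltn0.
  exists 0%N, (fun=> s'), c0, (fun=> setT); split => //.
    by move=> _; rewrite lexx.
  by apply/seteqP; split.
- exact: mbox.
- by move=> E cE; exact: cylinders_indep.
move: iA; apply: smallest_sub; first exact: smallest_sigma_algebra.
move=> _ [r [i [C [rs mC ->]]]]; apply: sub_sigma_algebra.
exists 1%N, (fun=> r), (fun=> i), (fun=> C); split => //.
by apply/seteqP; split => x; [move=> H k _|move=> /(_ ord0 I)].
Qed.

Let as' : a <= s'. Proof. exact: le_trans (ltW ss'). Qed.

Lemma increments_sigma_measurable r A : a <= r -> increments_sigma w t r A -> measurable A.
Proof.
move=> ar; apply: smallest_sub.
  by split; [exact: measurable0|move=> B mB; rewrite setTD; exact: measurableC|exact: bigcupT_measurable].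
move=> _ [r' [i [C [/andP[rr' r't] mC ->]]]].
apply: (@preimage_measurable _ _ _ (fun o => (w t o - w r' o) 0 i) C) => //.
have ar' := le_trans ar rr'.
by apply: wiener_increment_measurable => //; exact: le_trans r't.
Qed.

(** An event of the augmented filtration differs by a null event from one of [increments_sigma], and
    null events change no probability on either side. *)
Lemma backward_filtration_independent A B : backward_filtration P w t s' A ->
  (forall i, measurable (B i)) -> P (A `&` box B) = (P A * P (box B))%E.
Proof.
move=> [mA [A' iA' AA']] mB; have mA' := increments_sigma_measurable as' iA'.
have mD := measurableU _ _ (measurableD mA mA') (measurableD mA' mA).
have eqP (C : set Omega) : measurable C -> P (A `&` C) = P (A' `&` C).
  move=> mC; apply/eqP; rewrite eq_le; apply/andP; split.
    rewrite -[leRHS]adde0 -AA'; apply: le_trans (measureU2 _ _ _); last 2 first.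
    - exact: measurableI.
    - exact: mD.
    rewrite le_measure ?inE//; [exact: measurableI|apply: measurableU => //; exact: measurableI|].
    by move=> x [Ax Cx]; case: (pselect (A' x)) => ?; [left|right; left].
  rewrite -[leRHS]adde0 -AA'; apply: le_trans (measureU2 _ _ _); last 2 first.
  - exact: measurableI.
  - exact: mD.
  rewrite le_measure ?inE//; [exact: measurableI|apply: measurableU => //; exact: measurableI|].
  by move=> x [Ax Cx]; case: (pselect (A x)) => ?; [left|right; right].
have -> : P A = P A' by have := eqP _ measurableT; rewrite !setIT.
by rewrite eqP; [exact: past_increments_independent|exact: mbox].
Qed.

Let h := s' - s.
Let Wi i (o : Omega) : R := (w s' o - w s o) 0 i.
Let mW i : measurable_fun setT (Wi i).
Proof. exact: wiener_increment_measurable. Qed.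
Let lawW i A : measurable A -> P ((Wi i) @^-1` A) = normal_prob 0 (Num.sqrt h) A.
Proof. exact: wiener_increment_law. Qed.
Let h0 : 0 < Num.sqrt h. Proof. by rewrite sqrtr_gt0 subr_gt0. Qed.
Let iW i := normal_integrable (mW i) h0 (@lawW i).
Let iW2 i := normal_sqr_integrable (mW i) h0 (@lawW i).
Let EW i := normal_mean (mW i) h0 (@lawW i).

Let box1 i B : box (fun j => if j == i then B else setT) = (Wi i) @^-1` B.
Proof.
apply/seteqP; split => x; first by move=> /(_ i I); rewrite /= eqxx.
by move=> Wx j _; case: eqP => [->|].
Qed.

Let indep1 A i B : backward_filtration P w t s' A -> measurable B ->
  P (A `&` (Wi i) @^-1` B) = (P A * P ((Wi i) @^-1` B))%E.
Proof.
move=> FA mB; rewrite -box1; apply: backward_filtration_independent => // j.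
by case: ifP.
Qed.

Let indep2 i j A B : i != j -> measurable A -> measurable B ->
  P ((Wi i) @^-1` A `&` (Wi j) @^-1` B)
  = (P ((Wi i) @^-1` A) * P ((Wi j) @^-1` B))%E.
Proof.
move=> ij mA mB.
have [|ind _] := (let: And3 _ _ h := wW in h) s [:: s'] as_; first by rewrite /= ss'.
pose C (k : 'I_1 * 'I_d) := if k.2 == i then A else if k.2 == j then B else setT.
have mC k : measurable (C k) by rewrite /C; case: ifP => // _; case: ifP.
have := ind C mC.
have -> : \bigcap_(k in [set: 'I_(size [:: s']) * 'I_d]) ((fun o => (w (tick s [:: s'] k.1.+1) o - w (tick s [:: s'] k.1) o) 0 k.2) @^-1` C k) =
  (Wi i) @^-1` A `&` (Wi j) @^-1` B.
  apply/seteqP; split => x.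
    move=> H; split; [have := H (ord0, i) I|have := H (ord0, j) I]; rewrite /C /= eqxx//.
    by rewrite eq_sym (negbTE ij).
  move=> [H1 H2] [k c] _; rewrite ord1 /C /=; case: eqP => [->//|_].
  by case: eqP => [->|].
move=> ->; rewrite (bigD1 (ord0, i))//= (bigD1 (ord0, j))/=; last first.
  by rewrite xpair_eqE eqxx /= eq_sym.
rewrite big1 ?mule1; first by rewrite /C/= !eqxx eq_sym (negbTE ij).
move=> [k c]; rewrite ord1 !xpair_eqE !eqxx/= /C/= => /andP[/negbTE -> /negbTE ->].
by rewrite preimage_setT probability_setT.
Qed.

Section AdaptedCoefficient.
Variables (xi : Omega -> R) (C : R).
Hypothesis Fxi : forall B, measurable B -> backward_filtration P w t s' (xi @^-1` B).
Hypothesis xiC : forall o, `|xi o| <= C.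

Let mxi : measurable_fun setT xi.
Proof. by move=> _ B mB; rewrite setTI; case: (Fxi mB). Qed.

Let ixi : P.-integrable setT (fun o => (xi o)%:E).
Proof.
apply: measurable_bounded_integrable => //.
- by apply: le_lt_trans (probability_le1 _ measurableT) _; rewrite ltry.
- by exists C; split; rewrite ?num_real// => x Cx o _; apply: le_trans (xiC o) (ltW Cx).
Qed.

Let indep_xi i A B : measurable A -> measurable B ->
  P (xi @^-1` A `&` (Wi i) @^-1` B) = (P (xi @^-1` A) * P ((Wi i) @^-1` B))%E.
Proof. by move=> mA mB; apply: indep1 => //; exact: Fxi. Qed.

(** The assumptions on [xi] are those of a bounded coefficient frozen at the later end s' of a cell.
    With the next two lemmas this covers the terms of a second-order expansion: first order,
    diagonal and mixed second order. *)
Lemma adapted_increment i : P.-integrable setT (fun o => (xi o * Wi i o)%:E) /\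
  (\int[P]_o (xi o * Wi i o)%:E = 0)%E.
Proof.
have [? E] := independent_expectationM mxi (mW i) (@indep_xi i) ixi (iW i).
by rewrite E EW mule0.
Qed.

Lemma adapted_increment_sqr i :
  P.-integrable setT (fun o => (xi o * (Wi i o ^+ 2 - h))%:E) /\
  (\int[P]_o (xi o * (Wi i o ^+ 2 - h))%:E = 0)%E.
Proof.
pose Y o := Wi i o ^+ 2 - h.
have mg : measurable_fun setT (fun x : R => x ^+ 2 - h).
  by apply: measurable_funB => //; exact: exprn_measurable.
have mY : measurable_fun setT Y by exact: (measurableT_comp mg (mW i)).
have ic : P.-integrable setT (EFin \o (fun _ : Omega => h)).
  by apply: finite_measure_integrable_cst.
have iY : P.-integrable setT (EFin \o Y).
  by rewrite (_ : _ \o _ = (fun o => (Wi i o ^+ 2)%:E - h%:E)%E)//; apply: integrableB.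
have EY : (\int[P]_o (Y o)%:E = 0)%E.
  under eq_integral do rewrite /Y EFinB.
  rewrite integralB// (normal_second_moment (mW i) h0 (@lawW i)) sqr_sqrtr ?subr_ge0 ?ltW//.
  by rewrite integral_cst// [X in (_ - _ * X)%E]probability_setT mule1 subee.
have [|? E] := independent_expectationM mxi mY _ ixi iY; last by rewrite E EY mule0.
move=> A B mA mB.
have -> : Y @^-1` B = (Wi i) @^-1` ((fun x => x ^+ 2 - h) @^-1` B) by [].
by apply: indep_xi => //; exact: preimage_measurable.
Qed.

(** The past is independent of the whole increment, and the coordinates of the increment are
    independent of each other; hence the product of [xi] with one coordinate is independent of the
    other coordinate, and both factors are centered. *)
Lemma adapted_increment_cross i j : i != j ->
  P.-integrable setT (fun o => (xi o * (Wi i o * Wi j o))%:E) /\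
  (\int[P]_o (xi o * (Wi i o * Wi j o))%:E = 0)%E.
Proof.
move=> ij; have [iX EX] := adapted_increment i.
have mX : measurable_fun setT (fun o => xi o * Wi i o) by exact: measurable_funM.
have [|? E] := independent_expectationM mX (mW j) _ iX (iW j); last first.
  by split; under eq_fun do rewrite mulrA; rewrite ?E ?EX ?mul0e.
apply: (@independentM _ _ _ P xi (Wi i) (Wi j)) => // A B D mA mB mD.
pose S k := if k == i then B else if k == j then D else setT.
have mS k : measurable (S k) by rewrite /S; case: ifP => // _; case: ifP.
have bE : box S = (Wi i) @^-1` B `&` (Wi j) @^-1` D.
  apply/seteqP; split => x.
    move=> H; split; [have := H i I|have := H j I]; rewrite /S /= eqxx//.
    by rewrite eq_sym (negbTE ij).
  move=> [H1 H2] c _; rewrite /S /=; case: eqP => [->//|_].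
  by case: eqP => [->|].
rewrite -setIA -bE backward_filtration_independent//; last exact: Fxi.
by rewrite bE indep2// indep_xi// muleA.
Qed.
End AdaptedCoefficient.

End PastIndependence.
End WienerIncrements.

(** * Second-order expansion over a cell *)

Section Sums.
Context {R : realType} {d : nat}.

Lemma coord_le_norm (x : 'rV[R]_d) i : `|x 0 i| <= `|x|.
Proof.
rewrite [leRHS]/Num.norm /= mx_normrE.
exact: (le_bigmax _ (fun ij : 'I_1 * 'I_d => `|x ij.1 ij.2|) (0, i)).
Qed.

Lemma norm_le_coord (x : 'rV[R]_d) (c : R) : 0 <= c -> (forall i, `|x 0 i| <= c) -> `|x| <= c.
Proof.
move=> c0 H; rewrite [leLHS]/Num.norm /= mx_normrE; apply/bigmax_leP; split => // -[i j] _ /=.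
by rewrite ord1.
Qed.

Lemma ler_norm_sum_ord (f : 'I_d -> R) (c : R) : (forall i, `|f i| <= c) ->
  `|\sum_i f i| <= d%:R * c.
Proof.
move=> H; apply: le_trans (ler_norm_sum _ _ _) _.
apply: le_trans (ler_sum _ (fun i _ => H i)) _.
by rewrite sumr_const card_ord mulr_natl.
Qed.

Lemma ler_norm_sum_ord2 (f : 'I_d -> 'I_d -> R) (c : R) : (forall i j, `|f i j| <= c) ->
  `|\sum_i \sum_j f i j| <= d%:R ^+ 2 * c.
Proof.
by move=> H; rewrite expr2 -mulrA; apply: ler_norm_sum_ord => i; exact: ler_norm_sum_ord.
Qed.

Lemma ler_normM (x y b c : R) : `|x| <= b -> `|y| <= c -> `|x * y| <= b * c.
Proof. by move=> xb yc; rewrite normrM ler_pM. Qed.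
End Sums.

Section Cells.
Context {R : realType} {d : nat}.

Section Expansion.
Variables (T : set R) (v vt : R -> 'rV[R]_d -> R) (v1 : 'I_d -> R -> 'rV[R]_d -> R)
  (v2 : 'I_d -> 'I_d -> R -> 'rV[R]_d -> R).
Hypothesis cv : continuous_on T v.
Hypothesis c1 : forall i, continuous_on T (v1 i).
Hypothesis c2 : forall i j, continuous_on T (v2 i j).
Hypothesis dx : forall i s x, T s -> is_derive x (delta_mx 0 i) (v s) (v1 i s x).
Hypothesis dxx : forall i j s x, T s -> is_derive x (delta_mx 0 j) (v1 i s) (v2 i j s x).

Lemma time_increment s s' x : s <= s' -> `[s, s'] `<=` T ->
  (forall r, s < r < s' -> is_derive r 1 (v^~ x) (vt r x)) ->
  exists2 r, s <= r <= s' & v s' x - v s x = (s' - s) * vt r x.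
Proof.
move=> ss sT dv.
have [r rs ->] := MVT_cont ss dv (@continuous_on_time _ _ T `[s, s'] v x sT cv).
by exists r => //; rewrite mulrC.
Qed.

(** The base point is the later end (s', x), and [u] is the displacement from there back to time s.
    The time step is made at u + x and the space step at time s', so no mixed derivative occurs. The
    oscillation is only constrained at points whose norm does not exceed that of both end points:
    balls being convex, the segment from x to u + x consists of such points, and before the exit
    time all of them stay in the ball. *)
Lemma cell_expansion s s' x u (k rho : R) : s <= s' -> `[s, s'] `<=` T ->
  (forall r y, s < r < s' -> is_derive r 1 (v^~ y) (vt r y)) ->
  `|u| <= rho ->
  (forall r y, s <= r <= s' -> `|y - x| <= rho -> `|y| <= Num.max `|x| `|u + x| ->
     `|vt r y - vt s' x| <= k /\ forall i j, `|v2 i j r y - v2 i j s' x| <= k) ->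
  `|v s (u + x) - v s' x - (- (s' - s) * vt s' x + \sum_i u 0 i * v1 i s' x
      + (\sum_i \sum_j u 0 i * u 0 j * v2 i j s' x) / 2)|
  <= k * (s' - s) + d%:R ^+ 2 * (k * `|u| ^+ 2).
Proof.
move=> ss sT dv urho osc.
have Ts' : T s' by apply: sT; rewrite /= in_itv/= lexx ss.
have [r rs Er] := time_increment ss sT (fun r rs => dv r (u + x) rs).
have [c /andP[c0 c1'] Ec] := taylor2 (fun i y => @dx i s' y Ts') (fun i j y => @dxx i j s' y Ts')
  (fun i => continuous_on_space Ts' (@c1 i)) (fun i j => continuous_on_space Ts' (@c2 i j)) x u.
have k0 : 0 <= k.
  have := osc s' x; rewrite ss lexx subrr normr0 (le_trans _ urho)// => /(_ isT isT).
  by rewrite le_max lexx => /(_ isT) [+ _]; rewrite subrr normr0.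
have o1 : `|vt r (u + x) - vt s' x| <= k.
  by apply: (osc r (u + x) _ _ _).1; rewrite ?addrK// le_max lexx orbT.
have cu : `|c *: u + x| <= Num.max `|x| `|u + x|.
  have -> : c *: u + x = c *: (u + x) + (1 - c) *: x.
    by apply/rowP => i; rewrite !mxE; ring.
  apply: le_trans (ler_normD _ _) _; rewrite !normrZ ger0_norm// ger0_norm ?subr_ge0//.
  have -> : Num.max `|x| `|u + x| = c * Num.max `|x| `|u + x| + (1 - c) * Num.max `|x| `|u + x| by ring.
  by apply: lerD; apply: ler_wpM2l; rewrite ?subr_ge0// le_max lexx ?orbT.
have o2 i j : `|v2 i j s' (c *: u + x) - v2 i j s' x| <= k.
  apply: (osc s' (c *: u + x) _ _ _).2 => //; first by rewrite ss lexx.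
  by rewrite addrK normrZ ger0_norm//; apply: le_trans urho; rewrite ler_piMl.
have -> : v s (u + x) - v s' x - (- (s' - s) * vt s' x + \sum_i u 0 i * v1 i s' x
      + (\sum_i \sum_j u 0 i * u 0 j * v2 i j s' x) / 2)
  = - (s' - s) * (vt r (u + x) - vt s' x) +
    2^-1 * (\sum_i \sum_j u 0 i * u 0 j * (v2 i j s' (c *: u + x) - v2 i j s' x)).
  have -> : v s (u + x) = v s' (u + x) - (s' - s) * vt r (u + x) by rewrite -Er; ring.
  rewrite Ec; under [in RHS]eq_bigr do under eq_bigr do rewrite mulrBr.
  under [in RHS]eq_bigr do rewrite sumrB.
  by rewrite sumrB; field.
apply: le_trans (ler_normD _ _) _; apply: lerD.
  rewrite normrM (_ : `|- (s' - s)| = s' - s); last by rewrite normrN ger0_norm ?subr_ge0.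
  rewrite [leLHS]mulrC; by apply: ler_wpM2r => //; rewrite subr_ge0.
rewrite normrM gtr0_norm ?invr_gt0//.
have H : `|\sum_i \sum_j u 0 i * u 0 j * (v2 i j s' (c *: u + x) - v2 i j s' x)| <= d%:R ^+ 2 * (k * `|u| ^+ 2).
  apply: ler_norm_sum_ord2 => i j; rewrite mulrC; apply: ler_normM => //.
  by rewrite expr2; apply: ler_normM; exact: coord_le_norm.
by have := le_trans (normr_ge0 _) H; lra.
Qed.

(** The expansions of [v] and of its gradient have the same second-order part, and the mean of the
    two end gradients makes it cancel. Only the oscillation of the second derivatives remains, so no
    third derivative is needed. *)
Lemma trapezoid s x u (k : R) : T s -> 
  (forall c : R, 0 <= c <= 1 -> forall i j, `|v2 i j s (c *: u + x) - v2 i j s x| <= k) ->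
  `|v s (u + x) - v s x - (\sum_i u 0 i * (v1 i s x + v1 i s (u + x))) / 2|
   <= d%:R ^+ 2 * (k * `|u| ^+ 2).
Proof.
move=> Ts osc.
have [c c01 Ec] := taylor2 (fun i y => @dx i s y Ts) (fun i j y => @dxx i j s y Ts)
  (fun i => continuous_on_space Ts (@c1 i)) (fun i j => continuous_on_space Ts (@c2 i j)) x u.
have [e e01 Ee] := gradient_increment (fun i j y => @dxx i j s y Ts)
  (fun i j => continuous_on_space Ts (@c2 i j)) x u.
under eq_bigr do rewrite mulrDr.
rewrite big_split /= Ee Ec.
pose S c := \sum_i \sum_j u 0 i * u 0 j * (v2 i j s (c *: u + x) - v2 i j s x).
have SE c' : \sum_i \sum_j u 0 i * u 0 j * v2 i j s (c' *: u + x)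
   = S c' + \sum_i \sum_j u 0 i * u 0 j * v2 i j s x.
  rewrite /S -big_split; apply: eq_bigr => i _; rewrite -big_split; apply: eq_bigr => j _ /=; ring.
have HS c' : 0 <= c' <= 1 -> `|S c'| <= d%:R ^+ 2 * (k * `|u| ^+ 2).
  move=> c'01; apply: ler_norm_sum_ord2 => i j; rewrite mulrC; apply: ler_normM; first exact: osc.
  by rewrite expr2; apply: ler_normM; exact: coord_le_norm.
rewrite !SE; have := HS _ c01; have := HS _ e01.
move: (S c) (S e) (\sum_i \sum_j u 0 i * u 0 j * v2 i j s x) (\sum_i u 0 i * v1 i s x) => A B C D hB hA.
have -> : v s x + D + (A + C) / 2 - v s x - (D + (D + (B + C))) / 2 = (A - B) / 2 by field.
rewrite normrM [`|2^-1|]gtr0_norm ?invr_gt0//.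
by have := ler_normB A B; lra.
Qed.
End Expansion.

(** One cell, with every datum reduced to a number or a vector: [h] is its length, [k] an
    oscillation bound, [v] and [v'] the values at the earlier and the later end, [vt], [v1], [v2],
    [b], [c] the derivatives, drift and discount rate at the later end, [al] the discount factor
    over the cell, [D] the integrated drift, [W] the Wiener increment and [u] the displacement. In
    the bound, k + h + |W| is the small factor, while h + |W|^2 has bounded sums over a grid in
    mean. *)
Lemma backward_ito_cell (C sigma : R) : 1 <= C -> 0 <= sigma -> exists2 K : R, 0 <= K &
  forall (k h v v' vt c al : R) (v1 : 'I_d -> R) (v2 : 'I_d -> 'I_d -> R) (b D W : 'rV[R]_d),
  0 <= h -> 0 <= k <= 2 * C -> `|v| <= C -> (forall i, `|v1 i| <= C) ->
  (forall i j, `|v2 i j| <= C) -> (forall i, `|b 0 i| <= C) -> `|c| <= C ->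
  (forall i, `|D 0 i - h * b 0 i| <= k * h) ->
  `|al - 1 - h * c| <= C * (k + h) * h -> `|v - v'| <= k ->
  let u := - (D + sigma *: W) in
  `|v - v' - (- h * vt + \sum_i u 0 i * v1 i + (\sum_i \sum_j u 0 i * u 0 j * v2 i j) / 2)|
    <= k * h + d%:R ^+ 2 * (k * `|u| ^+ 2) ->
  - vt - \sum_i b 0 i * v1 i + c * v' + sigma ^+ 2 / 2 * \sum_i v2 i i = 0 ->
  `|al * v - v' - (- sigma * \sum_i W 0 i * v1 i
     + sigma ^+ 2 / 2 * (\sum_i \sum_j W 0 i * W 0 j * v2 i j - h * \sum_i v2 i i))|
  <= K * ((k + h + `|W|) * (h + `|W| ^+ 2)).
Proof.
move=> C1 s0; have C0 : 0 <= C := le_trans ler01 C1.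
pose n : R := d%:R; have n0 : 0 <= n by exact: ler0n.
pose K1 := C * C; pose K2 := C; pose K3 := 1 + n ^+ 2 * (36 * C ^+ 3 + 2 * sigma ^+ 2).
pose K4 := n * C; pose K5 := n ^+ 2 * (9 * C ^+ 3 + 6 * C ^+ 2 * sigma) / 2.
have K10 : 0 <= K1 by rewrite mulr_ge0.
have K20 : 0 <= K2 by [].
have s20 : 0 <= sigma ^+ 2 by rewrite exprn_ge0.
have K30 : 0 <= K3 by rewrite addr_ge0// mulr_ge0 ?exprn_ge0// addr_ge0 ?mulr_ge0 ?exprn_ge0.
have K40 : 0 <= K4 by rewrite mulr_ge0.
have K50 : 0 <= K5.
  by rewrite divr_ge0// mulr_ge0 ?exprn_ge0// addr_ge0 ?mulr_ge0 ?exprn_ge0.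
have KS : 0 <= K1 + K2 + K3 + K4 + K5 by do 4 (apply: addr_ge0 => //).
exists (K1 + K2 + K3 + K4 + K5) => //.
move=> k h v v' vt c al v1 v2 b D W h0 /andP[k0 kC] vC v1C v2C bC cC DE alE vE u ex pde.
set om := `|W|; have om0 : 0 <= om by exact: normr_ge0.
(* The four sizes that occur in the errors; each of T1 to T5 below is bounded by a constant times
   [X], and [XX] brings [X] into the announced form. *)
pose X := k * h + h ^+ 2 + k * om ^+ 2 + h * om.
have p1 : 0 <= k * h by rewrite mulr_ge0.
have p2 : 0 <= h ^+ 2 by rewrite exprn_ge0.
have p3 : 0 <= k * om ^+ 2 by rewrite mulr_ge0 ?exprn_ge0.
have p4 : 0 <= h * om by rewrite mulr_ge0.
have XX : X <= (k + h + om) * (h + om ^+ 2).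
  rewrite /X; have : 0 <= h * om ^+ 2 by rewrite mulr_ge0 ?exprn_ge0.
  have : 0 <= om ^+ 3 by rewrite exprn_ge0.
  by nra.
have DC i : `|D 0 i| <= 3 * C * h.
  rewrite -(subrK (h * b 0 i) (D 0 i)); apply: le_trans (ler_normD _ _) _.
  have := DE i; have : `|h * b 0 i| <= h * C by apply: ler_normM => //; rewrite ger0_norm.
  have : k * h <= 2 * C * h by rewrite ler_wpM2r.
  by lra.
have WC i : `|W 0 i| <= om by exact: coord_le_norm.
have uC : `|u| <= 3 * C * h + sigma * om.
  apply: norm_le_coord; first by rewrite addr_ge0 ?mulr_ge0.
  move=> i; rewrite !mxE normrN; apply: le_trans (ler_normD _ _) _; apply: lerD => //.
  by apply: ler_normM => //; rewrite ger0_norm.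
have T1 : `|(al - 1 - h * c) * v| <= K1 * X.
  apply: le_trans (ler_normM alE vC) _; rewrite /K1 /X.
  have := mulr_ge0 K10 p3; have := mulr_ge0 K10 p4; rewrite /K1; lra.
have T2 : `|h * c * (v - v')| <= K2 * X.
  apply: le_trans (ler_normM (ler_normM (lexx `|h|) cC) vE) _; rewrite ger0_norm// /K2 /X.
  have := mulr_ge0 C0 p3; have := mulr_ge0 C0 p4; have := mulr_ge0 C0 p2; lra.
have T3 : k * h + d%:R ^+ 2 * (k * `|u| ^+ 2) <= K3 * X.
  have u2 : `|u| ^+ 2 <= 18 * C ^+ 2 * h ^+ 2 + 2 * sigma ^+ 2 * om ^+ 2.
    apply: (@le_trans _ _ ((3 * C * h + sigma * om) ^+ 2)).
      by rewrite lerXn2r// nnegrE// addr_ge0// !mulr_ge0.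
    by have := sqr_ge0 (3 * C * h - sigma * om); lra.
  have ku : k * `|u| ^+ 2 <= 36 * C ^+ 3 * h ^+ 2 + 2 * sigma ^+ 2 * (k * om ^+ 2).
    apply: le_trans (ler_wpM2l k0 u2) _.
    have : k * (C ^+ 2 * h ^+ 2) <= 2 * C * (C ^+ 2 * h ^+ 2).
      by rewrite ler_wpM2r// mulr_ge0 ?exprn_ge0.
    by lra.
  have n2 : 0 <= n ^+ 2 by rewrite exprn_ge0.
  have := ler_wpM2l n2 ku; rewrite -/n /K3 /X.
  have C30 : 0 <= n ^+ 2 * C ^+ 3 by rewrite mulr_ge0 ?exprn_ge0.
  have ns0 : 0 <= n ^+ 2 * sigma ^+ 2 by rewrite mulr_ge0.
  have := mulr_ge0 C30 p1; have := mulr_ge0 C30 p3; have := mulr_ge0 C30 p4.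
  have := mulr_ge0 ns0 p1; have := mulr_ge0 ns0 p2; have := mulr_ge0 ns0 p4.
  by lra.
have T4 : `|\sum_i (D 0 i - h * b 0 i) * v1 i| <= K4 * X.
  apply: le_trans (ler_norm_sum_ord (fun i => ler_normM (DE i) (v1C i))) _.
  rewrite /K4 /X -/n; have := mulr_ge0 K40 p2; have := mulr_ge0 K40 p3; have := mulr_ge0 K40 p4.
  by rewrite /K4; lra.
pose Q i j := (D 0 i * D 0 j + sigma * (D 0 i * W 0 j) + sigma * (W 0 i * D 0 j)) * v2 i j.
have T5 : `|(\sum_i \sum_j Q i j) / 2| <= K5 * X.
  have Qij i j : `|Q i j| <= (9 * C ^+ 2 * h ^+ 2 + 6 * C * sigma * (h * om)) * C.
    apply: ler_normM => //.
    have d1 := ler_normM (DC i) (DC j).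
    have d2 := ler_normM (_ : `|sigma| <= sigma) (ler_normM (DC i) (WC j)).
    have d3 := ler_normM (_ : `|sigma| <= sigma) (ler_normM (WC i) (DC j)).
    have ns : `|sigma| <= sigma by rewrite ger0_norm.
    apply: le_trans (ler_normD _ _) _; apply: le_trans (lerD (ler_normD _ _) (lexx _)) _.
    by have := d1; have := d2 ns; have := d3 ns; lra.
  rewrite normrM [`|2^-1|]gtr0_norm ?invr_gt0//.
  have := ler_norm_sum_ord2 Qij; rewrite /K5 /X -/n.
  have C30 : 0 <= n ^+ 2 * C ^+ 3 by rewrite mulr_ge0 ?exprn_ge0.
  have ns0 : 0 <= n ^+ 2 * (C ^+ 2 * sigma) by rewrite mulr_ge0 ?exprn_ge0// mulr_ge0// exprn_ge0.
  have := mulr_ge0 C30 p1; have := mulr_ge0 C30 p3; have := mulr_ge0 C30 p4.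
  have := mulr_ge0 ns0 p1; have := mulr_ge0 ns0 p2; have := mulr_ge0 ns0 p3.
  by lra.
pose r := v - v' - (- h * vt + \sum_i u 0 i * v1 i + (\sum_i \sum_j u 0 i * u 0 j * v2 i j) / 2).
have uE : \sum_i u 0 i * v1 i = - (\sum_i (D 0 i - h * b 0 i) * v1 i)
    - h * (\sum_i b 0 i * v1 i) - sigma * \sum_i W 0 i * v1 i.
  rewrite !mulr_sumr -!sumrN -!big_split /=; apply: eq_bigr => i _; rewrite !mxE; ring.
have uuE : \sum_i \sum_j u 0 i * u 0 j * v2 i j = \sum_i \sum_j Q i j
    + sigma ^+ 2 * \sum_i \sum_j W 0 i * W 0 j * v2 i j.
  rewrite !mulr_sumr -!big_split /=; apply: eq_bigr => i _; rewrite !mulr_sumr -!big_split /=.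
  by apply: eq_bigr => j _; rewrite /Q !mxE; ring.
(* An exact identity. The last bracket, multiplied by [h], is the left side of the differential
   equation at the later end and vanishes; everything before it is an error term. *)
have -> : al * v - v' - (- sigma * \sum_i W 0 i * v1 i
     + sigma ^+ 2 / 2 * (\sum_i \sum_j W 0 i * W 0 j * v2 i j - h * \sum_i v2 i i))
  = (al - 1 - h * c) * v + h * c * (v - v') + r - \sum_i (D 0 i - h * b 0 i) * v1 i
    + (\sum_i \sum_j Q i j) / 2
    + h * (- vt - \sum_i b 0 i * v1 i + c * v' + sigma ^+ 2 / 2 * \sum_i v2 i i).
  rewrite /r uE uuE.
  move: (\sum_i \sum_j Q i j) (\sum_i \sum_j W 0 i * W 0 j * v2 i j) (\sum_i v2 i i)
    (\sum_i b 0 i * v1 i) (\sum_i W 0 i * v1 i) (\sum_i (D 0 i - h * b 0 i) * v1 i) => *.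
  by field.
rewrite pde mulr0 addr0; clearbody K1 K2 K3 K4 K5 X.
apply: (@le_trans _ _ ((K1 + K2 + K3 + K4 + K5) * X)).
  have -> : (K1 + K2 + K3 + K4 + K5) * X = K1 * X + K2 * X + K3 * X + K4 * X + K5 * X by ring.
  apply: le_trans (ler_normD _ _) _; apply: lerD => //.
  apply: le_trans (ler_normB _ _) _; apply: lerD => //.
  apply: le_trans (ler_normD _ _) _; apply: lerD; last by apply: (le_trans ex); exact: T3.
  by apply: le_trans (ler_normD _ _) _; apply: lerD.
exact: ler_wpM2l.
Qed.
End Cells.

Section FiniteFamilies.
Context {R : realType} {d : nat}.
Variables (I : finType) (T : set R) (F : I -> R -> 'rV[R]_d -> R).
Hypothesis cF : forall i, continuous_on T (F i).

Lemma family_bounded c t M : `[c, t] `<=` T ->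
  exists2 C : R, 1 <= C & forall i s x, c <= s <= t -> `|x| <= M -> `|F i s x| <= C.
Proof.
move=> cT; have /choice[C HC] : forall i, exists C : R, 0 <= C /\ forall s x, c <= s <= t -> `|x| <= M -> `|F i s x| <= C.
  by move=> i; have [C ? ?] := continuous_on_bounded M cT (@cF i); exists C.
exists (1 + \sum_i C i); first by rewrite lerDl sumr_ge0// => i _; case: (HC i).
move=> i s x cs xM; apply: le_trans ((HC i).2 s x cs xM) _.
rewrite (bigD1 i)//= addrCA lerDl addr_ge0// sumr_ge0// => j _; by case: (HC j).
Qed.

Lemma family_uniform c t M : `[c, t] `<=` T -> forall e : R, 0 < e ->
  exists2 r : R, 0 < r & forall i s s' x x',
    c <= s <= t -> c <= s' <= t -> `|x| <= M -> `|x'| <= M ->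
    `|s - s'| < r -> `|x - x'| < r -> `|F i s x - F i s' x'| < e.
Proof.
move=> cT e e0; have /choice[r Hr] : forall i, exists r : R, 0 < r /\ forall s s' x x',
    c <= s <= t -> c <= s' <= t -> `|x| <= M -> `|x'| <= M ->
    `|s - s'| < r -> `|x - x'| < r -> `|F i s x - F i s' x'| < e.
  by move=> i; have [r ? ?] := continuous_on_uniform M cT (@cF i) e0; exists r.
exists (\big[Num.min/1]_i r i).
  by apply/bigmin_gtP; split => // i _; case: (Hr i).
move=> i s s' x x' cs cs' xM xM' ss xx; apply: (Hr i).2 => //.
  by apply: lt_le_trans ss _; exact: bigmin_le_cond.
by apply: lt_le_trans xx _; exact: bigmin_le_cond.
Qed.
End FiniteFamilies.

(** * The expansion along one sample path up to an exit time *)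

Section PathwiseIto.
Context {R : realType} {d : nat}.
Local Notation mu := (@lebesgue_measure R).
Variables (a sigma : R) (v vt cc : R -> 'rV[R]_d -> R) (v1 b : 'I_d -> R -> 'rV[R]_d -> R)
  (v2 : 'I_d -> 'I_d -> R -> 'rV[R]_d -> R).
Hypothesis sigma0 : 0 < sigma.
Local Notation T := (`]a, +oo[%classic : set R).
Hypothesis cv : continuous_on T v.
Hypothesis cvt : continuous_on T vt.
Hypothesis ccc : continuous_on T cc.
Hypothesis cv1 : forall i, continuous_on T (v1 i).
Hypothesis cb : forall i, continuous_on T (b i).
Hypothesis cv2 : forall i j, continuous_on T (v2 i j).
Hypothesis dvt : forall s x, a < s -> is_derive s 1 (v^~ x) (vt s x).
Hypothesis dv1 : forall i s x, a < s -> is_derive x (delta_mx 0 i) (v s) (v1 i s x).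
Hypothesis dv2 : forall i j s x, a < s -> is_derive x (delta_mx 0 j) (v1 i s) (v2 i j s x).
Hypothesis pde : forall s x, a < s ->
  - vt s x - \sum_i b i s x * v1 i s x + cc s x * v s x + sigma ^+ 2 / 2 * \sum_i v2 i i s x = 0.

Variables (c t n : R).
Hypothesis ac : a < c.
Hypothesis ct : c <= t.

Let cT s s' : c <= s -> `[s, s'] `<=` T.
Proof.
by move=> cs r /=; rewrite !in_itv/= => /andP[sr _]; rewrite andbT (lt_le_trans ac)// (le_trans cs).
Qed.

(** All fields are collected in one finite family, so that a single bound and a single modulus of
    continuity serve for them together. *)
Let fam (k : option (option (option ('I_d + 'I_d + 'I_d * 'I_d)))) : R -> 'rV[R]_d -> R :=
  match k with
  | None => v | Some None => vt | Some (Some None) => cc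
  | Some (Some (Some (inl (inl i)))) => v1 i
  | Some (Some (Some (inl (inr i)))) => b i
  | Some (Some (Some (inr ij))) => v2 ij.1 ij.2
  end.

Let cfam k : continuous_on T (fam k).
Proof. by case: k => [[[[[i|i]|[i j]]|]|]|] /=. Qed.

Definition discount (x : R -> 'rV[R]_d) (s : R) : R :=
  expR (\int[mu]_(r in `[s, t]) cc r (x r))%R.

Definition discounted (x : R -> 'rV[R]_d) (s : R) : R := discount x s * v s (x s).

(* The part of the expansion of [discounted] over [[s, s']] that is centered given the path after [s']. *)
Definition martingale_increment (x W : R -> 'rV[R]_d) (s s' : R) : R :=
  discount x s' * (- sigma * \sum_i (W s' - W s) 0 i * v1 i s' (x s')
    + sigma ^+ 2 / 2 * (\sum_i \sum_j (W s' - W s) 0 i * (W s' - W s) 0 j * v2 i j s' (x s')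
        - (s' - s) * \sum_i v2 i i s' (x s'))).

(** What the expansion uses of one sample path. The estimates below are deterministic, and their
    constants must not depend on the path if they are to be integrated later. *)
Definition solution_path (q : 'rV[R]_d) (x W : R -> 'rV[R]_d) (tau : R) :=
  [/\ c <= tau <= t, {within `[c, t], continuous x},
      {within `[c, t], continuous W},
      forall s, c <= s <= t -> x s = q - \row_i (\int[mu]_(r in `[s, t]) b i r (x r))%R
         - sigma *: (W t - W s) &
      forall s, tau <= s <= t -> `|x s| <= n].

(** The second-order remainder of r to e^(r x) between 0 and 1 is x^2 e^(z x) / 2 with z in the unit
    interval. *)
Let exp_close (x C : R) : 1 <= C -> `|x| <= C -> `|expR x - 1 - x| <= expR C * x ^+ 2.
Proof.
move=> C1 xC.
pose f (r : R) := expR (r * x).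
have df (r : R) : is_derive r 1 f (x * expR (r * x)).
  rewrite mulrC; apply: (is_derive1_comp (f := expR) (g := fun r => r * x)).
  by apply: is_derive_eq; rewrite /GRing.scale/= mulr1 mulr0 ?addr0 ?add0r.
have ddf (r : R) : is_derive r 1 (fun r => x * expR (r * x)) (x ^+ 2 * expR (r * x)).
  have := df r => ?; rewrite -[fun r => _]/(x *: f).
  by apply: is_derive_eq; rewrite /GRing.scale/= mulrA expr2.
have [z /andP[z0 z1]] := taylor2_unit df ddf.
rewrite /f mul1r mul0r expR0 => ->.
have -> : 1 + x * 1 + x ^+ 2 * expR (z * x) / 2 - 1 - x = x ^+ 2 * (expR (z * x) / 2) by field.
rewrite normrM ger0_norm ?sqr_ge0// mulrC ler_wpM2r ?sqr_ge0//.
rewrite ger0_norm; last by rewrite divr_ge0// expR_ge0.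
have : expR (z * x) <= expR C.
  rewrite ler_expR; apply: le_trans (ler_norm _) _; rewrite normrM ger0_norm//.
  by apply: le_trans xC; rewrite ler_piMl.
by have := expR_ge0 (z * x); lra.
Qed.

Let cpath (f : R -> 'rV[R]_d -> R) x : continuous_on T f -> {within `[c, t], continuous x} ->
  {within `[c, t], continuous (fun r => f r (x r))}.
Proof. by move=> cf; apply: continuous_on_path cf; exact: cT. Qed.

Let sub_itv (f : R -> R) s s' : c <= s -> s' <= t -> {within `[c, t], continuous f} ->
  {within `[s, s'], continuous f}.
Proof.
move=> cs st; apply: continuous_subspaceW => r /=; rewrite !in_itv/= => /andP[sr rs].
by rewrite (le_trans cs sr) (le_trans rs st).
Qed.

Let T0 : R := t - c.
Let T00 : 0 <= T0. Proof. by rewrite subr_ge0. Qed.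

(** The constants are chosen before the path. The oscillation [k] and the radius [rho] are left as
    parameters: a crude choice gives a uniform bound, a choice adapted to the path gives smallness.
    The bounds of the second group use the path at s' and later only, so s may lie before tau, as it
    does for the cell that contains tau. *)
Lemma backward_ito_path_cell : exists C K B : R, [/\ [/\ 1 <= C, 0 <= K, 0 <= B &
    forall j r y, c <= r <= t -> `|y| <= n -> `|fam j r y| <= C],
  forall q x W tau s s' k rho, solution_path q x W tau -> tau <= s -> s <= s' -> s' <= t ->
    0 <= k <= 2 * C ->
    (forall r, s <= r <= s' -> `|x r - x s'| <= rho) ->
    (forall j r y, s <= r <= s' -> `|y - x s'| <= rho -> `|y| <= n ->
      `|fam j r y - fam j s' (x s')| <= k) ->
    `|discounted x s - discounted x s' - martingale_increment x W s s'|
      <= K * ((k + (s' - s) + `|W s' - W s|) * ((s' - s) + `|W s' - W s| ^+ 2)),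
  forall q x W tau s s', solution_path q x W tau -> tau <= s' -> s <= s' -> s' <= t ->
   [/\ `|discount x s'| <= B, `|discounted x s'| <= B,
    (forall i, `|v1 i s' (x s')| <= C), (forall i j, `|v2 i j s' (x s')| <= C) &
    `|martingale_increment x W s s'| <= B * ((s' - s) + `|W s' - W s| + `|W s' - W s| ^+ 2)] &
  forall q x W tau s s', solution_path q x W tau -> tau <= s -> s <= s' -> s' <= t ->
    `|W s' - W s| <= B].
Proof.
have [C C1 HC] := family_bounded cfam n (@cT c t (lexx c)).
have C0 : 0 <= C := le_trans ler01 C1.
pose C3 := 1 + C * T0.
(* The discount factor over a cell differs from 1 + h c by at most k h, from the oscillation of the
   rate, plus e^C3 C^2 h^2, from the exponential; [C2] absorbs both and still dominates [C]. *)
pose C2 := C + expR C3 * C ^+ 2.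
have CC2 : C <= C2 by rewrite lerDl mulr_ge0 ?expR_ge0// exprn_ge0.
have C21 : 1 <= C2 := le_trans C1 CC2.
have [K0 K00 HK] := @backward_ito_cell R d C2 sigma C21 (ltW sigma0).
pose BA := expR C3; have BA0 : 0 <= BA := expR_ge0 C3.
pose dR : R := d%:R; have d0 : 0 <= dR by exact: ler0n.
pose BE := BA * (C * (sigma * dR + sigma ^+ 2 * dR ^+ 2 + sigma ^+ 2 * dR)).
(* Up to the exit time the Wiener increments are bounded as well: the equation expresses sigma (W_s'
   - W_s) by two values of the path, each at most n, and an integrated drift. *)
pose BW := (2 * `|n| + C * T0) / sigma.
have s20 : 0 <= sigma ^+ 2 by rewrite sqr_ge0.
have sd0 : 0 <= sigma * dR by rewrite mulr_ge0// ltW.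
have BE0 : 0 <= BE.
  apply: mulr_ge0 => //; apply: mulr_ge0 => //; apply: addr_ge0; last exact: mulr_ge0.
  by apply: addr_ge0 => //; rewrite mulr_ge0// sqr_ge0.
have BW0 : 0 <= BW by rewrite divr_ge0 ?(ltW sigma0)// addr_ge0// mulr_ge0.
have BAC0 : 0 <= BA * C by rewrite mulr_ge0.
have bnd x tau s k : (forall s, tau <= s <= t -> `|x s| <= n) -> c <= tau -> tau <= s <= t ->
    `|fam k s (x s)| <= C.
  move=> xn ctau /andP[ts st]; apply: HC; first by rewrite (le_trans ctau ts).
  by apply: xn; rewrite ts.
have int_bnd x tau s s' k : {within `[c, t], continuous x} ->
    (forall s, tau <= s <= t -> `|x s| <= n) -> c <= tau -> tau <= s -> s <= s' -> s' <= t ->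
    `|(\int[mu]_(r in `[s, s']) fam k r (x r))%R| <= C * (s' - s).
  move=> cx xn ctau ts ss st.
  have cs := le_trans ctau ts.
  have := @Rintegral_close R (fun r => fam k r (x r)) s s' 0 C ss
    (sub_itv cs st (cpath (@cfam k) cx)).
  rewrite mulr0 subr0; apply => r /andP[sr rs]; rewrite subr0.
  by apply: (bnd x tau) => //; rewrite (le_trans ts sr) (le_trans rs st).
have discB q x W tau s' : solution_path q x W tau -> tau <= s' -> s' <= t -> `|discount x s'| <= BA.
  move=> [/andP[ctau taut] cx cW sde xn] ts' s't.
  rewrite /discount ger0_norm ?expR_ge0// ler_expR.
  apply: le_trans (ler_norm _) _; apply: le_trans (int_bnd x tau s' t (Some (Some None)) cx xn ctau ts' s't (lexx t)) _.
  rewrite /C3 -[leLHS]add0r lerD// ler_wpM2l// lerD2l lerN2; exact: le_trans ts'.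
exists C2, (BA * K0), (BA + BA * C + BE + BW); split => //.
- split => //; first by rewrite mulr_ge0.
  by rewrite !addr_ge0.
  by move=> j r y cr yn; apply: le_trans (HC j r y cr yn) CC2.
- move=> q x W tau s s' k rho sol ts ss s't kC xrho osc.
  have := discB _ _ _ _ s' sol (le_trans ts ss) s't.
  case: (sol) => /andP[ctau taut] cx cW sde xn dB.
  have cs := le_trans ctau ts; have st := le_trans ss s't; have cs' := le_trans cs ss.
  have ts' := le_trans ts ss.
  have as' : a < s' := lt_le_trans ac cs'.
  have k0 : 0 <= k by case/andP : kC.
  set h := s' - s; have h0 : 0 <= h by rewrite subr_ge0.
  pose D : 'rV[R]_d := \row_i (\int[mu]_(r in `[s, s']) b i r (x r))%R.
  pose y := (\int[mu]_(r in `[s, s']) cc r (x r))%R.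
  have split_ (f : R -> 'rV[R]_d -> R) : continuous_on T f ->
      (\int[mu]_(r in `[s, t]) f r (x r) = \int[mu]_(r in `[s, s']) f r (x r) + \int[mu]_(r in `[s', t]) f r (x r))%R.
    move=> cf; apply: Rintegral_split; first by rewrite ss.
    exact: sub_itv (cpath cf cx).
  have AE : discount x s = discount x s' * expR y.
    by rewrite /discount -expRD; congr expR; rewrite addrC; exact: split_.
  have xE : x s = - (D + sigma *: (W s' - W s)) + x s'.
    rewrite (sde s) ?cs// (sde s') ?cs'//; apply/rowP => i; rewrite !mxE split_//; ring.
  have close (f : R -> 'rV[R]_d -> R) : continuous_on T f ->
      (forall r y, s <= r <= s' -> `|y - x s'| <= rho -> `|y| <= n -> `|f r y - f s' (x s')| <= k) ->
      `|(\int[mu]_(r in `[s, s']) f r (x r))%R - h * f s' (x s')| <= k * h.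
    move=> cf of_; apply: Rintegral_close => //; first exact: sub_itv (cpath cf cx).
    move=> r /andP[sr rs]; apply: of_; [by rewrite sr|by apply: xrho; rewrite sr|].
    by apply: xn; rewrite (le_trans ts sr) (le_trans rs s't).
  have uu := xrho s; rewrite lexx ss xE addrK in uu; have {}uu := uu isT.
  have xsn : `|- (D + sigma *: (W s' - W s)) + x s'| <= n by rewrite -xE; apply: xn; rewrite ts.
  have xs'n : `|x s'| <= n by apply: xn; rewrite ts'.
  rewrite {1}/discounted AE {1}/discounted /martingale_increment -/h.
  have -> : discount x s' * expR y * v s (x s) - discount x s' * v s' (x s') -
     discount x s' * (- sigma * \sum_i (W s' - W s) 0 i * v1 i s' (x s') + sigma ^+ 2 / 2 * (\sum_i \sum_j (W s' - W s) 0 i * (W s' - W s) 0 j * v2 i j s' (x s') -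
     h * (\sum_i v2 i i s' (x s'))))
   = discount x s' * (expR y * v s (x s) - v s' (x s') - (- sigma * \sum_i (W s' - W s) 0 i * v1 i s' (x s') + sigma ^+ 2 / 2 * (\sum_i \sum_j (W s' - W s) 0 i * (W s' - W s) 0 j * v2 i j s' (x s') -
     h * (\sum_i v2 i i s' (x s'))))) by ring.
  rewrite -[BA * K0 * _]mulrA; apply: ler_normM => //.
  apply: (HK k h (v s (x s)) (v s' (x s')) (vt s' (x s')) (cc s' (x s')) (expR y)
    (fun i => v1 i s' (x s')) (fun i j => v2 i j s' (x s')) (\row_i b i s' (x s')) D) => //.
  + by apply: le_trans CC2; apply: (bnd x tau s None) => //; rewrite ts.
  + by move=> i; apply: le_trans CC2; apply: (bnd x tau s' (Some (Some (Some (inl (inl i)))))) => //; rewrite ts'.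
  + by move=> i j; apply: le_trans CC2; apply: (bnd x tau s' (Some (Some (Some (inr (i, j)))))) => //; rewrite ts'.
  + by move=> i; rewrite mxE; apply: le_trans CC2; apply: (bnd x tau s' (Some (Some (Some (inl (inr i)))))) => //; rewrite ts'.
  + by apply: le_trans CC2; apply: (bnd x tau s' (Some (Some None))) => //; rewrite ts'.
  + by move=> i; rewrite !mxE; apply: close => // r z rs zr zn; exact: (osc (Some (Some (Some (inl (inr i)))))).
  + have yh : `|y - h * cc s' (x s')| <= k * h.
      by apply: close => // r z rs zr zn; exact: (osc (Some (Some None))).
    have yC : `|y| <= C * h := int_bnd x tau s s' (Some (Some None)) cx xn ctau ts ss s't.
    have hT : h <= T0 by exact: lerB.
    have yC3 : `|y| <= C3.
      by apply: le_trans yC _; apply: le_trans (ler_wpM2l C0 hT) _; rewrite /C3 lerDr.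
    have C31 : 1 <= C3 by rewrite lerDl mulr_ge0.
    have E := exp_close C31 yC3.
    have y2 : y ^+ 2 <= (C * h) ^+ 2 by rewrite -[y ^+ 2]ger0_norm ?sqr_ge0// normrX lerXn2r// nnegrE mulr_ge0.
    have -> : expR y - 1 - h * cc s' (x s') = (expR y - 1 - y) + (y - h * cc s' (x s')) by ring.
    apply: le_trans (ler_normD _ _) _; apply: le_trans (lerD E yh) _.
    have := ler_wpM2l BA0 y2; rewrite /BA /C2.
    have kh : 0 <= k * h by rewrite mulr_ge0.
    have : k * h <= C * (k * h) by rewrite ler_peMl.
    have : 0 <= C * h ^+ 2 by rewrite mulr_ge0// sqr_ge0.
    have : 0 <= expR C3 * C ^+ 2 * (k * h) by rewrite mulr_ge0// mulr_ge0 ?expR_ge0// sqr_ge0.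
    by move: (expR C3) => E3; lra.
  + rewrite xE; apply: (osc None) => //; first by rewrite lexx ss.
    by rewrite addrK.
  + rewrite {1}xE; apply: (cell_expansion (T := T) cv cv1 cv2 _ _ ss _ _ uu).
    * by move=> i r z; rewrite /= in_itv/= andbT; exact: dv1.
    * by move=> i j r z; rewrite /= in_itv/= andbT; exact: dv2.
    * exact: cT.
    * by move=> r z /andP[sr _]; apply: dvt; apply: lt_trans sr; exact: lt_le_trans cs.
    * move=> r z rs zr; rewrite le_max => zn.
      have {}zn : `|z| <= n by case/orP: zn => /le_trans; apply.
      by split=> [|i j]; [exact: (osc (Some None))|exact: (osc (Some (Some (Some (inr (i, j))))))].
  + under eq_bigr do rewrite mxE; exact: pde.
- move=> q x W tau s s' sol ts' ss s't.
  have dB := discB _ _ _ _ s' sol ts' s't.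
  case: (sol) => /andP[ctau taut] cx cW sde xn.
  have h0 : 0 <= s' - s by rewrite subr_ge0.
  have b1 i : `|v1 i s' (x s')| <= C by apply: (bnd x tau s' (Some (Some (Some (inl (inl i)))))) => //; rewrite ts'.
  have b2 i j : `|v2 i j s' (x s')| <= C by apply: (bnd x tau s' (Some (Some (Some (inr (i, j)))))) => //; rewrite ts'.
  have b0 : `|v s' (x s')| <= C by apply: (bnd x tau s' None) => //; rewrite ts'.
  split.
  + by apply: le_trans dB _; lra.
  + by apply: le_trans (ler_normM dB b0) _; lra.
  + by move=> i; exact: le_trans (b1 i) CC2.
  + by move=> i j; exact: le_trans (b2 i j) CC2.
  set om := `|W s' - W s|; have om0 : 0 <= om := normr_ge0 _; set h := s' - s.
  have WC i : `|(W s' - W s) 0 i| <= om by exact: coord_le_norm.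
  have s1 : `|\sum_i (W s' - W s) 0 i * v1 i s' (x s')| <= dR * (om * C).
    by apply: ler_norm_sum_ord => i; exact: ler_normM.
  have s2 : `|\sum_i \sum_j (W s' - W s) 0 i * (W s' - W s) 0 j * v2 i j s' (x s')| <= dR ^+ 2 * (om * om * C).
    by apply: ler_norm_sum_ord2 => i j; apply: ler_normM => //; exact: ler_normM.
  have s3 : `|\sum_i v2 i i s' (x s')| <= dR * C by exact: ler_norm_sum_ord.
  have o2 : 0 <= om ^+ 2 by rewrite sqr_ge0.
  apply: (@le_trans _ _ (BE * (h + om + om ^+ 2))); last first.
    apply: ler_wpM2r; first by do 2 (apply: addr_ge0 => //).
    by rewrite -[leLHS]addr0 lerD// -[leLHS]add0r lerD// addr_ge0.
  rewrite /martingale_increment /BE -[BA * _ * (h + _ + _)]mulrA; apply: ler_normM => //.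
  apply: le_trans (ler_normD _ _) _.
  have ns : `|- sigma| <= sigma by rewrite normrN ger0_norm// ltW.
  have ns2 : `|sigma ^+ 2 / 2| <= sigma ^+ 2 by rewrite ger0_norm ?divr_ge0//; lra.
  have nh : `|s' - s| <= h by rewrite ger0_norm.
  have e1 := ler_normM ns s1.
  have e2 := ler_normM ns2 (le_trans (ler_normB _ _) (lerD s2 (ler_normM nh s3))).
  apply: le_trans (lerD e1 e2) _.
  have p1 : 0 <= C * (sigma * dR) by rewrite mulr_ge0.
  have p2 : 0 <= C * (sigma ^+ 2 * dR ^+ 2) by apply: mulr_ge0 => //; apply: mulr_ge0 => //; exact: sqr_ge0.
  have p3 : 0 <= C * (sigma ^+ 2 * dR) by apply: mulr_ge0 => //; exact: mulr_ge0.
  have := mulr_ge0 p1 h0; have := mulr_ge0 p1 o2; have := mulr_ge0 p2 h0; have := mulr_ge0 p2 om0.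
  have := mulr_ge0 p3 om0; have := mulr_ge0 p3 o2; rewrite -/h.
  by lra.
- move=> q x W tau s s' sol ts ss s't.
  case: (sol) => /andP[ctau taut] cx cW sde xn.
  have cs := le_trans ctau ts; have st := le_trans ss s't; have cs' := le_trans cs ss.
  have ts' := le_trans ts ss.
  apply: (@le_trans _ _ BW); last by lra.
  rewrite /BW ler_pdivlMr// mulrC.
  have -> : sigma * `|W s' - W s| = `|sigma *: (W s' - W s)| by rewrite normrZ gtr0_norm.
  have -> : sigma *: (W s' - W s) = x s' - x s - \row_i (\int[mu]_(r in `[s, s']) b i r (x r))%R.
    rewrite (sde s) ?cs// (sde s') ?cs'//; apply/rowP => i; rewrite !mxE.
    rewrite (@Rintegral_split _ _ s s' t) ?ss//; first by ring.
    exact: sub_itv (cpath (@cb i) cx).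
  have nn : n <= `|n| := ler_norm n.
  have i1 : `|\row_i (\int[mu]_(r in `[s, s']) b i r (x r))%R| <= C * (s' - s).
    apply: norm_le_coord; first by rewrite mulr_ge0// subr_ge0.
    by move=> i; rewrite mxE; exact: (int_bnd x tau s s' (Some (Some (Some (inl (inr i)))))).
  have x1 : `|x s'| <= n by apply: xn; rewrite ts'.
  have x2 : `|x s| <= n by apply: xn; rewrite ts.
  apply: le_trans (ler_normB _ _) _; apply: le_trans (lerD (ler_normB _ _) i1) _.
  have : C * (s' - s) <= C * T0 by rewrite ler_wpM2l// /T0; lra.
  by lra.
Qed.

(** The crude version, with 2 C for the oscillation: it supplies the domination, with one constant
    for all paths. The last item bounds the coefficients of the martingale increments, as needed for
    their integrability. *)
Lemma backward_ito_path_bounds : exists2 k : R, 0 <= k &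
  forall q x W tau, solution_path q x W tau ->
  [/\ forall s s', tau <= s -> s <= s' -> s' <= t ->
       `|discounted x s - discounted x s' - martingale_increment x W s s'|
         <= k * ((s' - s) + `|W s' - W s| ^+ 2),
     forall s s', c <= s -> s < tau -> tau < s' -> s' <= t ->
       `|discounted x tau - discounted x s' - martingale_increment x W s s'|
         <= k + k * ((s' - s) + `|W s' - W s| ^+ 2),
     forall s', tau <= s' <= t -> `|discounted x s'| <= k &
     forall s', tau <= s' <= t -> (forall i, `|discount x s' * v1 i s' (x s')| <= k) /\
       (forall i j, `|discount x s' * v2 i j s' (x s')| <= k)].
Proof.
have [C [K [B [[C1 K0 B0 fam_bound] cell bd1 bd2]]]] := backward_ito_path_cell.
have C0 : 0 <= C := le_trans ler01 C1.
have BC : 0 <= B * C by rewrite mulr_ge0.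
pose k1 := K * (2 * C + T0 + B); pose k2 := B * (3 + T0).
have k10 : 0 <= k1.
  by apply: mulr_ge0 => //; do 2 (apply: addr_ge0 => //); apply: mulr_ge0.
have k20 : 0 <= k2 by apply: mulr_ge0 => //; apply: addr_ge0.
exists (k1 + k2 + B + B * C); first by do 3 (apply: addr_ge0 => //).
move=> q x W tau sol.
have [/andP[ctau taut] cx cW sde xn] := sol.
split.
- move=> s s' ts ss s't.
  have h0 : 0 <= s' - s by rewrite subr_ge0.
  have o2 : 0 <= `|W s' - W s| ^+ 2 by rewrite exprn_ge0.
  have hT : s' - s <= T0 by apply: lerB => //; exact: le_trans ts.
  have kC : 0 <= 2 * C <= 2 * C by rewrite lexx mulr_ge0.
  have W1 := bd2 q x W tau s s' sol ts ss s't.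
  have c1 : `|discounted x s - discounted x s' - martingale_increment x W s s'|
      <= K * ((2 * C + (s' - s) + `|W s' - W s|) * ((s' - s) + `|W s' - W s| ^+ 2)).
    apply: (cell q x W tau s s' (2 * C) (2 * n)) => //.
    + move=> r /andP[sr rs]; apply: le_trans (ler_normB _ _) _; rewrite mulr_natl mulr2n.
      by apply: lerD; apply: xn; rewrite ?(le_trans ts)// ?(le_trans rs)// (le_trans ts ss).
    + move=> j r y /andP[sr rs] _ yn; apply: le_trans (ler_normB _ _) _.
      rewrite mulr_natl mulr2n; apply: lerD.
        by apply: fam_bound => //; rewrite (le_trans _ sr) ?(le_trans ctau)// (le_trans rs).
      apply: fam_bound; first by rewrite s't (le_trans ctau)// (le_trans ts).
      by apply: xn; rewrite s't (le_trans ts).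
  apply: le_trans c1 _; rewrite mulrA; apply: ler_wpM2r; first exact: addr_ge0.
  have : K * (2 * C + (s' - s) + `|W s' - W s|) <= k1.
    by apply: ler_wpM2l => //; do 2 apply: lerD => //.
  by move=> H; apply: le_trans H _; clearbody k1 k2; lra.
- move=> s s' cs st ts' s't.
  have ts'' := ltW ts'; have ss := ltW (lt_trans st ts').
  have h0 : 0 <= s' - s by rewrite subr_ge0.
  have hT : s' - s <= T0 by apply: lerB.
  have [_ M1 _ _ e1] := bd1 q x W tau s s' sol ts'' ss s't.
  have [_ M2 _ _ _] := bd1 q x W tau s tau sol (lexx _) (ltW st) taut.
  set om := `|W s' - W s| in e1 *; have om0 : 0 <= om := normr_ge0 _.
  have om1 : om <= 1 + om ^+ 2 by have := sqr_ge0 (om - 1 / 2); lra.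
  have o2 : 0 <= om ^+ 2 by rewrite exprn_ge0.
  apply: le_trans (ler_normB _ _) _; apply: le_trans (lerD (ler_normB _ _) (lexx _)) _.
  have p1 := ler_wpM2l B0 om1; have p2 := ler_wpM2l B0 hT.
  have p3 : 0 <= B * (T0 * om ^+ 2) by rewrite mulr_ge0// mulr_ge0.
  have p4 := mulr_ge0 B0 o2; have p5 := mulr_ge0 B0 h0.
  have p6 := mulr_ge0 k10 h0; have p7 := mulr_ge0 k10 o2.
  have p8 := mulr_ge0 BC h0; have p9 := mulr_ge0 BC o2.
  have p10 : 0 <= B * (T0 * (s' - s)) by rewrite mulr_ge0// mulr_ge0.
  by rewrite /k2; clearbody k1 T0 om; lra.
- move=> s' /andP[ts' s't]; have [_ M1 _ _ _] := bd1 q x W tau s' s' sol ts' (lexx _) s't.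
  apply: le_trans M1 _; rewrite -addrA addrC -addrA lerDl.
  by do 2 (apply: addr_ge0 => //).
- move=> s' /andP[ts' s't]; have [d1 _ b1 b2 _] := bd1 q x W tau s' s' sol ts' (lexx _) s't.
  have H : B * C <= k1 + k2 + B + B * C by rewrite lerDr; do 2 (apply: addr_ge0 => //).
  split=> [i|i j]; apply: le_trans H; exact: ler_normM.
Qed.

(** Here the threshold depends on the path, through the moduli of continuity of [x] and [W]. If tau
    lies inside the cell, the expansion is applied from tau to s', and the two martingale
    increments, starting at tau and at s, are both small because their cells are short. *)
Lemma backward_ito_path_small q x W tau : solution_path q x W tau ->
  forall e : R, 0 < e -> exists2 r : R, 0 < r & forall s s', c <= s -> s <= s' -> s' <= t -> s' - s < r ->
    (tau <= s -> `|discounted x s - discounted x s' - martingale_increment x W s s'|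
         <= e * ((s' - s) + `|W s' - W s| ^+ 2)) /\
    (s < tau -> tau < s' ->
       `|discounted x tau - discounted x s' - martingale_increment x W s s'| <= e).
Proof.
move=> sol e e0.
have [C [K [B [[C1 K0 B0 fam_bound] cell bd1 bd2]]]] := backward_ito_path_cell.
have C0 : 0 <= C := le_trans ler01 C1.
have [k k0 /(_ q x W tau sol)[unif _ _ _]] := backward_ito_path_bounds.
have [/andP[ctau taut] cx cW sde xn] := sol.
have K10 : 0 < 1 + K by rewrite ltr_pwDl.
(* The 3 shares [e] among the oscillation, the cell length and |W|, which add up in the small factor
   of the cell estimate. *)
pose e1 := Num.min (e / (3 * (1 + K))) (Num.min 1 (2 * C)).
have e10 : 0 < e1.
  rewrite !lt_min ltr01 !divr_gt0 ?mulr_gt0//.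
  exact: lt_le_trans ltr01 C1.
have e1C : e1 <= 2 * C by rewrite /e1 !ge_min lexx !orbT.
have e1e : K * (3 * e1) <= e.
  have : e1 <= e / (3 * (1 + K)) by rewrite /e1 ge_min lexx.
  rewrite ler_pdivlMr ?mulr_gt0// => H.
  have : 0 <= 3 * e1 by rewrite mulr_ge0// ltW.
  by lra.
clearbody e1.
pose kB := 1 + k + B; have kB0 : 0 < kB by rewrite /kB; lra.
(* For the cell containing tau, each of the two martingale increments costs at most 3 B e2 and the
   expansion 2 k e2, together at most 6 (1 + k + B) e2. *)
pose e2 := Num.min e1 (Num.min 1 (e / (6 * kB))).
have e20 : 0 < e2 by rewrite !lt_min e10 ltr01 divr_gt0// mulr_gt0.
have e21 : e2 <= e1 by rewrite /e2 ge_min lexx.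
have e22 : e2 <= 1 by rewrite /e2 !ge_min lexx !orbT.
have e23 : kB * (6 * e2) <= e.
  have : e2 <= e / (6 * kB) by rewrite /e2 !ge_min lexx !orbT.
  by rewrite ler_pdivlMr ?mulr_gt0// => H; lra.
clearbody e2.
have [r1 r10 H1] := family_uniform cfam n (@cT c t (lexx c)) e10.
have r1h : 0 < r1 / 2 by rewrite divr_gt0.
have [r2 r20 H2] := uniform_continuity_on_compact (@segment_compact _ c t) cx r1h.
have [r3 r30 H3] := uniform_continuity_on_compact (@segment_compact _ c t) cW e20.
pose r := Num.min (Num.min r1 r2) (Num.min r3 e2).
have r0 : 0 < r by rewrite !lt_min r10 r20 r30 e20.
exists r => // s s' cs ss s't; rewrite !lt_min => /andP[/andP[hr1 hr2] /andP[hr3 hr4]].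
have h0 : 0 <= s' - s by rewrite subr_ge0.
have in_ct u : s <= u <= s' -> `[c, t]%classic u.
  by move=> /andP[su us]; rewrite /= in_itv/= (le_trans cs su) (le_trans us s't).
have cl u u' rr : s <= u <= s' -> s <= u' <= s' -> s' - s < rr -> `|u - u'| < rr.
  move=> /andP[su us] /andP[su' us'] hr; rewrite ltr_norml; apply/andP; split; lra.
have Wcl u u' : s <= u <= s' -> s <= u' <= s' -> `|W u - W u'| < e2.
  by move=> iu iu'; apply: H3; [exact: in_ct..|exact: cl].
split.
- move=> ts.
  have W1 : `|W s' - W s| < e2 by apply: Wcl; rewrite ?lexx ?ss.
  have o2 : 0 <= `|W s' - W s| ^+ 2 by rewrite exprn_ge0.
  have c1 : `|discounted x s - discounted x s' - martingale_increment x W s s'|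
      <= K * ((e1 + (s' - s) + `|W s' - W s|) * ((s' - s) + `|W s' - W s| ^+ 2)).
    apply: (cell q x W tau s s' e1 (r1 / 2)) => //.
    + by rewrite e1C (ltW e10).
    + by move=> u iu; apply/ltW/H2; [exact: in_ct|by apply: in_ct; rewrite ss lexx|apply: cl; rewrite ?lexx ?ss].
    + move=> j u y iu yx yn; apply/ltW/H1 => //.
      * by have := in_ct _ iu; rewrite /= in_itv.
      * by rewrite s't (le_trans cs).
      * by apply: xn; rewrite s't (le_trans ts).
      * by apply: cl; rewrite ?lexx ?ss.
      * by apply: le_lt_trans yx _; lra.
  apply: le_trans c1 _; rewrite mulrA; apply: ler_wpM2r; first exact: addr_ge0.
  apply: le_trans e1e; apply: ler_wpM2l => //; lra.
- move=> st ts'.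
  have iu : s <= tau <= s' by rewrite !ltW.
  have W1 : `|W s' - W s| < e2 by apply: Wcl; rewrite ?lexx ?ss.
  have W2 : `|W s' - W tau| < e2 by apply: Wcl; rewrite ?lexx ?ss ?iu.
  have U := unif tau s' (lexx _) (ltW ts') s't.
  have [_ _ _ _ b1] := bd1 q x W tau s s' sol (ltW ts') ss s't.
  have [_ _ _ _ b2] := bd1 q x W tau tau s' sol (ltW ts') (ltW ts') s't.
  have sq u : `|u : 'rV[R]_d| < e2 -> `|u| ^+ 2 <= e2.
    move=> ue; rewrite expr2; apply: le_trans (_ : 1 * `|u| <= _); last by rewrite mul1r ltW.
    by rewrite ler_wpM2r// (le_trans (ltW ue)).
  have W1s := sq _ W1; have W2s := sq _ W2.
  have h1 : s' - s <= e2 by exact: ltW.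
  have h2 : s' - tau <= e2 by have := ltW st; lra.
  have t1 : `|discounted x tau - discounted x s' - martingale_increment x W s s'| <=
     `|discounted x tau - discounted x s' - martingale_increment x W tau s'|
     + `|martingale_increment x W tau s'| + `|martingale_increment x W s s'|.
    rewrite -[X in `|X - _|](subrK (martingale_increment x W tau s')).
    by apply: le_trans (ler_normB _ _) _; apply: lerD => //; exact: ler_normD.
  apply: le_trans t1 _; apply: le_trans (lerD (lerD U b2) b1) _; apply: le_trans e23.
  have u1 : k * (s' - tau + `|W s' - W tau| ^+ 2) <= k * (2 * e2).
    by apply: ler_wpM2l => //; lra.
  have u2 : B * (s' - tau + `|W s' - W tau| + `|W s' - W tau| ^+ 2) <= B * (3 * e2).
    by apply: ler_wpM2l => //; have := ltW W2; lra.
  have u3 : B * (s' - s + `|W s' - W s| + `|W s' - W s| ^+ 2) <= B * (3 * e2).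
    by apply: ler_wpM2l => //; have := ltW W1; lra.
  apply: le_trans (lerD (lerD u1 u2) u3) _.
  by rewrite /kB; have := mulr_ge0 k0 (ltW e20); have := ltW e20; lra.
Qed.
End PathwiseIto.

(** * Telescoping up to an exit time *)

Section Telescoping.
Context {R : realType} {d : nat}.

(** [M] is telescoped along the grid points replaced by their maximum with tau: cells before tau
    contribute nothing, cells after tau the full expansion, and at most one cell straddles tau,
    which is why k' is paid once. *)
Lemma stopped_telescoping (M : R -> R) (e : R -> R -> R) (om : R -> R -> R) (c t tau k k' : R) N :
  c <= t -> c <= tau <= t -> 0 <= k -> 0 <= k' -> (forall s s', 0 <= om s s') ->
  (forall i, (i < N.+1)%N -> let s := grid c t N i in let s' := grid c t N i.+1 in
     (tau <= s -> `|M s - M s' - e s s'| <= k * ((s' - s) + om s s')) /\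
     (s < tau -> tau < s' -> `|M tau - M s' - e s s'| <= k' + k * ((s' - s) + om s s'))) ->
  `|M tau - M t - \sum_(i < N.+1) (tau < grid c t N i.+1)%R%:R * e (grid c t N i) (grid c t N i.+1)|
   <= k * ((t - c) + \sum_(i < N.+1) om (grid c t N i) (grid c t N i.+1)) + k'.
Proof.
move=> ct /andP[ctau taut] k0 k'0 om0 H.
pose m i := Num.max (grid c t N i) tau.
pose e' i := (tau < grid c t N i.+1)%R%:R * e (grid c t N i) (grid c t N i.+1).
(* br i - br (i+1) is 1 exactly when tau lies beyond the left end of cell i but not beyond its right
   end, so charging k' to this difference lets it telescope. *)
pose br i : R := (grid c t N i < tau)%R%:R.
have tele (f : nat -> R) n : \sum_(i < n) (f i - f i.+1) = f 0%N - f n.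
  elim: n => [|n IH]; first by rewrite big_ord0 subrr.
  by rewrite big_ord_recr /= IH; ring.
have -> : M tau - M t = \sum_(i < N.+1) (M (m i) - M (m i.+1)).
  by rewrite (tele (fun i => M (m i))) /m grid0 gridN max_r// max_l.
rewrite -sumrB; apply: le_trans (ler_norm_sum _ _ _) _.
apply: (@le_trans _ _ (\sum_(i < N.+1) (k * ((grid c t N i.+1 - grid c t N i)
     + om (grid c t N i) (grid c t N i.+1)) + k' * (br i - br i.+1)))).
  apply: ler_sum => i _; have [H1 H2] := H i (ltn_ord i).
  have gg := grid_le N ct (leqnSn i).
  have k1 : 0 <= k * ((grid c t N i.+1 - grid c t N i) + om (grid c t N i) (grid c t N i.+1)).
    by rewrite mulr_ge0// addr_ge0// subr_ge0.
  rewrite /m /br; case: (lerP (grid c t N i.+1) tau) => [g1|g1].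
    rewrite (max_r (le_trans gg g1)) subrr mul0r subrr normr0 addr_ge0// mulr_ge0//.
    rewrite subr_ge0 ler_nat; case: (ltrP (grid c t N i.+1) tau) => // g2.
    by rewrite (le_lt_trans gg g2).
  rewrite mul1r [(grid c t N i.+1 < tau)]ltNge (ltW g1) subr0.
  case: (lerP tau (grid c t N i)) => g2.
    by rewrite mulr0 addr0; exact: H1.
  by rewrite mulr1 [leRHS]addrC; exact: H2.
rewrite big_split /= -!mulr_sumr tele /br grid0 gridN [(t < tau)]ltNge taut subr0 lerD//.
  rewrite big_split /= ler_wpM2l// lerD2r.
  rewrite (eq_bigr (fun i : 'I_N.+1 => - grid c t N i - - grid c t N i.+1)).
    by rewrite (tele (fun i => - grid c t N i)) grid0 gridN opprK addrC.
  by move=> i _; rewrite opprK addrC.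
by rewrite ler_piMr//; case: (c < tau).
Qed.
End Telescoping.

Section ExitTime.
Context {R : realType} {V : normedModType R}.

(** The last such time in forward order is the first exit in backward order. If the supremum exceeds
    [c], continuity makes the norm at least n there. *)
Lemma last_exit_exists (x : R -> V) (c t n : R) : c <= t -> {within `[c, t], continuous x} ->
  exists tau, [/\ c <= tau <= t, forall r, tau < r <= t -> `|x r| < n &
    tau = c \/ n <= `|x tau|].
Proof.
move=> ct /subspace_continuousP cx.
(* Including [c] makes the set nonempty and gives the default value when the path never leaves the
   ball. *)
pose S := [set r | r = c \/ (c <= r <= t /\ n <= `|x r|)].
have Sc : S c by left.
have St : ubound S t by move=> r [->//|[/andP[]]].
have hS : has_sup S by split; [exists c|exists t].
have cS : c <= sup S by exact: ub_le_sup hS.2 c Sc.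
have tS : sup S <= t by apply: ge_sup => //; exists c.
exists (sup S); split; first by rewrite cS.
  move=> r /andP[r1 r2]; rewrite ltNge; apply/negP => nr.
  have : r <= sup S by apply: ub_le_sup hS.2 _ _; right; rewrite (le_trans cS (ltW r1)) r2.
  by rewrite leNgt r1.
move: cS; rewrite le_eqVlt => /predU1P[->|cS]; first by left.
right; rewrite leNgt; apply/negP => xn.
have I : `[c, t]%classic (sup S) by rewrite /= in_itv/= (ltW cS).
have := cx _ I => /cvgr_dist_lt/(_ (n - `|x (sup S)|)); rewrite subr_gt0 => /(_ xn).
rewrite /within /= => /nbhs_ballP[e /= e0 He].
have m0 : 0 < Num.min e (sup S - c) by rewrite lt_min e0 subr_gt0.
have [r Sr rS] := sup_adherent m0 hS.
have rle : r <= sup S by exact: ub_le_sup hS.2 _ Sr.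
case: Sr => [rc|[/andP[cr rt] nr]].
  move: rS; rewrite rc; have : Num.min e (sup S - c) <= sup S - c by rewrite ge_min lexx orbT.
  by lra.
have := He r; rewrite /= -ball_normE /= => /(_ _ _).
have b1 : `|sup S - r| < e.
  rewrite ger0_norm ?subr_ge0//; have : Num.min e (sup S - c) <= e by rewrite ge_min lexx.
  by lra.
move=> /(_ b1); rewrite in_itv/= cr rt => /(_ isT) H.
have := lerB_dist (x r) (x (sup S)); rewrite distrC => H'.
by have := le_lt_trans H' H; lra.
Qed.
End ExitTime.

Section StoppedProcess.
Context {R : realType} d (T : measurableType d).

(** The random time is rounded up to the grid, which turns the stopped value into a finite sum of
    measurable terms; continuity of the path recovers the value at tau as the mesh shrinks. *)
Lemma measurable_stopped (k : R -> T -> R) (tau : T -> R) (c t : R) : c <= t ->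
  (forall s, c <= s <= t -> measurable_fun setT (k s)) ->
  (forall o, {within `[c, t], continuous (k^~ o)}) ->
  measurable_fun setT tau -> (forall o, c <= tau o <= t) ->
  measurable_fun setT (fun o => k (tau o) o).
Proof.
move=> ct mk ck mtau taut.
pose ind N i o : R := (grid c t N i < tau o)%R%:R - (grid c t N i.+1 < tau o)%R%:R.
(* The cells are open on the left, so tau = c belongs to none of them and gets a term of its own. *)
pose kN N o := (tau o <= c)%R%:R * k c o + \sum_(i < N.+1) ind N i o * k (grid c t N i.+1) o.
have mb (f : T -> bool) : measurable_fun setT f -> measurable_fun setT (fun o => (f o)%:R : R).
  move=> mf; rewrite (_ : (fun o => (f o)%:R : R) = (fun o => if f o then 1 else 0)).
    exact: measurable_fun_ifT.
  by apply/funext => o; case: (f o).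
have mlt u : measurable_fun setT (fun o => u < tau o) by exact: measurable_fun_ltr.
have kNE N o : exists u, [/\ c <= u <= t, tau o <= u, u - tau o <= (t - c) / N.+1%:R & kN N o = k u o].
  have /andP[c1 c2] := taut o.
  move: c1; rewrite le_eqVlt => /predU1P[tc|ctau].
    exists c; split; rewrite ?lexx// -?tc ?lexx ?subrr//.
      by rewrite divr_ge0// subr_ge0.
    rewrite /kN -tc lexx mul1r big1 ?addr0// => i _.
    rewrite /ind -tc ltNge; have /andP[-> _] := grid_itv ct (ltnW (ltn_ord i)).
    by rewrite ltNge; have /andP[-> _] := grid_itv ct (ltn_ord i); rewrite subrr mul0r.
  have ex : exists i, tau o <= grid c t N i by exists N.+1; rewrite gridN.
  case: (ex_minnP ex) => i0 Hi0 mini.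
  have i0pos : (0 < i0)%N.
    by rewrite lt0n; apply/eqP => i00; move: Hi0; rewrite i00 grid0 leNgt ctau.
  have i0N : (i0 <= N.+1)%N by apply: mini; rewrite gridN.
  have prev : grid c t N i0.-1 < tau o.
    by rewrite ltNge; apply/negP => /mini; rewrite leqNgt prednK// leqnn.
  have I0 : (i0.-1 < N.+1)%N by rewrite prednK.
  exists (grid c t N i0); split => //.
  - exact: grid_itv.
  - have := gridS c t N i0.-1; rewrite prednK// => <-; lra.
  rewrite /kN leNgt ctau mul0r add0r (bigD1 (Ordinal I0))//= big1 ?addr0.
    by rewrite /ind prednK// prev ltNge Hi0 subr0 mul1r.
  move=> j; rewrite -val_eqE /= neq_ltn /ind => /orP[ji|ij].
    have g1 : grid c t N j.+1 < tau o.
      rewrite ltNge; apply/negP => /mini; rewrite leqNgt => /negP; apply.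
      by rewrite -(prednK i0pos) ltnS.
    by rewrite g1 (le_lt_trans (grid_le N ct (leqnSn j)) g1) subrr mul0r.
  have g1 : tau o <= grid c t N j by apply: le_trans Hi0 (grid_le N ct _); rewrite -(prednK i0pos).
  by rewrite !ltNge g1 (le_trans g1 (grid_le N ct (leqnSn j))) subrr mul0r.
apply: (@measurable_fun_cvg _ _ _ setT kN) => [N|o _].
  apply: measurable_funD.
    apply: measurable_funM; last by apply: mk; rewrite lexx.
    by apply: mb; exact: measurable_fun_ler.
  apply: measurable_sum => i; apply: measurable_funM.
    by apply: measurable_funB; exact/mb/mlt.
  by apply: mk; exact: grid_itv.
have /subspace_continuousP ko := ck o.
apply/cvgrPdist_lt => e e0.
have I : `[c, t]%classic (tau o) by rewrite /= in_itv/= taut.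
have := ko _ I => /cvgr_dist_lt/(_ e e0); rewrite /within /= => /nbhs_ballP[r /= r0 Hr].
have /cvgrPdist_lt/(_ _ r0) := grid_mesh_cvg c t; apply: filterS => N.
rewrite sub0r normrN ger0_norm ?divr_ge0 ?subr_ge0// => hN.
have [u [cu tu uh ->]] := kNE N o.
apply: Hr; rewrite /= ?in_itv//= -ball_normE /= distrC ger0_norm ?subr_ge0//.
exact: le_lt_trans hN.
Qed.
End StoppedProcess.

(** * Remainders controlled by a quadratic variation *)

Section Remainders.
Context d (T : measurableType d) (R : realType) (P : probability T R).

Lemma bounded_integrable (f : T -> R) (K : R) : measurable_fun setT f ->
  (forall o, `|f o| <= K) -> P.-integrable setT (EFin \o f).
Proof.
move=> mf fK; apply: measurable_bounded_integrable => //.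
- by apply: le_lt_trans (probability_le1 _ measurableT) _; rewrite ltry.
- by exists K; split; rewrite ?num_real// => x Kx o _; apply: le_trans (fK o) (ltW Kx).
Qed.

Lemma bounded_cvg_integral (f : (T -> R)^nat) (g : T -> R) (K : R) :
  (forall N, measurable_fun setT (f N)) -> (forall N o, `|f N o| <= K) ->
  (forall o, f N o @[N --> \oo] --> g o) ->
  (\int[P]_o (f N o)%:E @[N --> \oo] --> \int[P]_o (g o)%:E)%E.
Proof.
move=> mf fK fg.
have mg : measurable_fun setT g by apply: (@measurable_fun_cvg _ _ _ setT f) => // o _; exact: fg.
have h1 N : measurable_fun setT (fun o => (f N o)%:E) by exact/measurable_EFinP.
have h2 : measurable_fun setT (fun o => (g o)%:E) by exact/measurable_EFinP.
have h3 : {ae P, forall o, setT o -> (f N o)%:E @[N --> \oo] --> (g o)%:E}.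
  by apply: aeW => o _; apply: cvg_EFin; [exact: nearW|exact: fg].
have h4 : P.-integrable setT (fun=> K%:E) by exact: finite_measure_integrable_cst.
have h5 : {ae P, forall o, forall N : nat, setT o -> (`|(f N o)%:E| <= K%:E)%E}.
  by apply: aeW => o N _; rewrite lee_fin.
by have [_ _] := dominated_convergence measurableT h1 h2 h3 h4 h5.
Qed.

Lemma near_ereal_lt (u : (\bar R)^nat) (c : R) : u N @[N --> \oo] --> 0%E -> 0 < c ->
  \forall N \near \oo, (u N < c%:E)%E.
Proof.
move=> /fine_cvgP[fu cu] c0; have H := cvgr_lt _ cu c c0.
near=> N; have fN : u N \is a fin_num by near: N; exact: fu.
by rewrite -(fineK fN) lte_fin; near: N; exact: H.
Unshelve. all: end_near. Qed.

Lemma markov_ge0 (f : T -> R) (e : R) : measurable_fun setT f -> (forall o, 0 <= f o) -> 0 < e ->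
  (e%:E * P [set o | (e <= f o)%R] <= \int[P]_o (f o)%:E)%E.
Proof.
move=> mf f0 e0.
have mE : measurable [set o | (e <= f o)%R].
  by rewrite -[X in measurable X]setTI; apply: measurable_fun_ler => //; exact: measurable_cst.
rewrite -integral_cst// integral_mkcond; apply: ge0_le_integral => //=.
- by move=> o _; rewrite patchE; case: ifP => // _; rewrite lee_fin ltW.
- by apply/measurable_restrict => //; rewrite setTI; exact: measurable_cst.
- exact/measurable_EFinP.
- move=> o _; rewrite patchE; case: ifPn; rewrite ?lee_fin// inE; exact.
Qed.

Section Quadratic.
Variables (f Q : (T -> R)^nat).
Hypothesis mf : forall N, measurable_fun setT (f N).
Hypothesis mQ : forall N, measurable_fun setT (Q N).
Hypothesis Q0 : forall N o, 0 <= Q N o.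
Hypothesis fQ : forall o (e : R), 0 < e -> \forall N \near \oo, `|f N o| <= e * (1 + Q N o).

Let Q1 N o : 0 < 1 + Q N o. Proof. by rewrite ltr_pwDl. Qed.

(** [Q] need not converge along a given path, but the normalised remainder tends to 0 there, so
    dominated convergence applies to it. *)
Let g N o := `|f N o| / (1 + Q N o).

Let g0 N o : 0 <= g N o. Proof. by rewrite divr_ge0// ltW. Qed.

Let mg N : measurable_fun setT (g N).
Proof.
apply: measurable_funM; first exact: measurableT_comp.
rewrite (_ : (fun o => _) = (fun x => (1 + x)^-1) \o (Q N))//.
pose Dn : set R := `[0, +oo[%classic.
have mi : measurable_fun Dn (fun x : R => (1 + x)^-1).
  apply: subspace_continuous_measurable_fun; first exact: measurable_itv.
  apply/subspace_continuousP => x.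
  rewrite /Dn /= in_itv/= andbT => x0; apply: cvg_within_filter.
  apply: cvgV; first by rewrite gt_eqF// ltr_pwDl.
  by apply: cvgD; [exact: cvg_cst|exact: cvg_id].
apply: (@measurable_comp _ _ _ _ _ _ Dn) => //; first exact: measurable_itv.
by move=> _ [x _ <-]; rewrite /Dn /= in_itv/= andbT.
Qed.

Let cvgg o : g N o @[N --> \oo] --> 0.
Proof.
apply/cvgrPdist_le => e e0; apply: (filterS _ (fQ o e0)) => N HN.
by rewrite sub0r normrN (ger0_norm (g0 N o)) /g ler_pdivrMr.
Qed.

(** Either [Q] is large, which Markov's inequality makes improbable from its first moment alone, or
    the normalised remainder is not small, which bounded convergence makes improbable. *)
Lemma remainder_probability_vanishes (C : R) : (forall N, (\int[P]_o (Q N o)%:E <= C%:E)%E) ->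
  forall e eta : R, 0 < e -> 0 < eta ->
  \forall N \near \oo, (P [set o | (e < `|f N o|)%R] < eta%:E)%E.
Proof.
move=> QC e eta e0 eta0.
have C0 : 0 <= C.
  by rewrite -lee_fin; apply: le_trans (QC 0%N); apply: integral_ge0 => o _; rewrite lee_fin.
(* Large enough for C / K to be at most eta / 2, also when C = 0. *)
pose K := 1 + 4 * C / eta.
have Ceta : 0 <= 4 * C / eta by rewrite divr_ge0 ?mulr_ge0// ltW.
have K0 : 0 < K by rewrite ltr_pwDl.
(* The cap provides the bound for dominated convergence, and no information is lost: if Q < K and
   |f| > e, then g exceeds e / (1 + K) and the cap is attained. *)
pose m N o := Num.min (g N o) (e / (1 + K)).
have k1 : 0 < 1 + K by rewrite addr_gt0.
have eK : 0 < e / (1 + K) by rewrite divr_gt0.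
have m0 N o : 0 <= m N o by rewrite le_min g0 ltW.
have mm N : measurable_fun setT (m N) by exact: measurable_minr.
have mc : (\int[P]_o (m N o)%:E @[N --> \oo] --> \int[P]_o (0 : R)%:E)%E.
  apply: (@bounded_cvg_integral _ _ (e / (1 + K))) => // [N o|o].
    by rewrite ger0_norm// ge_min lexx orbT.
  apply: (squeeze_cvgr _ (cvg_cst 0) (cvgg o)); apply: nearW => N.
  by rewrite m0 ge_min lexx.
rewrite integral0 in mc.
have ee : 0 < eta / 2 * (e / (1 + K)) by rewrite mulr_gt0// divr_gt0.
apply: (filterS _ (near_ereal_lt mc ee)) => N HN.
have M1 := markov_ge0 (mm N) (m0 N) eK.
have Kh : 0 < K / 2 by rewrite divr_gt0.
have mQN : measurable_fun setT (fun o => Q N o) by [].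
have M2 := markov_ge0 (mQ N) (Q0 N) K0.
pose A1 := [set o | (e / (1 + K) <= m N o)%R]; pose A2 := [set o | (K <= Q N o)%R].
have mA1 : measurable A1.
  by rewrite -[X in measurable X]setTI; apply: measurable_fun_ler => //; exact: measurable_cst.
have mA2 : measurable A2.
  by rewrite -[X in measurable X]setTI; apply: measurable_fun_ler => //; exact: measurable_cst.
have mA : measurable [set o | (e < `|f N o|)%R].
  by rewrite -[X in measurable X]setTI; apply: measurable_fun_ltr => //; exact: measurableT_comp.
have sub : [set o | (e < `|f N o|)%R] `<=` A1 `|` A2.
  move=> o /= fo; case: (lerP K (Q N o)) => KQ; [by right|left].
  rewrite /A1 /m /= le_min lexx andbT /g ler_pdivlMr// mulrAC ler_pdivrMr//.
  by apply: ler_pM; rewrite ?(ltW e0) ?(ltW (Q1 N o)) ?(ltW fo)// lerD2l ltW.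
apply: (@le_lt_trans _ _ (P A1 + P A2)%E).
  by apply: le_trans (measureU2 _ mA1 mA2); rewrite le_measure ?inE//; exact: measurableU.
have pA1 : (P A1 < (eta / 2)%:E)%E.
  have := le_lt_trans M1 HN; rewrite -/A1 -(fineK (fin_num_measure P _ mA1)) -EFinM !lte_fin.
  by rewrite mulrC ltr_pM2r.
have pA2 : (P A2 <= (eta / 2)%:E)%E.
  have := le_trans M2 (QC N); rewrite -/A2 -(fineK (fin_num_measure P _ mA2)) -EFinM !lee_fin => H.
  rewrite -(ler_pM2l K0); apply: le_trans H _.
  by rewrite /K mulrDl mul1r; have -> : 4 * C / eta * (eta / 2) = 2 * C by [field; rewrite gt_eqF]; lra.
have -> : eta%:E = ((eta / 2)%:E + (eta / 2)%:E)%E by rewrite -EFinD -splitr.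
move: pA1 pA2; rewrite -(fineK (fin_num_measure P _ mA1)) -(fineK (fin_num_measure P _ mA2)).
by rewrite -!EFinD !lte_fin !lee_fin; lra.
Qed.

(** Since |f| = g (1 + Q), Young's inequality gives |f| <= g^2 / (2 eta) + eta (1 + Q^2). The first
    term vanishes in mean because [g] is bounded, and the second moment of [Q] controls the other;
    [eta] is chosen so that it contributes e / 2. *)
Lemma remainder_expectation_vanishes (K C : R) : (forall N o, `|f N o| <= K * (1 + Q N o)) ->
  (forall N, (\int[P]_o (Q N o ^+ 2)%:E <= C%:E)%E) ->
  forall e : R, 0 < e -> \forall N \near \oo, (\int[P]_o (`|f N o|)%:E <= e%:E)%E.
Proof.
move=> fK QC e e0.
have C0 : 0 <= C.
  by rewrite -lee_fin; apply: le_trans (QC 0%N); apply: integral_ge0 => o _; rewrite lee_fin sqr_ge0.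
have gK N o : `|g N o ^+ 2| <= K ^+ 2.
  rewrite normrX lerXn2r ?nnegrE//; last by rewrite (ger0_norm (g0 N o)) /g ler_pdivrMr.
  have := le_trans (normr_ge0 _) (fK N o); rewrite pmulr_lge0//.
have mg2 N : measurable_fun setT (fun o => g N o ^+ 2) by exact: measurable_funX.
have mc : (\int[P]_o (g N o ^+ 2)%:E @[N --> \oo] --> \int[P]_o (0 : R)%:E)%E.
  apply: (@bounded_cvg_integral (fun N o => g N o ^+ 2) (fun=> 0) (K ^+ 2)) => // o.
  have := cvgM (cvgg o) (cvgg o); rewrite mul0r.
  exact.
rewrite integral0 in mc.
pose eta := e / (2 * (1 + C)).
have C1 : 0 < 1 + C by rewrite ltr_pwDl.
have eta0 : 0 < eta by rewrite divr_gt0// mulr_gt0.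
have ee : 0 < e * eta by rewrite mulr_gt0.
apply: (filterS _ (near_ereal_lt mc ee)) => N HN.
have mQ2 : measurable_fun setT (fun o => Q N o ^+ 2) by exact: measurable_funX.
apply: (@le_trans _ _ (\int[P]_o ((2 * eta)^-1%:E * (g N o ^+ 2)%:E + eta%:E * (1 + (Q N o ^+ 2)%:E)))%E).
  apply: ge0_le_integral => //=.
  - by apply/measurable_EFinP; exact: measurableT_comp.
  - by apply: emeasurable_funD; apply: emeasurable_funM => //; [exact/measurable_EFinP|apply: emeasurable_funD => //; exact/measurable_EFinP].
  move=> o _; rewrite -?EFinD -?EFinM -?EFinD lee_fin.
  have -> : `|f N o| = g N o * (1 + Q N o) by rewrite /g divfK// gt_eqF.
  have i0 : 0 < (2 * eta)^-1 by rewrite invr_gt0 mulr_gt0.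
  have := mulr_ge0 (ltW i0) (sqr_ge0 (g N o - eta * (1 + Q N o))).
  have -> : (2 * eta)^-1 * (g N o - eta * (1 + Q N o)) ^+ 2
    = (2 * eta)^-1 * g N o ^+ 2 - g N o * (1 + Q N o) + eta / 2 * (1 + Q N o) ^+ 2.
    by field; rewrite gt_eqF.
  have := mulr_ge0 (ltW eta0) (sqr_ge0 (Q N o - 1)); lra.
rewrite ge0_integralD//=; last 4 first.
- by move=> o _; rewrite -EFinM lee_fin mulr_ge0 ?sqr_ge0// invr_ge0 mulr_ge0// ltW.
- by apply: emeasurable_funM => //; exact/measurable_EFinP.
- by move=> o _; rewrite -EFinD -EFinM lee_fin mulr_ge0 ?(ltW eta0)// addr_ge0// sqr_ge0.
- by apply: emeasurable_funM => //; apply: emeasurable_funD => //; exact/measurable_EFinP.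
rewrite ge0_integralZl//; last 3 first.
- exact/measurable_EFinP.
- by move=> o _; rewrite lee_fin sqr_ge0.
- by rewrite lee_fin invr_ge0 mulr_ge0// ltW.
rewrite ge0_integralZl//; last 3 first.
- by apply: emeasurable_funD => //; exact/measurable_EFinP.
- by move=> o _; rewrite -EFinD lee_fin addr_ge0// sqr_ge0.
- by rewrite lee_fin ltW.
rewrite ge0_integralD//; last 2 first.
- by move=> o _; rewrite lee_fin sqr_ge0.
- exact/measurable_EFinP.
rewrite integral_cst// [X in (1 * X)%E]probability_setT mule1.
have -> : e = (2 * eta)^-1 * (e * eta) + eta * (1 + C) by rewrite /eta; field; rewrite !gt_eqF.
rewrite EFinD; apply: leeD.
  rewrite EFinM; apply: lee_wpmul2l; last exact: ltW.
  by rewrite lee_fin invr_ge0 mulr_ge0// ltW.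
rewrite [leRHS]EFinM; apply: lee_wpmul2l; first by rewrite lee_fin ltW.
by rewrite EFinD; apply: leeD.
Qed.
End Quadratic.
End Remainders.

(** * The augmented backward filtration and adapted functionals *)

Section Filtration.
Context {R : realType} {d : nat} {dO : measure_display}
        {Omega : measurableType dO} (P : probability Omega R).
Variables (a t : R) (w : R -> Omega -> 'rV[R]_d).
Hypothesis wW : wiener P a w.

Lemma backward_filtration_measurable s A : backward_filtration P w t s A -> measurable A.
Proof. by case. Qed.

Lemma backward_filtration_sigma_algebra s : a <= s ->
  sigma_algebra setT (backward_filtration P w t s).
Proof.
move=> as_; have Fm B := @increments_sigma_measurable R d dO Omega P a w wW t s B as_.
have [S0 SD SU] := smallest_sigma_algebra setT [set A | exists r i B,
  [/\ s <= r <= t, measurable B & A = [set o : Omega | B ((w t o - w r o) 0 i)]]].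
split.
- split=> //; exists set0 => //; by rewrite !setD0 setU0 measure0.
- move=> A [mA [B iB AB]]; split; first exact: measurableD.
  exists (setT `\` B); first exact: SD.
  rewrite -AB; congr (P _); rewrite !setTD !setDE !setCK.
  by rewrite [in LHS](setIC (~` A)) [in LHS](setIC (~` B)) setUC setUC.
- move=> A HA; have mA n : measurable (A n) by case: (HA n).
  have /choice[B HB] : forall n, exists B, increments_sigma w t s B /\
      P ((A n `\` B) `|` (B `\` A n)) = 0%E.
    by move=> n; case: (HA n) => _ [B ? ?]; exists B.
  have mB n : measurable (B n) by apply: Fm; case: (HB n).
  split; first exact: bigcupT_measurable.
  exists (\bigcup_n B n); first by apply: SU => n; case: (HB n).
  have mD n : measurable ((A n `\` B n) `|` (B n `\` A n)).
    by apply: measurableU; exact: measurableD.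
  apply/measure_negligible.
    by apply: measurableU; apply: measurableD; exact: bigcupT_measurable.
  apply: (@negligibleS _ _ _ _ (\bigcup_n ((A n `\` B n) `|` (B n `\` A n)))); last first.
    apply: negligible_bigcup => n; apply/negligibleP => //; exact: (HB n).2.
  move=> x [[[n _ Ax] nB]|[[n _ Bx] nA]]; exists n => //.
    by left; split => // Bx; apply: nB; exists n.
  by right; split => // Ax; apply: nA; exists n.
Qed.

(** The filtration at time s as a measurable structure on the sample space: adaptedness becomes
    ordinary measurability and inherits its closure properties. By [pastE] the generated
    sigma-algebra adds no event. *)
Definition past s := g_sigma_algebraType (backward_filtration P w t s).

Lemma pastE s A : a <= s -> @measurable _ (past s) A = backward_filtration P w t s A.
Proof.
move=> as_; rewrite -[LHS]/(<<s backward_filtration P w t s >> A) smallest_id//.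
exact: backward_filtration_sigma_algebra.
Qed.

Lemma backward_filtration_mono r s : a <= r -> r <= s ->
  backward_filtration P w t s `<=` backward_filtration P w t r.
Proof.
move=> ar rs A [mA [B iB AB]]; split=> //; exists B => //.
move: iB; apply: smallest_sub; first exact: smallest_sigma_algebra.
move=> _ [u [i [C [/andP[su ut] mC ->]]]]; apply: sub_sigma_algebra.
by exists u, i, C; split => //; rewrite (le_trans rs su).
Qed.

Lemma backward_filtration_null s N : measurable N -> P N = 0%E -> backward_filtration P w t s N.
Proof.
move=> mN N0; split=> //; exists set0; last by rewrite setD0 set0D setU0.
by case: (smallest_sigma_algebra setT [set A | exists r i B,
  [/\ s <= r <= t, measurable B & A = [set o : Omega | B ((w t o - w r o) 0 i)]]]).
Qed.

Section Adapted.
Variable X : R -> Omega -> 'rV[R]_d.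
Hypothesis FX : forall s i B, a <= s <= t -> measurable B ->
        backward_filtration P w t s [set o | B (X s o 0 i)].
Hypothesis cX : forall o, {within `[a, t], continuous (X^~ o)}.

Lemma adapted_coord s r i : a <= s -> s <= r -> r <= t ->
  measurable_fun setT ((fun o => X r o 0 i) : past s -> R).
Proof.
move=> as_ sr rt _ B mB; rewrite setTI pastE//.
apply: (@backward_filtration_mono s r) => //; apply: FX => //.
by rewrite (le_trans as_ sr).
Qed.

Lemma adapted_path s r (f : 'rV[R]_d -> R) : a <= s -> s <= r -> r <= t -> continuous f ->
  measurable_fun setT ((fun o => f (X r o)) : past s -> R).
Proof.
move=> as_ sr rt cf; apply: (@measurable_continuous_coord _ _ (past s)) => // i.
exact: adapted_coord.
Qed.

Lemma adapted_integral s (f : R -> 'rV[R]_d -> R) T : a <= s -> s <= t ->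
  `[s, t] `<=` T -> continuous_on T f ->
  measurable_fun setT ((fun o => \int[lebesgue_measure]_(r in `[s, t]) f r (X r o))%R : past s -> R).
Proof.
move=> as_ st sT cf; apply: (@measurable_path_integral _ _ (past s) (fun r o => f r (X r o))) => //.
- move=> r /andP[sr rt]; apply: adapted_path => //; first exact: ltW.
  by apply: continuous_on_space cf; apply: sT; rewrite /= in_itv/= (ltW sr).
- have sub : `[s, t]%classic `<=` `[a, t]%classic.
    by move=> r /=; rewrite !in_itv/= => /andP[sr ->]; rewrite (le_trans as_ sr).
  move=> o; have cXo : {within `[s, t], continuous (X^~ o)} := continuous_subspaceW sub (@cX o).
  exact: (continuous_on_path sT cf cXo).
Qed.

(** An uncountable union over r is made countable: the ball is left if and only if, for every m,
    some grid point carries a norm above n - 1/(m+1). One direction is uniform continuity of the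
    path, the other the attained maximum of its norm. *)
Lemma adapted_exit s (n : R) : a <= s -> s <= t ->
  @measurable _ (past s) [set o | exists r, s <= r <= t /\ n <= `|X r o|].
Proof.
move=> as_ st.
pose E m N i := [set o | n - m.+1%:R^-1 < `|X (grid s t N i) o|].
have mE m N i : (i <= N.+1)%N -> @measurable _ (past s) (E m N i).
  move=> iN; have /andP[g1 g2] := grid_itv st iN.
  have mN : measurable_fun setT ((fun o => `|X (grid s t N i) o|) : past s -> R).
    by apply: (adapted_path (f := fun x => `|x|)) => //; exact: norm_continuous.
  have := mN measurableT _ (measurable_itv `]n - m.+1%:R^-1, +oo[); rewrite setTI.
  congr measurable; apply/seteqP; split => x; by rewrite /E /= in_itv/= andbT.
have sub : `[s, t]%classic `<=` `[a, t]%classic.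
  by move=> r /=; rewrite !in_itv/= => /andP[sr ->]; rewrite (le_trans as_ sr).
have cx (o : Omega) : {within `[s, t], continuous (X^~ o)} := continuous_subspaceW sub (@cX o).
have -> : [set o | exists r, s <= r <= t /\ n <= `|X r o|]
   = \bigcap_m \bigcup_N \bigcup_(i in [set i | (i <= N.+1)%N]) E m N i.
  apply/seteqP; split => o.
    move=> [r [/andP[sr rt] nr]] m _.
    have m0 : 0 < m.+1%:R^-1 :> R by rewrite invr_gt0.
    have [dl dl0 Hd] := uniform_continuity_on_compact (@segment_compact _ s t) (@cx o) m0.
    have /cvgrPdist_lt/(_ _ dl0)[N _ /(_ N (leqnn N))] := grid_mesh_cvg s t.
    rewrite /= sub0r normrN ger0_norm ?divr_ge0 ?subr_ge0// => hN.
    have ex : exists i, r <= grid s t N i by exists N.+1; rewrite gridN.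
    case: (ex_minnP ex) => i0 Hi0 mini.
    have i0N : (i0 <= N.+1)%N by apply: mini; rewrite gridN.
    exists N => //; exists i0 => //; rewrite /E /=.
    have gr : `|grid s t N i0 - r| < dl.
      rewrite ger0_norm ?subr_ge0//; apply: le_lt_trans hN; case: i0 Hi0 mini i0N => [|i] Hi0 mini i0N.
        by rewrite grid0 (le_trans (_ : s - r <= 0))// ?subr_le0// divr_ge0// subr_ge0.
      rewrite -(gridS s t N i) lerD2l lerN2 leNgt; apply/negP => /ltW /mini.
      by rewrite ltnn.
    have := Hd (grid s t N i0) r; rewrite /= !in_itv/= sr rt grid_itv// => /(_ isT isT gr).
    have := lerB_dist (X r o) (X (grid s t N i0) o); rewrite distrC => H1 H2.
    by rewrite ltrBlDr; apply: le_lt_trans nr _; rewrite addrC -ltrBlDr; exact: le_lt_trans H1 H2.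
  move=> H.
  have cn : {within `[s, t], continuous (fun r => `|X r o|)}.
    by move=> z; apply: cvg_norm; exact: (@cx o).
  have [r rs rmax] := EVT_max st cn.
  exists r; split; first by rewrite in_itv in rs.
  rewrite leNgt; apply/negP => xn.
  have n0 : 0 < n - `|X r o| by rewrite subr_gt0.
  have [m _ /(_ m (leqnn m)) Hm0] := @near_infty_natSinv_lt R (PosNum n0).
  have Hm : m.+1%:R^-1 < n - `|X r o| := Hm0.
  have [N _ [i iN]] := H m I; rewrite /E /= => Ei.
  have := rmax (grid s t N i); rewrite in_itv/= grid_itv// => /(_ isT) /= H3.
  by have := lt_le_trans Ei H3; rewrite ltrBlDr -ltrBlDl => /(lt_trans Hm); rewrite ltxx.
apply: bigcapT_measurable => m; apply: bigcupT_measurable => N.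
by apply: bigcup_measurable => i; exact: mE.
Qed.
End Adapted.
End Filtration.

(** * Quadratic variation and exit times *)

Section QuadraticVariation.
Context {R : realType} {d : nat} {dO : measure_display}
        {Omega : measurableType dO} (P : probability Omega R).
Variables (a : R) (w : R -> Omega -> 'rV[R]_d).
Hypothesis wW : wiener P a w.

Lemma dotv_ge_norm (x : 'rV[R]_d) : `|x| ^+ 2 <= dotv x x.
Proof.
have d0 : 0 <= dotv x x by apply: sumr_ge0 => i _; rewrite -expr2 sqr_ge0.
have : `|x| <= Num.sqrt (dotv x x).
  apply: norm_le_coord => [|i]; first exact: sqrtr_ge0.
  rewrite -sqrtr_sqr ler_sqrt//= /dotv (bigD1 i)//= expr2 lerDl.
  by apply: sumr_ge0 => j _; rewrite -expr2 sqr_ge0.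
by move=> h; rewrite -[leRHS]sqr_sqrtr// lerXn2r ?nnegrE ?sqrtr_ge0.
Qed.

Lemma increment_second_moment s s' i : a <= s -> s <= s' ->
  (\int[P]_o (((w s' o - w s o) 0 i) ^+ 2)%:E = (s' - s)%:E)%E.
Proof.
move=> as_; rewrite le_eqVlt => /predU1P[<-|ss'].
  rewrite subrr integral0_eq// => o _; by rewrite subrr mxE expr0n.
have := normal_second_moment (wiener_increment_measurable wW i as_ (le_trans as_ (ltW ss'))) _
  (fun A => @wiener_increment_law _ _ _ _ _ _ _ wW s s' i A as_ ss').
by rewrite sqrtr_gt0 subr_gt0 ss' sqr_sqrtr ?subr_ge0 ?(ltW ss')//; apply.
Qed.

Lemma increment_fourth_moment s s' i : a <= s -> s < s' ->
  (\int[P]_o (((w s' o - w s o) 0 i) ^+ 4)%:E <= (64 * (s' - s) ^+ 2)%:E)%E.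
Proof.
move=> as_ ss'.
have := normal_fourth_moment (wiener_increment_measurable wW i as_ (le_trans as_ (ltW ss'))) _
  (fun A => @wiener_increment_law _ _ _ _ _ _ _ wW s s' i A as_ ss').
rewrite sqrtr_gt0 subr_gt0 ss' -[Num.sqrt _ ^+ 4]/(Num.sqrt (s' - s) ^+ (2 * 2)) exprM.
by rewrite sqr_sqrtr ?subr_ge0 ?(ltW ss')//; apply.
Qed.

Definition square_increment (W : R -> 'rV[R]_d) s s' := dotv (W s' - W s) (W s' - W s).

Lemma square_increment_ge0 W s s' : 0 <= square_increment W s s'.
Proof. by apply: sumr_ge0 => i _; rewrite -expr2 sqr_ge0. Qed.

Lemma measurable_square_increment s s' : a <= s -> a <= s' ->
  measurable_fun setT (fun o => square_increment (w^~ o) s s').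
Proof.
move=> as_ as'; apply: measurable_sum => i.
by apply: measurable_funM; exact: (wiener_increment_measurable wW).
Qed.

Lemma square_increment_expectation s s' : a <= s -> s <= s' ->
  (\int[P]_o (square_increment (w^~ o) s s')%:E = (d%:R * (s' - s))%:E)%E.
Proof.
move=> as_ ss'; have as' := le_trans as_ ss'.
under eq_integral do rewrite -sumEFin.
rewrite ge0_integral_sum//=; last 2 first.
- move=> i; apply/measurable_EFinP; apply: measurable_funM; exact: (wiener_increment_measurable wW).
- by move=> i o _; rewrite lee_fin -expr2 sqr_ge0.
under eq_bigr do under eq_integral do rewrite -expr2.
under eq_bigr do rewrite increment_second_moment//.
by rewrite sumEFin sumr_const card_ord mulr_natl.
Qed.

Definition quadratic_variation c t N (W : R -> 'rV[R]_d) : R :=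
  \sum_(i < N.+1) square_increment W (grid c t N i) (grid c t N i.+1).

(** Cauchy-Schwarz, over cells and over coordinates, reduces the square to (N+1) d times a sum of
    (N+1) d fourth moments, each at most 64 ((t - c) / (N+1))^2; the powers of N+1 cancel, so the
    bound is uniform in the grid. *)
Lemma quadratic_variation_second_moment c t N : a <= c -> c < t ->
  (\int[P]_o ((quadratic_variation c t N (w^~ o)) ^+ 2)%:E <= (64 * (d%:R * (t - c)) ^+ 2)%:E)%E.
Proof.
move=> ac ct; have ag i : (i <= N.+1)%N -> a <= grid c t N i.
  by move=> iN; have /andP[? _] := grid_itv (ltW ct) iN; exact: le_trans ac _.
pose W (i : 'I_N.+1) (k : 'I_d) o := (w (grid c t N i.+1) o - w (grid c t N i) o) 0 k.
pose m : R := (N.+1)%:R * d%:R.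
have mW i k : measurable_fun setT (W i k).
  by apply: (wiener_increment_measurable wW); apply: ag => //; exact: ltnW.
have CS (n : nat) (x : 'I_n -> R) : (\sum_i x i) ^+ 2 <= n%:R * \sum_i x i ^+ 2.
  have : 0 <= \sum_i \sum_j (x i - x j) ^+ 2.
    by apply: sumr_ge0 => i _; apply: sumr_ge0 => j _; exact: sqr_ge0.
  have -> : \sum_i \sum_j (x i - x j) ^+ 2 = 2 * (n%:R * (\sum_i x i ^+ 2) - (\sum_i x i) ^+ 2).
    pose S := \sum_i x i ^+ 2; pose S1 := \sum_i x i.
    have E i : \sum_j (x i - x j) ^+ 2 = n%:R * x i ^+ 2 - 2 * S1 * x i + S.
      rewrite (eq_bigr (fun j => x i ^+ 2 + (- (2 * x i) * x j + x j ^+ 2))); last by move=> j _; ring.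
      rewrite big_split/= big_split/= sumr_const card_ord -mulr_sumr -/S -/S1 -(mulr_natl (x i ^+ 2)).
      by ring.
    under eq_bigr do rewrite E.
    rewrite big_split/= sumrB -!mulr_sumr -/S -/S1 sumr_const card_ord -(mulr_natl S).
    by ring.
  by rewrite pmulr_rge0// subr_ge0.
have Q2 o : (quadratic_variation c t N (w^~ o)) ^+ 2 <= m * \sum_i \sum_k W i k o ^+ 4.
  rewrite /m -mulrA; apply: le_trans (CS _ _) _; rewrite ler_wpM2l// mulr_sumr ler_sum// => i _.
  apply: le_trans (CS _ _) _; rewrite ler_wpM2l// ler_sum// => k _.
  by rewrite -expr2 -exprM.
apply: (@le_trans _ _ (\int[P]_o (m * \sum_i \sum_k W i k o ^+ 4)%:E)%E).
  apply: ge0_le_integral => //.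
  - by move=> o _; rewrite lee_fin sqr_ge0.
  - apply/measurable_EFinP; apply: measurable_funX; apply: measurable_sum => i.
    by apply: measurable_square_increment; apply: ag => //; exact: ltnW.
  - apply/measurable_EFinP; apply: measurable_funM => //; apply: measurable_sum => i.
    by apply: measurable_sum => k; exact: measurable_funX.
  - by move=> o _; rewrite lee_fin.
have m0 : 0 <= m by rewrite mulr_ge0.
have mW4 i k : measurable_fun setT (fun o => (W i k o ^+ 4)%:E).
  by apply/measurable_EFinP; exact: measurable_funX.
have W40 i k o : (0 <= (W i k o ^+ 4)%:E)%E by rewrite lee_fin exprn_even_ge0.
under eq_integral do rewrite EFinM -sumEFin.
under eq_integral do under eq_bigr do rewrite -sumEFin.
rewrite ge0_integralZl//; last 2 first.
- by apply: emeasurable_sum => i; apply: emeasurable_sum => k; exact: mW4.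
- by move=> o _; apply: sume_ge0 => i _; apply: sume_ge0 => k _.
rewrite ge0_integral_sum//; last 2 first.
- by move=> i; apply: emeasurable_sum => k; exact: mW4.
- by move=> i o _; apply: sume_ge0 => k _.
under eq_bigr do rewrite ge0_integral_sum//.
pose h := (t - c) / N.+1%:R.
apply: (@le_trans _ _ (m%:E * \sum_(i < N.+1) \sum_(k < d) (64 * h ^+ 2)%:E)%E).
  apply: lee_wpmul2l => //; apply: lee_sum => i _; apply: lee_sum => k _.
  have -> : h = grid c t N i.+1 - grid c t N i by rewrite gridS.
  apply: increment_fourth_moment; first by apply: ag; exact: ltnW.
  by apply: grid_lt.
under eq_bigr do rewrite sumEFin sumr_const card_ord.
rewrite sumEFin sumr_const card_ord -EFinM lee_fin.
rewrite -(mulr_natl (64 * h ^+ 2)) -(mulr_natl (d%:R * _)) le_eqVlt; apply/orP; left.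
by apply/eqP; rewrite /m /h; field.
Qed.
End QuadraticVariation.

Section ExitTimes.
Context {R : realType} {d : nat} {dO : measure_display}
        {Omega : measurableType dO} (P : probability Omega R).
Variables (a t : R) (w : R -> Omega -> 'rV[R]_d).
Hypothesis wW : wiener P a w.

Lemma measurable_stopping_time tau : backward_stopping_time P w a t tau ->
  measurable_fun setT tau.
Proof.
move=> [taut Ftau]; apply: (@measurability _ _ _ _ setT tau _ (RGenCInfty.measurableE R)).
move=> _ [_ [s ->] <-]; rewrite setTI.
have -> : tau @^-1` `[s, +oo[ = [set o | s <= tau o].
  by apply/seteqP; split => o; rewrite /= in_itv/= andbT.
have [sa|sa] := leP s a.
  rewrite (_ : [set _ | _] = setT)//; apply/seteqP; split => o // _ /=.
  by have /andP[h _] := taut o; exact: le_trans h.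
have [st|st] := leP s t; first by apply: (Ftau s _).1; rewrite (ltW sa) st.
rewrite (_ : [set _ | _] = set0)//; apply/seteqP; split => o //=.
by have /andP[_ h] := taut o => h'; have := lt_le_trans st (le_trans h' h); rewrite ltxx.
Qed.

Lemma stopped_before_past tau s : backward_stopping_time P w a t tau -> a <= s <= t ->
  @measurable _ (past P t w s) [set o | tau o < s].
Proof.
move=> [_ Ftau] /andP[as_ st].
rewrite (_ : [set o | _] = ~` [set o | s <= tau o]).
  by apply: measurableC; rewrite (pastE wW)//; apply: Ftau; rewrite as_.
by apply/seteqP; split => o /= h; [apply/negP; rewrite -ltNge|rewrite ltNge; apply/negP].
Qed.

Variables (b : R -> 'rV[R]_d -> 'rV[R]_d) (sigma : R) (q : 'rV[R]_d) (X : R -> Omega -> 'rV[R]_d).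
Hypothesis sX : backward_solution P b sigma w a t q X.

(* Time runs down from [t]: this is the first time, in that direction, at which [X] leaves the open
   ball of radius [n], and [c] if it does not leave. *)
Definition exit_time c (n : R) (tau : Omega -> R) := forall o,
  [/\ c <= tau o <= t, forall r, tau o < r <= t -> `|X r o| < n &
    tau o = c \/ n <= `|X (tau o) o|].

Lemma exit_time_exists c n : a <= c <= t -> exists tau, exit_time c n tau.
Proof.
move=> /andP[ac ct]; have [_ cX _] := sX.
have /choice[tau H] : forall o, exists r, [/\ c <= r <= t, forall u, r < u <= t -> `|X u o| < n &
    r = c \/ n <= `|X r o|].
  move=> o; apply: (last_exit_exists (x := X^~ o)) => //.
  apply: continuous_subspaceW (@cX o) => r /=; rewrite !in_itv/= => /andP[cr ->].
  by rewrite (le_trans ac cr).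
by exists tau.
Qed.

(** Above c, tau is at least s exactly when the norm reaches n somewhere between s and t, an event
    of the past by [adapted_exit]; at or below c it always is. *)
Lemma exit_time_stopping c n tau : a <= c -> exit_time c n tau ->
  backward_stopping_time P w a t tau.
Proof.
move=> ac H; have [FX cX _] := sX; split=> [x|s /andP[as_ st]].
  by have [/andP[h ->] _ _] := H x; rewrite (le_trans ac h).
rewrite -(pastE wW)//; have [sc|cs] := leP s c.
  rewrite (_ : [set _ | _] = setT)//; apply/seteqP; split => o // _ /=.
  by have [/andP[h _] _ _] := H o; exact: le_trans h.
have := adapted_exit wW FX cX n as_ st; congr measurable; apply/seteqP; split => o /=.
  move=> [r [/andP[sr rt] nr]]; rewrite leNgt; apply/negP => ts.
  have [_ h _] := H o; have := h r; rewrite rt (lt_le_trans ts sr) => /(_ isT).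
  by rewrite ltNge nr.
move=> stau; have [/andP[_ tt] _ [tc|h]] := H o; last by exists (tau o); rewrite stau tt.
by have := lt_le_trans cs stau; rewrite tc ltxx.
Qed.

(** Immediately after tau the path is in the open ball, so continuity gives the closed one at tau.
    This needs later times, hence tau < t. *)
Lemma exit_time_bound c n tau o : a <= c -> exit_time c n tau -> tau o < t ->
  `|X (tau o) o| <= n.
Proof.
move=> ac H tt; rewrite leNgt; apply/negP => nX.
have [/andP[ct _] Hn _] := H o; have [_ cX _] := sX.
have e0 : 0 < `|X (tau o) o| - n by rewrite subr_gt0.
have [r r0 Hr] := uniform_continuity_on_compact (@segment_compact _ a t) (@cX o) e0.
pose u := Num.min (tau o + r / 2) t.
have ut : u <= t by rewrite /u ge_min lexx orbT.
have tu : tau o < u by rewrite /u lt_min tt andbT ltrDl divr_gt0.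
have ur : u <= tau o + r / 2 by rewrite /u ge_min lexx.
have atau : a <= tau o := le_trans ac ct.
have : `|X (tau o) o - X u o| < `|X (tau o) o| - n.
  apply: Hr; rewrite /= ?in_itv/= ?atau ?(ltW tt)// ?ut ?(le_trans atau (ltW tu))//.
  by rewrite distrC gtr0_norm ?subr_gt0//; clearbody u; lra.
have := Hn u; rewrite tu ut => /(_ isT).
have := lerB_dist (X (tau o) o) (X u o).
by move=> h1 h2 h3; have := le_lt_trans h1 h3; rewrite ltrD2l ltrN2 => /(lt_trans h2); rewrite ltxx.
Qed.

Lemma solution_null_set : exists N, [/\ measurable N, P N = 0%E &
  forall o, ~ N o -> forall s, a <= s <= t -> X s o = q
          - \row_i (\int[lebesgue_measure]_(r in `[s, t]) b r (X r o) 0 i)%R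
          - sigma *: (w t o - w s o)].
Proof.
have [_ _ [N [mN N0 sub]]] := sX; exists N; split => // o No.
by apply: contrapT => h; apply: No; apply: sub => /= h'; apply: h => s; exact: h'.
Qed.

Lemma exit_path c n tau o : a < c -> c < t -> `|q| < n -> exit_time c n tau ->
  (forall s, a <= s <= t -> X s o = q
          - \row_i (\int[lebesgue_measure]_(r in `[s, t]) b r (X r o) 0 i)%R
          - sigma *: (w t o - w s o)) ->
  solution_path sigma (fun i r x => b r x 0 i) c t n q (X^~ o) (w^~ o) (tau o) /\ tau o < t.
Proof.
move=> ac ct qn H sde; have at_ := ltW (lt_trans ac ct).
have Xt : X t o = q.
  rewrite sde ?at_ ?lexx// subrr scaler0 subr0 set_itv1.
  rewrite (_ : \row__ _ = 0) ?subr0//.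
  by apply/rowP => i; rewrite !mxE Rintegral_set1.
have [/andP[ctau taut] Hn Hc] := H o.
have tt : tau o < t.
  rewrite lt_neqAle taut andbT; apply/eqP => E; case: Hc => [E'|].
    by move: ct; rewrite -E -E' ltxx.
  by rewrite E Xt leNgt qn.
have sub : `[c, t]%classic `<=` `[a, t]%classic.
  by move=> r /=; rewrite !in_itv/= => /andP[cr ->]; rewrite (le_trans (ltW ac) cr).
have [_ cX _] := sX; split=> //; split => //.
- by rewrite ctau taut.
- exact: continuous_subspaceW sub (@cX o).
- case: wW => _ /(_ o) h _; apply: continuous_subspaceW h => r /=.
  by rewrite !in_itv/= => /andP[cr _]; rewrite (le_trans (ltW ac) cr).
- by move=> s /andP[cs st]; rewrite sde// (le_trans (ltW ac) cs).
- move=> s /andP[ts st]; move: ts; rewrite le_eqVlt => /predU1P[<-|ts].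
    exact: (exit_time_bound (ltW ac) H).
  by apply/ltW/Hn; rewrite ts.
Qed.
End ExitTimes.

(** * The stopped martingale *)

Section Centered.
Context {dO : measure_display} {Omega : measurableType dO} {R : realType} (P : probability Omega R).

Definition centered (f : Omega -> R) :=
  P.-integrable setT (EFin \o f) /\ (\int[P]_o (f o)%:E = 0)%E.

Lemma centeredD f g : centered f -> centered g -> centered (fun o => f o + g o).
Proof.
move=> [if0 f0] [ig g0]; split.
  rewrite (_ : EFin \o _ = (EFin \o f) \+ (EFin \o g))%E; last exact/funext.
  exact: integrableD.
have := integralD_EFin measurableT if0 ig; rewrite [RHS](_ : _ = 0)%E; last first.
  by rewrite [X in (X + _)%E]f0 [X in (_ + X)%E]g0 adde0.
by move=> <-; apply: eq_integral => o _.
Qed.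

Lemma centeredZ k f : centered f -> centered (fun o => k * f o).
Proof.
move=> [if0 f0]; split.
  rewrite (_ : EFin \o _ = (fun o => k%:E * (EFin \o f) o))%E; last exact/funext.
  exact: integrableZl.
under eq_integral do rewrite EFinM.
by rewrite (@integralZl _ _ _ P _ measurableT (EFin \o f) if0) [X in (_ * X)%E]f0 mule0.
Qed.

Lemma centered_sum (I : finType) (f : I -> Omega -> R) :
  (forall i, centered (f i)) -> centered (fun o => \sum_i f i o).
Proof.
move=> cf; rewrite (_ : (fun o => _) = \sum_i f i); last first.
  by apply/funext => o; rewrite fct_sumE.
elim/big_ind : _ => // [|g h cg ch].
  by split; [exact: integrable0|rewrite integral0].
exact: centeredD.
Qed.
End Centered.

Section AdaptedFunctionals.
Context {R : realType} {d : nat} {dO : measure_display}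
        {Omega : measurableType dO} (P : probability Omega R).
Variables (a t sigma : R) (b : R -> 'rV[R]_d -> 'rV[R]_d) (w : R -> Omega -> 'rV[R]_d)
  (q : 'rV[R]_d) (X : R -> Omega -> 'rV[R]_d).
Hypothesis wW : wiener P a w.
Hypothesis sX : backward_solution P b sigma w a t q X.
Variables (T : set R) (v cc : R -> 'rV[R]_d -> R).
Hypothesis cv : continuous_on T v.
Hypothesis ccc : continuous_on T cc.

Lemma adapted_discount s : a <= s -> s <= t -> `[s, t] `<=` T ->
  measurable_fun setT ((fun o => discount cc t (X^~ o) s) : past P t w s -> R).
Proof.
move=> as_ st sT; have [FX cX _] := sX.
apply: (measurableT_comp (f := expR)); first exact: measurable_expR.
exact: (adapted_integral wW FX cX (T := T)).
Qed.

Lemma adapted_field s (f : R -> 'rV[R]_d -> R) : a <= s -> s <= t -> T s -> continuous_on T f ->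
  measurable_fun setT ((fun o => f s (X s o)) : past P t w s -> R).
Proof.
move=> as_ st Ts cf; have [FX cX _] := sX.
by apply: (adapted_path wW FX) => //; exact: continuous_on_space cf.
Qed.

Lemma past_measurable s (f : Omega -> R) : a <= s ->
  measurable_fun setT (f : past P t w s -> R) -> measurable_fun setT f.
Proof.
move=> as_ mf _ B mB; rewrite setTI; apply: (@backward_filtration_measurable _ _ _ _ P t w s).
by rewrite -(pastE wW)// -[X in @measurable _ _ X]setTI; exact: mf.
Qed.

Lemma measurable_discounted s : a <= s <= t -> `[s, t] `<=` T ->
  measurable_fun setT (fun o => discounted v cc t (X^~ o) s).
Proof.
move=> /andP[as_ st] sT; apply: (@past_measurable s) => //.
apply: measurable_funM; [exact: adapted_discount|apply: adapted_field => //].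
by apply: sT; rewrite /= in_itv/= lexx.
Qed.

Lemma continuous_discounted c o : a <= c <= t -> `[c, t] `<=` T ->
  {within `[c, t], continuous (fun s => discounted v cc t (X^~ o) s)}.
Proof.
move=> /andP[ac ct] cT; have [_ cX _] := sX.
have sub : `[c, t]%classic `<=` `[a, t]%classic.
  by move=> r /=; rewrite !in_itv/= => /andP[cr ->]; rewrite (le_trans ac cr).
have cx : {within `[c, t], continuous (X^~ o)} := continuous_subspaceW sub (@cX o).
have ccx := continuous_on_path cT ccc cx; have cvx := continuous_on_path cT cv cx.
have icc := continuous_itv_integrable ccx.
pose F s := (\int[lebesgue_measure]_(r in `[c, s]) cc r (X r o))%R.
have cF : {within `[c, t], continuous F}.
  move: ct icc; rewrite le_eqVlt => /predU1P[<- _|ct icc].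
    by rewrite set_itv1; exact: continuous_subspace1.
  exact: parameterized_integral_continuous (ltW ct) icc.
have cD : {within `[c, t], continuous (fun s => expR (F t - F s) * v s (X s o))}.
  move=> s; apply: cvgM; last exact: cvx.
  apply: (cvg_comp (fun s => F t - F s) expR); last exact: continuous_expR.
  exact: (cvgB (@cvg_cst _ (F t) _ _ _) (cF s)).
apply: subspace_eq_continuous cD => s /=; rewrite inE/= in_itv/= => /andP[cs st].
have cst : c <= s <= t by rewrite cs st.
congr (expR _ * _); rewrite /F.
have E := Rintegral_split cst ccx; lra.
Qed.
End AdaptedFunctionals.

Section StoppedExpectation.
Context {R : realType} {d : nat} {dO : measure_display}
        {Omega : measurableType dO} (P : probability Omega R).
Variables (a t sigma : R) (v vt cc : R -> 'rV[R]_d -> R) (v1 : 'I_d -> R -> 'rV[R]_d -> R)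
  (b : R -> 'rV[R]_d -> 'rV[R]_d) (v2 : 'I_d -> 'I_d -> R -> 'rV[R]_d -> R).
Hypothesis sigma0 : 0 < sigma.
Local Notation T := (`]a, +oo[%classic : set R).
Hypothesis cv : continuous_on T v.
Hypothesis cvt : continuous_on T vt.
Hypothesis ccc : continuous_on T cc.
Hypothesis cv1 : forall i, continuous_on T (v1 i).
Hypothesis cb : forall i, continuous_on T (fun r x => b r x 0 i).
Hypothesis cv2 : forall i j, continuous_on T (v2 i j).
Hypothesis dvt : forall s x, a < s -> is_derive s 1 (v^~ x) (vt s x).
Hypothesis dv1 : forall i s x, a < s -> is_derive x (delta_mx 0 i) (v s) (v1 i s x).
Hypothesis dv2 : forall i j s x, a < s -> is_derive x (delta_mx 0 j) (v1 i s) (v2 i j s x).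
Hypothesis pde : forall s x, a < s ->
  - vt s x - \sum_i b s x 0 i * v1 i s x + cc s x * v s x + sigma ^+ 2 / 2 * \sum_i v2 i i s x = 0.

Variables (w : R -> Omega -> 'rV[R]_d) (q : 'rV[R]_d) (X : R -> Omega -> 'rV[R]_d).
Hypothesis wW : wiener P a w.
Hypothesis sX : backward_solution P b sigma w a t q X.
Variables (c n : R) (tau : Omega -> R).
Hypothesis ac : a < c.
Hypothesis ct : c < t.
Hypothesis qn : `|q| < n.
Hypothesis xtau : exit_time t X c n tau.

Let bounds := backward_ito_path_bounds sigma0 cv cvt ccc cv1 cb cv2 dvt dv1 dv2 pde n ac (ltW ct).
Let small x W r := @backward_ito_path_small _ _ _ _ _ _ _ _ _ _
  sigma0 cv cvt ccc cv1 cb cv2 dvt dv1 dv2 pde c t n ac (ltW ct) q x W r.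
Let stau : backward_stopping_time P w a t tau := exit_time_stopping wW sX (ltW ac) xtau.

Let cT s : c <= s -> `[s, t] `<=` T.
Proof.
by move=> cs r /=; rewrite !in_itv/= andbT => /andP[sr _]; rewrite (lt_le_trans ac)// (le_trans cs).
Qed.

Lemma measurable_stopped_discounted :
  measurable_fun setT (fun o => discounted v cc t (X^~ o) (tau o)).
Proof.
apply: (measurable_stopped (k := fun s o => discounted v cc t (X^~ o) s) (ltW ct)).
- move=> s /andP[cs st]; apply: (measurable_discounted wW sX cv ccc); last exact: cT.
  by rewrite (le_trans (ltW ac) cs).
- move=> o; apply: (continuous_discounted sX cv ccc); last exact: cT.
  by rewrite !ltW.
- exact: measurable_stopping_time stau.
- by move=> o; case: (xtau o).
Qed.

Section NullSet.
Variable N : set Omega.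
Hypothesis mN : measurable N.
Hypothesis N0 : P N = 0%E.
Hypothesis sdeN : forall o, ~ N o -> forall s, a <= s <= t -> X s o = q
          - \row_i (\int[lebesgue_measure]_(r in `[s, t]) b r (X r o) 0 i)%R
          - sigma *: (w t o - w s o).

Let path o (No : ~ N o) := exit_path wW sX ac ct qn xtau (sdeN No).

(** The equation may fail on the null set [N]. Removing [N] makes the coefficients bounded at every
    sample point, and the augmentation of the filtration keeps the event in the past. *)
Let G s : set Omega := ~` N `&` [set o | tau o < s].

(** The event that tau lies before s' is known from the path after s', as are the coefficients
    frozen at s'; their product is therefore an admissible coefficient for the increment over the
    whole cell, even if tau falls inside it. *)
Lemma stopped_increment_centered s s' : c <= s -> s < s' -> s' <= t ->
  centered P (fun o => \1_(G s') o * martingale_increment sigma cc v1 v2 t (X^~ o) (w^~ o) s s').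
Proof.
move=> cs ss s't; have cs' : c <= s' := le_trans cs (ltW ss).
have as_ : a <= s := le_trans (ltW ac) cs; have as' : a <= s' := le_trans (ltW ac) cs'.
have [k k0 Hk] := bounds.
have mG : @measurable _ (past P t w s') (G s').
  apply: measurableI; last by apply: (stopped_before_past wW stau); rewrite as' s't.
  by apply: measurableC; rewrite (pastE wW)//; exact: backward_filtration_null.
have bG o (x : R) : (G s' o -> `|x| <= k) -> `|\1_(G s') o * x| <= k.
  by rewrite indicE; case: (boolP (o \in G s')); rewrite ?inE ?notin_setE ?mul1r ?mul0r ?normr0// => Go; apply.
have bk o : G s' o -> (forall i, `|discount cc t (X^~ o) s' * v1 i s' (X s' o)| <= k) /\
    (forall i j, `|discount cc t (X^~ o) s' * v2 i j s' (X s' o)| <= k).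
  move=> [No ts]; have [sol _] := path No; have [_ _ _ h] := Hk _ _ _ _ sol.
  by apply: h; rewrite (ltW ts).
have mD := adapted_discount wW sX ccc as' s't (@cT s' cs').
have mI : measurable_fun setT (\1_(G s') : past P t w s' -> R) by exact: measurable_indic.
have F1 (f : R -> 'rV[R]_d -> R) : continuous_on T f -> forall B, measurable B ->
    backward_filtration P w t s' ((fun o => \1_(G s') o * (discount cc t (X^~ o) s' * f s' (X s' o))) @^-1` B).
  move=> cf B mB; rewrite -(pastE wW)// -[X in @measurable _ _ X]setTI.
  apply: (measurable_funM (T := past P t w s')) => //; apply: (measurable_funM (T := past P t w s')) => //.
  apply: (adapted_field wW sX as' s't _ cf).
  by apply: (@cT s' cs'); rewrite /= in_itv/= lexx.
pose xi i o := \1_(G s') o * (discount cc t (X^~ o) s' * v1 i s' (X s' o)).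
pose eta i j o := \1_(G s') o * (discount cc t (X^~ o) s' * v2 i j s' (X s' o)).
pose W i o := (w s' o - w s o) 0 i.
(* The subtracted trace of the Hessian becomes the diagonal correction of W_i W_j, so that each
   summand is centered by one of the three lemmas on adapted coefficients. *)
have -> : (fun o => \1_(G s') o * martingale_increment sigma cc v1 v2 t (X^~ o) (w^~ o) s s') =
   (fun o => - sigma * \sum_i xi i o * W i o +
      sigma ^+ 2 / 2 * \sum_i \sum_j eta i j o * (W i o * W j o - (s' - s) *+ (i == j))).
  apply/funext => o; rewrite /martingale_increment.
  have -> : \sum_i xi i o * W i o = \1_(G s') o * discount cc t (X^~ o) s' *
      \sum_i (w s' o - w s o) 0 i * v1 i s' (X s' o).
    by rewrite mulr_sumr; apply: eq_bigr => i _; rewrite /xi /W; ring.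
  have -> : \sum_i \sum_j eta i j o * (W i o * W j o - (s' - s) *+ (i == j)) =
      \1_(G s') o * discount cc t (X^~ o) s' *
     (\sum_i \sum_j (w s' o - w s o) 0 i * (w s' o - w s o) 0 j * v2 i j s' (X s' o)
        - (s' - s) * \sum_i v2 i i s' (X s' o)).
    rewrite mulr_sumr -sumrB mulr_sumr; apply: eq_bigr => i _.
    have -> : (s' - s) * v2 i i s' (X s' o) = \sum_j ((s' - s) *+ (i == j)) * v2 i j s' (X s' o).
      rewrite (bigD1 i)//= eqxx mulr1n big1 ?addr0// => j ji.
      by rewrite eq_sym (negbTE ji) mulr0n mul0r.
    by rewrite -sumrB mulr_sumr; apply: eq_bigr => j _; rewrite /eta /W; ring.
  ring.
apply: centeredD; apply: centeredZ; apply: centered_sum => i.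
  have xik o : `|xi i o| <= k by apply: bG => Go; exact: (bk o Go).1.
  exact: (adapted_increment wW as_ ss s't (F1 _ (@cv1 i)) xik).
apply: centered_sum => j.
have ek o : `|eta i j o| <= k by apply: bG => Go; exact: (bk o Go).2.
have [<-|ij] := eqVneq i j.
  rewrite (_ : (fun o => _) = (fun o => eta i i o * (W i o ^+ 2 - (s' - s)))); last first.
    by apply/funext => o; rewrite mulr1n -expr2.
  apply: (adapted_increment_sqr wW as_ ss s't (C := k) (F1 _ (@cv2 i i))) => o.
  by apply: bG => Go; exact: (bk o Go).2.
rewrite (_ : (fun o => _) = (fun o => eta i j o * (W i o * W j o))); last first.
  by apply/funext => o; rewrite mulr0n subr0.
exact: (adapted_increment_cross wW as_ ss s't (F1 _ (@cv2 i j)) ek).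
Qed.

Lemma discounted_terminal o : ~ N o -> discounted v cc t (X^~ o) t = v t q.
Proof.
move=> No; have at_ := ltW (lt_trans ac ct).
rewrite /discounted /discount set_itv1 Rintegral_set1 expR0 mul1r; congr (v t _).
rewrite (sdeN No) ?at_ ?lexx// subrr scaler0 subr0 set_itv1.
rewrite (_ : \row__ _ = 0) ?subr0//.
by apply/rowP => i; rewrite !mxE Rintegral_set1.
Qed.

Let M o s := discounted v cc t (X^~ o) s.
Let e o s s' := martingale_increment sigma cc v1 v2 t (X^~ o) (w^~ o) s s'.
Let S m o := \sum_(i < m.+1) \1_(G (grid c t m i.+1)) o * e o (grid c t m i) (grid c t m i.+1).
(** Put to 0 on [N], as are the sums [S m], so that the bounds on h - S m hold at every sample
    point. *)
Let h o := \1_(~` N) o * (M o (tau o) - M o t).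

Let h_sub_S m o : ~ N o -> h o - S m o = M o (tau o) - M o t -
  \sum_(i < m.+1) (tau o < grid c t m i.+1)%R%:R * e o (grid c t m i) (grid c t m i.+1).
Proof.
move=> No; rewrite /h indicE mem_set// mul1r; congr (_ - _); apply: eq_bigr => i _; congr (_ * _).
rewrite indicE; congr (_%:R); case: ltP => Ht.
  by rewrite mem_set//; split.
by rewrite memNset// => -[_ /=]; rewrite ltNge Ht.
Qed.

Let h_sub_S_null m o : N o -> h o - S m o = 0.
Proof.
move=> No; rewrite /h indicE memNset; last by apply.
rewrite mul0r sub0r /S big1 ?oppr0// => i _; rewrite indicE memNset ?mul0r//.
by case.
Qed.

Let S_centered m : centered P (S m).
Proof.
apply: centered_sum => i; have iN : (i < m.+1)%N := ltn_ord i.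
have /andP[g1 _] := grid_itv (ltW ct) (ltnW iN).
have /andP[_ g2] := grid_itv (ltW ct) iN.
by apply: stopped_increment_centered => //; exact: grid_lt.
Qed.

Let om o := square_increment (w^~ o).
Let Q m o := quadratic_variation c t m (w^~ o).

Let om_ge o s s' k : 0 <= k -> k * (s' - s + `|w s' o - w s o| ^+ 2) <= k * (s' - s + om o s s').
Proof. by move=> k0; rewrite ler_wpM2l// lerD2l; exact: dotv_ge_norm. Qed.

Let T0 : 0 < 1 + (t - c).
Proof. by rewrite ltr_pwDl// subr_ge0 ltW. Qed.

Let Q0 m o : 0 <= Q m o.
Proof. by apply: sumr_ge0 => i _; exact: square_increment_ge0. Qed.

Let h_sub_S_bound : exists2 K, 0 <= K & forall m o, `|h o - S m o| <= K * (1 + Q m o).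
Proof.
have [k k0 Hk] := bounds; exists (k * (1 + (t - c))); first by rewrite mulr_ge0// ltW.
move=> m o; have [No|No] := pselect (N o).
  rewrite h_sub_S_null// normr0 mulr_ge0// ?mulr_ge0// ?(ltW T0)//.
  by rewrite addr_ge0//; exact: Q0.
have [sol _] := path No; have [U1 U2 _ _] := Hk _ _ _ _ sol.
have [ctt _ _] := xtau o.
have := @stopped_telescoping R (M o) (e o) (om o) c t (tau o) k k m (ltW ct) ctt k0 k0.
rewrite -h_sub_S// => /(_ (@square_increment_ge0 _ _ (w^~ o))) H.
apply: le_trans (H _) _ => [i iN s s'|].
  have ss' : s <= s' by apply: grid_le => //; exact: ltW.
  have /andP[cs _] : c <= s <= t by apply: grid_itv; [exact: ltW|exact: ltnW].
  have /andP[_ st] : c <= s' <= t by apply: grid_itv; [exact: ltW|].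
  split=> [ts|st' ts'].
    by apply: le_trans (U1 s s' ts ss' st) _; exact: om_ge.
  by apply: le_trans (U2 s s' cs st' ts' st) _; rewrite lerD2l; exact: om_ge.
rewrite -/(quadratic_variation c t m (w^~ o)) -/(Q m o).
have h1 : 0 <= k * (t - c) by rewrite mulr_ge0// subr_ge0 ltW.
have := mulr_ge0 h1 (Q0 m o); lra.
Qed.

Let h_sub_S_small o (eps : R) : 0 < eps -> \forall m \near \oo, `|h o - S m o| <= eps * (1 + Q m o).
Proof.
move=> e0; have [No|No] := pselect (N o).
  by apply: nearW => m; rewrite h_sub_S_null// normr0 mulr_ge0 ?(ltW e0)// addr_ge0//; exact: Q0.
have [sol _] := path No; have e1 : 0 < eps / (1 + (t - c)) by rewrite divr_gt0.
have [r r0 Hr] := small sol e1.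
have near_r : \forall m \near \oo, (t - c) / m.+1%:R < r.
  exact: (cvgr_lt _ (@grid_mesh_cvg R c t) r r0).
apply: (filterS _ near_r) => m mr.
have [ctt _ _] := xtau o.
have := @stopped_telescoping R (M o) (e o) (om o) c t (tau o) _ _ m (ltW ct) ctt (ltW e1) (ltW e1).
rewrite -h_sub_S// => /(_ (@square_increment_ge0 _ _ (w^~ o))) H.
apply: le_trans (H _) _ => [i iN s s'|].
  have ss' : s <= s' by apply: grid_le => //; exact: ltW.
  have /andP[cs _] : c <= s <= t by apply: grid_itv; [exact: ltW|exact: ltnW].
  have /andP[_ st] : c <= s' <= t by apply: grid_itv; [exact: ltW|].
  have [|U1 U2] := Hr s s' cs ss' st; first by rewrite gridS.
  split=> [ts|st' ts'].
    by apply: le_trans (U1 ts) _; apply: om_ge; exact: ltW.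
  apply: le_trans (U2 st' ts') _; rewrite lerDl mulr_ge0 ?(ltW e1)// addr_ge0 ?subr_ge0//.
  exact: square_increment_ge0.
rewrite -/(quadratic_variation c t m (w^~ o)) -/(Q m o).
have -> : eps / (1 + (t - c)) * (t - c + Q m o) + eps / (1 + (t - c)) =
  eps + eps / (1 + (t - c)) * Q m o by field; rewrite gt_eqF.
rewrite mulrDr mulr1 lerD2l ler_wpM2r// ?Q0//.
by rewrite ler_pdivrMr// ler_peMr ?(ltW e0)// lerDl subr_ge0 ltW.
Qed.

Let mh : measurable_fun setT h.
Proof.
apply: measurable_funM; first by apply: measurable_indic; exact: measurableC.
apply: measurable_funB; first exact: measurable_stopped_discounted.
apply: (measurable_discounted wW sX cv ccc); last by apply: cT; exact: ltW.
by rewrite lexx andbT ltW// (lt_trans ac).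
Qed.

Let ih : P.-integrable setT (EFin \o h).
Proof.
have [k k0 Hk] := bounds.
apply: (@bounded_integrable _ _ _ _ _ (k + k)) => // o.
have [No|No] := pselect (N o).
  by rewrite /h indicE memNset ?mul0r ?normr0 ?addr_ge0//; apply.
rewrite /h indicE mem_set// mul1r; have [sol tt] := path No; have [_ _ H _] := Hk _ _ _ _ sol.
by apply: le_trans (ler_normB _ _) _; apply: lerD; apply: H; rewrite ?lexx ?(ltW tt).
Qed.

(** As [S m] is centered, the mean of h equals that of h - S m for every m, and the latter is as
    small as desired. *)
Let Eh : (\int[P]_o (h o)%:E = 0)%E.
Proof.
have [K K0 HK] := h_sub_S_bound.
have mS m : measurable_fun setT (S m).
  by apply/measurable_EFinP; case: (S_centered m) => /measurable_int.
have mQ m : measurable_fun setT (Q m).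
  apply: measurable_sum => i; apply: (measurable_square_increment wW).
    have /andP[? _] := grid_itv (ltW ct) (ltnW (ltn_ord i)).
    exact: le_trans (ltW ac) _.
  have /andP[? _] := grid_itv (ltW ct) (ltn_ord i).
  exact: le_trans (ltW ac) _.
have mf m : measurable_fun setT (fun o => h o - S m o) by exact: measurable_funB.
have QC m := quadratic_variation_second_moment wW m (ltW ac) ct.
have van := @remainder_expectation_vanishes _ _ _ P (fun m o => h o - S m o) Q mf mQ Q0
  h_sub_S_small K _ HK QC.
apply/eqP; rewrite -abse_eq0 eq_le abse_ge0 andbT; apply/lee_addgt0Pr => eps e0; rewrite add0e.
have [m _ /(_ m (leqnn m)) Hm] := van eps e0.
apply: le_trans Hm.
have [iS ES] := S_centered m.
have iD : P.-integrable setT (EFin \o (fun o => h o - S m o)).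
  rewrite (_ : EFin \o _ = ((EFin \o h) \- (EFin \o S m))%E); last exact/funext.
  exact: integrableB.
have -> : (\int[P]_o (h o)%:E = \int[P]_o (h o - S m o)%:E)%E.
  have := integralB_EFin measurableT ih iS; rewrite [X in (_ - X)%E]ES sube0 => <-.
  by apply: eq_integral => o _.
exact: (le_abse_integral _ measurableT (measurable_int _ iD)).
Qed.

Lemma stopped_expectation_null_set :
  P.-integrable setT (EFin \o (fun o => discounted v cc t (X^~ o) (tau o))) /\
  (\int[P]_o (discounted v cc t (X^~ o) (tau o))%:E = (v t q)%:E)%E.
Proof.
have ic : P.-integrable setT (EFin \o (fun=> v t q)) by exact: finite_measure_integrable_cst.
have mM : measurable_fun setT (fun o => (discounted v cc t (X^~ o) (tau o))%:E).
  by apply/measurable_EFinP; exact: measurable_stopped_discounted.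
have mhv : measurable_fun setT (fun o => (h o + v t q)%:E).
  by apply/measurable_EFinP; apply: measurable_funD.
have ihv : P.-integrable setT (fun o => (h o + v t q)%:E).
  by have := integrableD measurableT ih ic; apply: eq_integrable => // o _.
have ae : ae_eq P setT (fun o => (discounted v cc t (X^~ o) (tau o))%:E) (fun o => (h o + v t q)%:E).
  exists N; split => // o /= Ho; apply: contrapT => No; apply: Ho => _.
  by rewrite /h indicE mem_set// mul1r /M discounted_terminal// subrK.
split.
  apply/integrableP; split => //; case/integrableP: ihv => _; apply: le_lt_trans.
  rewrite le_eqVlt; apply/orP; left; apply/eqP; apply: ae_eq_integral => //.
  - exact: measurableT_comp.
  - exact: measurableT_comp.
  - by move: ae; apply: filterS => o H _; congr (`|_|)%E; exact: H.
transitivity (\int[P]_o (h o + v t q)%:E)%E; first exact: ae_eq_integral.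
have := integralD_EFin measurableT ih ic; rewrite [X in (X + _)%E]Eh add0e.
by rewrite integral_cst// [X in (_ * X)%E]probability_setT mule1 => <-; apply: eq_integral => o _.
Qed.
End NullSet.

Theorem stopped_expectation :
  P.-integrable setT (EFin \o (fun o => discounted v cc t (X^~ o) (tau o))) /\
  (\int[P]_o (discounted v cc t (X^~ o) (tau o))%:E = (v t q)%:E)%E.
Proof.
have [N [mN N0 H]] := solution_null_set sX; exact: (stopped_expectation_null_set mN N0 H).
Qed.
End StoppedExpectation.

(** * Removal of the stopping *)

Section UniformIntegrability.
Context d (T : measurableType d) (R : realType) (P : probability T R).

(** Truncation to the interval from -k to k, as a combination of absolute values, which makes its
    continuity immediate. *)
Let clip (k x : R) : R := (`|x + k| - `|x - k|) / 2.

Let clip_le k x : 0 <= k -> `|clip k x| <= k.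
Proof. by move=> k0; rewrite /clip ler_norml; case: (ger0P (x + k)); case: (ger0P (x - k)); lra. Qed.

Let clip_id k x : `|x| <= k -> clip k x = x.
Proof. by rewrite ler_norml => /andP[]; rewrite /clip; case: (ger0P (x + k)); case: (ger0P (x - k)); lra. Qed.

Let clip_dist k x : 0 <= k -> `|x - clip k x| <= `|x|.
Proof.
move=> k0; rewrite ler_norml /clip.
by case: (ger0P (x + k)); case: (ger0P (x - k)); case: (ger0P x); lra.
Qed.

Let clip_ge0 k x : 0 <= k -> 0 <= x -> 0 <= clip k x.
Proof. by move=> k0 x0; rewrite /clip; case: (ger0P (x + k)); case: (ger0P (x - k)); lra. Qed.

Let clip_mono k k' x : k <= k' -> 0 <= k -> 0 <= x -> clip k x <= clip k' x.
Proof.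
move=> kk k0 x0; rewrite /clip; case: (ger0P (x + k)); case: (ger0P (x - k));
case: (ger0P (x + k')); case: (ger0P (x - k')); lra.
Qed.

Let continuous_clip k : continuous (clip k).
Proof.
move=> x; apply: cvgMl; apply: cvgB; apply: cvg_norm.
  by apply: cvgD; [exact: cvg_id|exact: cvg_cst].
by apply: cvgB; [exact: cvg_id|exact: cvg_cst].
Qed.

Let measurable_clip k (f : T -> R) : measurable_fun setT f -> measurable_fun setT (fun o => clip k (f o)).
Proof.
move=> mf; apply: (measurableT_comp (f := clip k)) => //.
exact: continuous_measurable_fun.
Qed.

Variables (f : (T -> R)^nat) (g : T -> R) (v : R).
Hypothesis intf : forall N, P.-integrable setT (EFin \o f N).
Hypothesis Ef : forall N, (\int[P]_o (f N o)%:E = v%:E)%E.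
Hypothesis fg : forall o, f N o @[N --> \oo] --> g o.
Hypothesis g0 : forall o, 0 <= g o.
Hypothesis ui : forall e : R, 0 < e -> exists K : R, forall N,
  (\int[P]_(o in [set o | (K < `|f N o|)%R]) `|f N o|%:E <= e%:E)%E.

Let mf N : measurable_fun setT (f N).
Proof. by apply/measurable_EFinP; exact: measurable_int (intf N). Qed.

Let mg : measurable_fun setT g.
Proof. by apply: (@measurable_fun_cvg _ _ _ setT f) => // o _; exact: fg. Qed.

(** Truncating at a level above K costs at most [e] in mean, uniformly in N, so the bounded limit
    can be taken with the level fixed. *)
Let truncated e K k : 0 <= k -> K <= k -> (forall N,
    (\int[P]_(o in [set o | (K < `|f N o|)%R]) `|f N o|%:E <= e%:E)%E) ->
  ((v - e)%:E <= \int[P]_o (clip k (g o))%:E <= (v + e)%:E)%E.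
Proof.
move=> k0 Kk HK.
have ic N : P.-integrable setT (EFin \o (fun o => clip k (f N o))).
  by apply: (@bounded_integrable _ _ _ _ _ k) => [|o]; [exact: measurable_clip|exact: clip_le].
have fic N : (\int[P]_o (clip k (f N o))%:E = (fine (\int[P]_o (clip k (f N o))%:E))%:E)%E.
  by rewrite fineK//; exact: (integrable_fin_num measurableT (ic N)).
have bk N : (`|v - fine (\int[P]_o (clip k (f N o))%:E)|%:E <= e%:E)%E.
  have <- : `|\int[P]_o (f N o - clip k (f N o))%:E|%E = `|v - fine (\int[P]_o (clip k (f N o))%:E)|%:E.
    have := integralB_EFin measurableT (intf N) (ic N).
    rewrite [X in (X - _)%E]Ef [X in (_ - X)%E]fic -EFinB => E.
    by rewrite -abse_EFin -E; congr (`|_|)%E; apply: eq_integral => o _.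
  have id : P.-integrable setT (fun o => (f N o - clip k (f N o))%:E).
    by have := integrableB measurableT (intf N) (ic N); apply: eq_integrable => // o _.
  apply: le_trans (le_abse_integral _ measurableT (measurable_int _ id)) _.
  apply: le_trans (HK N); rewrite [leRHS]integral_mkcond.
  have mS : measurable [set o | K < `|f N o|].
    rewrite -[X in measurable X]setTI; apply: (measurable_fun_ltr (f := fun=> K) (g := fun o => `|f N o|)) => //.
    exact: measurableT_comp.
  apply: ge0_le_integral => //.
  - by apply: measurableT_comp => //; exact: measurable_int id.
  - apply/(measurable_restrictT _ mS); apply: measurable_funTS; apply/measurable_EFinP.
    exact: measurableT_comp.
  move=> o _; rewrite patchE; case: ifPn => [_|]; first by rewrite lee_fin clip_dist.
  rewrite notin_setE/= => /negP; rewrite -leNgt => h.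
  by rewrite clip_id ?subrr ?normr0// (le_trans h).
have cN : (\int[P]_o (clip k (f N o))%:E @[N --> \oo] --> \int[P]_o (clip k (g o))%:E)%E.
  apply: (@bounded_cvg_integral _ _ _ _ (fun N o => clip k (f N o)) _ k) => [N|N o|o].
  - exact: measurable_clip.
  - exact: clip_le.
  - apply: (cvg_comp (f^~ o) (clip k)); [exact: fg|exact: continuous_clip].
have bN N : ((v - e)%:E <= \int[P]_o (clip k (f N o))%:E <= (v + e)%:E)%E.
  by have := bk N; rewrite fic !lee_fin ler_norml => /andP[? ?]; lra.
have cvN : cvgn (fun N => \int[P]_o (clip k (f N o))%:E)%E by apply/cvg_ex; eexists; exact: cN.
rewrite -(cvg_lim _ cN)//; apply/andP; split.
  by apply: lime_ge => //; apply: nearW => N; case/andP: (bN N).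
by apply: lime_le => //; apply: nearW => N; case/andP: (bN N).
Qed.

(** First N tends to infinity at a fixed level, then the level. As g is non-negative the second
    limit is monotone, so the integrability of g is a result and not a premise. *)
Lemma uniformly_integrable_limit : (\int[P]_o (g o)%:E = v%:E)%E.
Proof.
have mc m : measurable_fun setT (fun o => (clip m%:R (g o))%:E).
  by apply/measurable_EFinP; exact: measurable_clip.
have cm : (\int[P]_o (clip m%:R (g o))%:E @[m --> \oo] --> \int[P]_o (g o)%:E)%E.
  rewrite [X in _ --> X](_ : _ = \int[P]_o limn (fun m => (clip m%:R (g o))%:E))%E.
    apply: cvg_monotone_convergence => //.
    - by move=> m o _; rewrite lee_fin clip_ge0.
    - by move=> o _ m m' mm; rewrite lee_fin clip_mono// ler_nat.
  apply: eq_integral => o _; apply/esym/cvg_lim => //; apply: cvg_near_cst.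
  near=> m; rewrite clip_id// ger0_norm//; near: m.
  exact: nbhs_infty_ger.
have cv : cvgn (fun m => \int[P]_o (clip m%:R (g o))%:E)%E by apply/cvg_ex; eexists; exact: cm.
have bd e : 0 < e -> \forall m \near \oo, ((v - e)%:E <= \int[P]_o (clip m%:R (g o))%:E <= (v + e)%:E)%E.
  move=> e0; have [K HK] := ui e0; near=> m; apply: (truncated _ _ HK) => //.
  near: m; exact: nbhs_infty_ger.
apply/eqP; rewrite eq_le; apply/andP; split; apply/lee_addgt0Pr => e e0.
  rewrite -(cvg_lim _ cm)//; apply: lime_le => //.
  by apply: filterS (bd e e0) => m /andP[_]; rewrite EFinD.
rewrite -leeBlDr// -(cvg_lim _ cm)//; apply: lime_ge => //.
by apply: filterS (bd e e0) => m /andP[+ _]; rewrite EFinB.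
Unshelve. all: by end_near. Qed.
End UniformIntegrability.

Section InitialExpectation.
Context {R : realType} {d : nat} {dO : measure_display}
        {Omega : measurableType dO} (P : probability Omega R).
Variables (a t sigma : R) (v vt cc : R -> 'rV[R]_d -> R) (v1 : 'I_d -> R -> 'rV[R]_d -> R)
  (b : R -> 'rV[R]_d -> 'rV[R]_d) (v2 : 'I_d -> 'I_d -> R -> 'rV[R]_d -> R).
Hypothesis sigma0 : 0 < sigma.
Local Notation T := (`]a, +oo[%classic : set R).
Local Notation Ta := (`[a, +oo[%classic : set R).
Hypothesis cv : continuous_on Ta v.
Hypothesis cvt : continuous_on T vt.
Hypothesis ccc : continuous_on Ta cc.
Hypothesis cv1 : forall i, continuous_on T (v1 i).
Hypothesis cb : forall i, continuous_on T (fun r x => b r x 0 i).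
Hypothesis cv2 : forall i j, continuous_on T (v2 i j).
Hypothesis dvt : forall s x, a < s -> is_derive s 1 (v^~ x) (vt s x).
Hypothesis dv1 : forall i s x, a < s -> is_derive x (delta_mx 0 i) (v s) (v1 i s x).
Hypothesis dv2 : forall i j s x, a < s -> is_derive x (delta_mx 0 j) (v1 i s) (v2 i j s x).
Hypothesis pde : forall s x, a < s ->
  - vt s x - \sum_i b s x 0 i * v1 i s x + cc s x * v s x + sigma ^+ 2 / 2 * \sum_i v2 i i s x = 0.
Hypothesis va0 : forall x, 0 <= v a x.

Variables (w : R -> Omega -> 'rV[R]_d) (q : 'rV[R]_d) (X : R -> Omega -> 'rV[R]_d).
Hypothesis wW : wiener P a w.
Hypothesis sX : backward_solution P b sigma w a t q X.
Hypothesis DM : class_D P w a t (fun s o => discounted v cc t (X^~ o) s).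

Let TTa : T `<=` Ta.
Proof. by move=> r /=; rewrite !in_itv/= !andbT; exact: ltW. Qed.

Let initial_expectation_lt : a < t ->
  (\int[P]_o (discounted v cc t (X^~ o) a)%:E = (v t q)%:E)%E.
Proof.
move=> at_; have aat : a <= a <= t by rewrite lexx ltW.
have sub : `[a, t] `<=` Ta by move=> r /=; rewrite !in_itv/= => /andP[->].
(* The shift by 2 makes c N strictly smaller than t already for N = 0. *)
pose c N : R := a + (t - a) / N.+2%:R.
have ac N : a < c N by rewrite /c ltrDl divr_gt0// subr_gt0.
have ct N : c N < t.
  by rewrite /c -ltrBrDl gtr_pMr ?subr_gt0// invf_lt1// ltr1n.
have cN : c N @[N --> \oo] --> a.
  rewrite -[X in _ --> X]addr0; apply: cvgD; first exact: cvg_cst.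
  by have := @grid_mesh_cvg R a t; rewrite -cvg_shiftS.
have /choice[tau xtau] : forall N : nat, exists tau, exit_time t X (c N) (`|q| + N.+1%:R) tau.
  by move=> N; apply: (exit_time_exists sX); rewrite (ltW (ac N)) (ltW (ct N)).
have qn N : `|q| < `|q| + N.+1%:R by rewrite ltrDl.
have SE N := stopped_expectation sigma0 (continuous_on_subset TTa cv) cvt
  (continuous_on_subset TTa ccc) cv1 cb cv2 dvt dv1 dv2 pde wW sX (ac N) (ct N) (qn N) (xtau N).
apply: (@uniformly_integrable_limit _ _ _ P (fun N o => discounted v cc t (X^~ o) (tau N o))).
- by move=> N; case: (SE N).
- by move=> N; case: (SE N).
- move=> o; have [_ cX _] := sX.
  have [B [_ HB]] := compact_bounded (continuous_compact (@cX o) (@segment_compact _ a t)).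
  have XB s : a <= s <= t -> `|X s o| <= B + 1.
    by move=> st; apply: (HB (B + 1)); rewrite ?ltrDl//; exists s => //=; rewrite in_itv.
  have cM := continuous_discounted (o := o) sX cv ccc aat sub.
  apply/cvgrPdist_lt => e e0.
  have [r r0 Hr] := uniform_continuity_on_compact (@segment_compact _ a t) cM e0.
  near=> N.
  (* A given path is bounded, so for large N it does not leave the growing ball, and the exit time
     takes its default value. *)
  have tN : tau N o = c N.
    have [/andP[cN1 cN2] _ [//|]] := xtau N o; rewrite leNgt => /negP[].
    apply: le_lt_trans (XB _ _) _; first by rewrite cN2 (le_trans (ltW (ac N)) cN1).
    have : `|B| + 1 <= N%:R by near: N; exact: nbhs_infty_ger.
    move=> BN; apply: (@le_lt_trans _ _ N%:R); last by rewrite ltr_wpDl// ltr_nat.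
    by apply: le_trans BN; rewrite lerD2r ler_norm.
  rewrite tN; apply: Hr; rewrite /= ?in_itv/= ?lexx ?ltW//.
  by near: N; move/cvgrPdist_lt : cN => /(_ r r0).
- by move=> o; rewrite mulr_ge0// expR_ge0.
- move=> e e0; have [K HK] := DM e0; exists K => N; apply: HK.
  exact: (exit_time_stopping wW sX (ltW (ac N)) (xtau N)).
Unshelve. all: by end_near. Qed.

Theorem initial_expectation : a <= t ->
  (\int[P]_o (discounted v cc t (X^~ o) a)%:E = (v t q)%:E)%E.
Proof.
rewrite le_eqVlt => /predU1P[at_|]; last exact: initial_expectation_lt.
have [N [mN N0 sde]] := solution_null_set sX.
transitivity (\int[P]_o (v t q)%:E)%E; last by rewrite integral_cst// [X in (_ * X)%E]probability_setT mule1.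
apply: ae_eq_integral => //.
- apply/measurable_EFinP; apply: (measurable_discounted wW sX cv ccc); first by rewrite at_ lexx.
  by move=> r /=; rewrite !in_itv/= andbT => /andP[].
- exists N; split => // o /= Ho; apply: contrapT => No; apply: Ho => _.
  rewrite /discounted /discount -at_ set_itv1 Rintegral_set1 expR0 mul1r; congr (v _ _)%:E.
  rewrite (sde o No) ?at_ ?lexx// subrr scaler0 subr0 set_itv1.
  rewrite (_ : \row__ _ = 0) ?subr0//.
  by apply/rowP => i; rewrite !mxE Rintegral_set1.
Qed.
End InitialExpectation.

(** * The Feynman-Kac data of the Fokker-Planck equation *)

Section DirectionalRules.
Context {R : realType} {V : normedModType R}.

Lemma is_derive_from_line (f : V -> R) (x v : V) (D : R) :
  is_derive (0 : R) 1 (fun s : R => f (s *: v + x)) D -> is_derive x v f D.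
Proof.
have E : (fun h : R => h^-1 *: (((fun s : R => f (s *: v + x)) \o shift 0) (h *: 1) - f (0 *: v + x)))
   = (fun h : R => h^-1 *: ((f \o shift x) (h *: v) - f x)).
  apply/funext => h /=; rewrite scale0r add0r; congr (_ *: (f (_ *: _ + _) - _)).
  by rewrite addr0 /GRing.scale /= mulr1.
by move=> [df Df]; split; [rewrite /derivable -E|rewrite /derive -E].
Qed.

Lemma is_derive_expR_direction (f : V -> R) (x v : V) (k D : R) : is_derive x v f D ->
  is_derive x v (fun y => expR (k * f y)) (expR (k * f x) * (k * D)).
Proof.
move=> df; apply: is_derive_from_line.
have dl : is_derive (0 : R) 1 (fun s : R => f (s *: v + x)) D.
  by apply: is_derive_line; rewrite scale0r add0r.
have dk : is_derive (0 : R) 1 (fun s : R => k * f (s *: v + x)) (k * D).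
  rewrite -[fun s => _]/(k *: (fun s : R => f (s *: v + x))).
  exact: is_derive_eq.
have := @is_derive1_comp R expR (fun s : R => k * f (s *: v + x)) 0 _ _ (is_derive_expR _) dk.
by rewrite scale0r add0r.
Qed.

Lemma is_derive_mul (f g : V -> R) (x v : V) (Df Dg : R) : is_derive x v f Df -> is_derive x v g Dg ->
  is_derive x v (fun y => f y * g y) (f x * Dg + Df * g x).
Proof. by move=> df dg; have := is_deriveM df dg; rewrite /GRing.scale/= (mulrC (g x)). Qed.
End DirectionalRules.

Section FeynmanKacData.
Context {R : realType} {d : nat}.
Variables (mu beta a : R) (U p g : R -> 'rV[R]_d -> R).
Hypothesis mu_gt0 : 0 < mu.
Hypothesis beta_gt0 : 0 < beta.
Hypothesis rU : regular_potential a U.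
Hypothesis fp : fokker_planck_solution mu beta a U p.
Hypothesis cg : continuous_on `[a, +oo[ g.
Hypothesis dg : forall s x, a < s -> is_derive s 1 (U^~ x) (g s x).
Local Notation T := (`]a, +oo[%classic : set R).
Local Notation Ta := (`[a, +oo[%classic : set R).

Let TTa : T `<=` Ta.
Proof. by move=> r /=; rewrite !in_itv/= !andbT; exact: ltW. Qed.

Let U1 i s := partial i (U s).
Let U2 i j s := partial j (U1 i s).
Let p1 i s := partial i (p s).
Let p2 i j s := partial j (p1 i s).
Let pt s x := derive1 (p^~ x) s.

Definition fk_value s x := expR (beta * U s x) * p s x.
Let e s x := expR (beta * U s x).
(** A component of the gradient of p plus beta p times the gradient of U, which is the probability
    current up to the factor -mu / beta; it is also e^(-beta U) times the gradient of [fk_value]. *)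
Definition fk_flux i s x := beta * U1 i s x * p s x + p1 i s x.
Definition fk_gradient i s x := e s x * fk_flux i s x.
Definition fk_hessian i j s x := e s x *
  (beta * U1 j s x * fk_flux i s x
     + (beta * U2 i j s x * p s x + beta * U1 i s x * p1 j s x + p2 i j s x)).
Definition fk_time s x := e s x * (beta * g s x * p s x + pt s x).

Let cU : continuous_on Ta U. Proof. by case: rU => _ []. Qed.
Let cU1 i : continuous_on Ta (U1 i). Proof. by case: rU => _ _ /(_ i) []. Qed.
Let cU2 i j : continuous_on Ta (U2 i j). Proof. by case: rU => _ _ /(_ i) [_ /(_ j) []]. Qed.
Let cp : continuous_on Ta p. Proof. by case: fp => -[]. Qed.
Let cp1 i : continuous_on T (p1 i). Proof. by case: fp => -[_ _ /(_ i) []]. Qed.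
Let cp2 i j : continuous_on T (p2 i j). Proof. by case: fp => -[_ _ _ /(_ i j) []]. Qed.
Let cpt : continuous_on T pt. Proof. by case: fp => -[_ []]. Qed.

Let cb T' (f : R -> 'rV[R]_d -> R) : continuous_on T' f -> continuous_on T' (fun s x => beta * f s x).
Proof. by move=> cf; apply: continuous_onM => //; exact: continuous_on_cst. Qed.

Let ce : continuous_on Ta e.
Proof. by apply: continuous_on_comp; [exact: continuous_expR|exact: cb]. Qed.

Lemma continuous_fk_value : continuous_on Ta fk_value.
Proof. by apply: continuous_onM; [exact: ce|exact: cp]. Qed.

Let down (f : R -> 'rV[R]_d -> R) : continuous_on Ta f -> continuous_on T f.
Proof. exact: continuous_on_subset. Qed.

Let continuous_fk_flux i : continuous_on T (fk_flux i).
Proof.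
apply: continuous_onD => //; apply: continuous_onM; last exact: down.
by apply: cb; exact: down.
Qed.

Lemma continuous_fk_gradient i : continuous_on T (fk_gradient i).
Proof. by apply: continuous_onM; [exact: down|exact: continuous_fk_flux]. Qed.

Lemma continuous_fk_hessian i j : continuous_on T (fk_hessian i j).
Proof.
apply: continuous_onM; first exact: down.
apply: continuous_onD.
  by apply: continuous_onM; [apply: cb; exact: down|exact: continuous_fk_flux].
apply: continuous_onD => //; apply: continuous_onD.
  by apply: continuous_onM; [apply: cb; exact: down|exact: down].
by apply: continuous_onM => //; apply: cb; exact: down.
Qed.

Lemma continuous_fk_time : continuous_on T fk_time.
Proof.
apply: continuous_onM; first exact: down.
apply: continuous_onD => //; apply: continuous_onM; last exact: down.
by apply: cb; exact: down.
Qed.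

Let dU i s x : a < s -> is_derive x (delta_mx 0 i) (U s) (U1 i s x).
Proof. by move=> as_; apply/derivableP; case: rU => _ [_ /(_ i) [+ _] _] _; apply; exact: ltW. Qed.
Let dU1 i j s x : a < s -> is_derive x (delta_mx 0 j) (U1 i s) (U2 i j s x).
Proof. by move=> as_; apply/derivableP; case: rU => _ _ /(_ i) [_ /(_ j) [+ _] _]; apply; exact: ltW. Qed.
Let dp i s x : a < s -> is_derive x (delta_mx 0 i) (p s) (p1 i s x).
Proof. by move=> as_; apply/derivableP; case: fp => -[_ _ /(_ i) [+ _] _] _ _; apply. Qed.
Let dp1 i j s x : a < s -> is_derive x (delta_mx 0 j) (p1 i s) (p2 i j s x).
Proof. by move=> as_; apply/derivableP; case: fp => -[_ _ _ /(_ i j) [+ _]] _ _; apply. Qed.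
Let dpt s x : a < s -> is_derive s 1 (p^~ x) (pt s x).
Proof. by move=> as_; rewrite /pt derive1E; apply/derivableP; case: fp => -[_ [+ _] _ _] _ _; apply. Qed.

Lemma is_derive_fk_time s x : a < s -> is_derive s 1 (fk_value^~ x) (fk_time s x).
Proof.
move=> as_; have h := is_derive_mul (is_derive_expR_direction beta (dg x as_)) (dpt x as_).
by apply: (is_derive_eq h); rewrite /fk_time /e; ring.
Qed.

Lemma is_derive_fk_value i s x : a < s -> is_derive x (delta_mx 0 i) (fk_value s) (fk_gradient i s x).
Proof.
move=> as_; have h := is_derive_mul (is_derive_expR_direction beta (@dU i s x as_)) (@dp i s x as_).
by apply: (is_derive_eq h); rewrite /fk_gradient /fk_flux /e; ring.
Qed.

Lemma is_derive_fk_gradient i j s x : a < s ->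
  is_derive x (delta_mx 0 j) (fk_gradient i s) (fk_hessian i j s x).
Proof.
move=> as_; have dflux : is_derive x (delta_mx 0 j) (fk_flux i s)
    (beta * U2 i j s x * p s x + beta * U1 i s x * p1 j s x + p2 i j s x).
  have h1 := is_derive_mul (is_derive_cst beta x (delta_mx 0 j)) (@dU1 i j s x as_).
  have h2 := is_deriveD (is_derive_mul h1 (@dp j s x as_)) (@dp1 i j s x as_).
  by apply: (is_derive_eq h2); rewrite /cst /=; ring.
have h := is_derive_mul (is_derive_expR_direction beta (@dU j s x as_)) dflux.
by apply: (is_derive_eq h); rewrite /fk_hessian /e; ring.
Qed.

(** With F the flux, the Fokker-Planck equation reads p_t = (mu / beta) div F. The gradient of the
    value is e^(beta U) F and its Laplacian e^(beta U) (beta <grad U, F> + div F), so the drift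
    cancels the term with <grad U, F> and what remains is e^(beta U) p_t. *)
Lemma fk_equation s x : a < s ->
  - fk_time s x - \sum_i (mu *: grad (U s) x) 0 i * fk_gradient i s x + beta * g s x * fk_value s x
   + Num.sqrt (2 * mu / beta) ^+ 2 / 2 * \sum_i fk_hessian i i s x = 0.
Proof.
move=> as_; have [_ _ /(_ s x as_)] := fp.
have -> : divergence (fun y => p s y *: grad (U s) y) x =
    \sum_i (p1 i s x * U1 i s x + p s x * U2 i i s x).
  apply: eq_bigr => i _; rewrite /partial.
  have -> : (fun y => (p s y *: grad (U s) y) 0 i) = (fun y => p s y * U1 i s y).
    by apply/funext => y; rewrite !mxE.
  have [_ ->] := is_derive_mul (@dp i s x as_) (@dU1 i i s x as_).
  by rewrite addrC.
have -> : laplacian (p s) x = \sum_i p2 i i s x by [].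
rewrite -/(pt s x) sqr_sqrtr; last by rewrite divr_ge0 ?mulr_ge0 ?ltW.
have b0 : beta != 0 by rewrite gt_eqF.
move=> E; rewrite /fk_time.
have -> : pt s x = mu * \sum_i (p1 i s x * U1 i s x + p s x * U2 i i s x) + mu / beta * \sum_i p2 i i s x.
  by move: E; lra.
pose S (f : 'I_d -> R) := \sum_i f i.
have -> : \sum_i (mu *: grad (U s) x) 0 i * fk_gradient i s x =
    mu * e s x * \sum_i U1 i s x * fk_flux i s x.
  by rewrite mulr_sumr; apply: eq_bigr => i _; rewrite !mxE /fk_gradient -/(U1 i s x); ring.
have -> : \sum_i fk_hessian i i s x = e s x * (beta * (\sum_i U1 i s x * fk_flux i s x)
     + beta * (\sum_i (p1 i s x * U1 i s x + p s x * U2 i i s x)) + \sum_i p2 i i s x).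
  rewrite !mulr_sumr -!big_split mulr_sumr; apply: eq_bigr => i _; rewrite /fk_hessian /=; ring.
rewrite /fk_value -/(e s x).
move: (\sum_i U1 i s x * _) (\sum_i (p1 i s x * _ + _)) (\sum_i p2 i i s x) => A B C.
by field.
Qed.
(** At the initial time the time derivative of U need not exist; [g] is its continuous extension,
    and the two integrands differ at most at that single point. *)
Lemma work_integral t (x : R -> 'rV[R]_d) s : {within `[a, t], continuous x} -> a <= s ->
  (\int[lebesgue_measure]_(r in `[s, t]) derive1 (U^~ (x r)) r =
   \int[lebesgue_measure]_(r in `[s, t]) g r (x r))%R.
Proof.
move=> cx as_.
have sub : `[s, t] `<=` Ta by move=> r /=; rewrite !in_itv/= => /andP[sr _]; rewrite (le_trans as_).
have cxs : {within `[s, t], continuous x}.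
  by apply: continuous_subspaceW cx => r /=; rewrite !in_itv/= => /andP[sr ->]; rewrite (le_trans as_).
have ig := continuous_itv_integrable (continuous_on_path sub cg cxs).
have E r : `]s, t]%classic r -> derive1 (U^~ (x r)) r = g r (x r).
  rewrite /= in_itv/= => /andP[sr _]; rewrite derive1E.
  by have [_ ->] := dg (x r) (le_lt_trans as_ sr).
have igo : lebesgue_measure.-integrable `]s, t] (EFin \o (fun r => g r (x r))).
  by apply: integrableS ig => // r /=; rewrite !in_itv/= => /andP[/ltW-> ->].
rewrite -(Rintegral_itv_obnd_cbnd igo) -Rintegral_itv_obnd_cbnd.
  by apply: eq_Rintegral => r; rewrite inE; exact: E.
apply: eq_integrable igo => // r; rewrite inE => /E H; by rewrite /= H.
Qed.

Lemma continuous_discount_rate : continuous_on Ta (fun s x => beta * g s x).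
Proof. exact: cb. Qed.

Section WorkProcess.
Context {dO : measure_display} {Omega : measurableType dO} (P : probability Omega R).
Variables (t : R) (w : R -> Omega -> 'rV[R]_d) (q : 'rV[R]_d) (X : R -> Omega -> 'rV[R]_d).
Hypothesis wW : wiener P a w.
Local Notation drift := (fun s x => mu *: grad (U s) x).
Hypothesis sX : backward_solution P drift (Num.sqrt (2 * mu / beta)) w a t q X.

Lemma work_processE s o : a <= s -> s <= t ->
  work_process beta t U p X s o = discounted fk_value (fun s x => beta * g s x) t (X^~ o) s.
Proof.
move=> as_ st; have [_ /(_ o) cX _] := sX.
rewrite /work_process work_integral// /discounted /discount /fk_value -mulrA.
congr (expR _ * _); rewrite RintegralZl//.
apply: continuous_itv_integrable; apply: (@continuous_on_path _ _ Ta) cg _.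
  by move=> r /=; rewrite !in_itv/= => /andP[sr _]; rewrite (le_trans as_).
by apply: continuous_subspaceW cX => r /=; rewrite !in_itv/= => /andP[sr ->]; rewrite (le_trans as_).
Qed.

Theorem work_process_expectation : (forall x, 0 <= p a x) -> a <= t ->
  class_D P w a t (work_process beta t U p X) ->
  (\int[P]_o (discounted fk_value (fun s x => beta * g s x) t (X^~ o) a)%:E = (fk_value t q)%:E)%E.
Proof.
move=> pa0 at_ DX; apply: (initial_expectation _ continuous_fk_value continuous_fk_time
  continuous_discount_rate continuous_fk_gradient _ continuous_fk_hessian is_derive_fk_time
  is_derive_fk_value is_derive_fk_gradient fk_equation _ wW sX) => //.
- by rewrite sqrtr_gt0 divr_gt0 ?mulr_gt0.
- move=> i; rewrite (_ : (fun r x => _) = (fun r x => mu * U1 i r x)).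
    by apply: continuous_onM; [exact: continuous_on_cst|exact: down].
  by apply/funext => r; apply/funext => x; rewrite !mxE.
- by move=> x; rewrite mulr_ge0// expR_ge0.
move=> eps e0; have [K HK] := DX eps e0; exists K => tau st.
have E o : work_process beta t U p X (tau o) o = discounted fk_value (fun s x => beta * g s x) t (X^~ o) (tau o).
  by have /andP[? ?] := st.1 o; exact: work_processE.
have := HK tau st; under eq_fun do rewrite E.
by under eq_integral do rewrite E.
Qed.
End WorkProcess.
End FeynmanKacData.

(** * Functionals on path space *)

Section PathSpace.
Context {R : realType} {d : nat} {dO : measure_display}
        {Omega : measurableType dO} (P : probability Omega R).
Variables (a t : R).

Definition path_cylinders : set (set (R -> 'rV[R]_d)) :=
  [set A | exists s i B, [/\ a <= s <= t, measurable B &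
     A = [set x : R -> 'rV[R]_d | B (x s 0 i)]]].

Local Notation paths := (g_sigma_algebraType path_cylinders).

Lemma measurable_path (Z : R -> Omega -> 'rV[R]_d) :
  (forall s i, a <= s <= t -> measurable_fun setT (fun o => Z s o 0 i)) ->
  measurable_fun setT ((fun o => Z^~ o) : Omega -> paths).
Proof.
move=> mZ; apply: (@measurability _ _ _ paths setT _ path_cylinders) => //.
move=> _ [_ [s [i [B [st mB ->]]]] <-].
by have := mZ s i st measurableT B mB.
Qed.

Lemma measurable_evaluation s i : a <= s <= t ->
  measurable_fun setT ((fun x => x s 0 i) : paths -> R).
Proof.
move=> st _ B mB; rewrite setTI; apply: sub_sigma_algebra.
by exists s, i, B.
Qed.

Variables (X Y : R -> Omega -> 'rV[R]_d) (D : Omega -> R).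
Hypothesis mX : forall s i, a <= s <= t -> measurable_fun setT (fun o => X s o 0 i).
Hypothesis mY : forall s i, a <= s <= t -> measurable_fun setT (fun o => Y s o 0 i).
Hypothesis mD : measurable_fun setT D.
Hypothesis D0 : forall o, 0 <= D o.
Hypothesis XYD : forall A, path_sigma a t A ->
  P (path_event X A) = (\int[P]_(o in path_event Y A) (D o)%:E)%E.

Lemma path_density (F : paths -> \bar R) : measurable_fun setT F -> (forall x, (0 <= F x)%E) ->
  (\int[P]_o F (X^~ o) = \int[P]_o (F (Y^~ o) * (D o)%:E))%E.
Proof.
move=> mF F0; have mXp := measurable_path mX; have mYp := measurable_path mY.
have := ge0_integral_pushforward mXp P measurableT mF (fun y _ => F0 y).
rewrite preimage_setT => <-.
by apply: (integral_density (Y := (fun o => Y^~ o) : Omega -> paths)).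
Qed.

Hypothesis cX : forall o, {within `[a, t], continuous (X^~ o)}.
Hypothesis cY : forall o, {within `[a, t], continuous (Y^~ o)}.
Hypothesis at_ : a <= t.
Variables (T : set R) (v cc : R -> 'rV[R]_d -> R).
Hypothesis aT : `[a, t] `<=` T.
Hypothesis cv : continuous_on T v.
Hypothesis ccc : continuous_on T cc.
Hypothesis v0 : forall x, 0 <= v a x.

Let riemann m (x : paths) : R :=
  \sum_(i < m.+1) (t - a) / m.+1%:R * cc (grid a t m i.+1) (x (grid a t m i.+1)).

(* The limsup makes this measurable on all paths; the Riemann sums converge along continuous ones only. *)
Let F (x : paths) : \bar R :=
  maxe 0%E (limn_esup (fun m => (expR (riemann m x) * v a (x a))%:E)).

Let F_continuous (x : R -> 'rV[R]_d) : {within `[a, t], continuous x} ->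
  F x = (discounted v cc t x a)%:E.
Proof.
move=> cx; have cvR := Riemann_sum_cvg at_ (continuous_on_path aT ccc cx).
have cF : (fun m => (expR (riemann m x) * v a (x a))%:E) @ \oo --> (discounted v cc t x a)%:E.
  apply: cvg_EFin; first exact: nearW.
  apply: cvgMl; apply: (cvg_comp _ expR cvR); exact: continuous_expR.
by rewrite /F (cvg_limn_einf_sup cF).2 max_r// lee_fin mulr_ge0// expR_ge0.
Qed.

Let mF : measurable_fun setT F.
Proof.
apply: measurable_maxe => //; apply: measurable_fun_limn_esup => m.
have aat : a <= a <= t by rewrite lexx.
apply/measurable_EFinP; apply: measurable_funM.
  apply: (measurableT_comp (f := expR)); first exact: measurable_expR.
  apply: measurable_sum => i; apply: measurable_funM => //.
  have gi : a <= grid a t m i.+1 <= t by apply: grid_itv.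
  apply: (@measurable_continuous_coord _ _ paths) => [|k]; last exact: measurable_evaluation.
  by apply: continuous_on_space ccc; apply: aT; rewrite /= in_itv.
apply: (@measurable_continuous_coord _ _ paths) => [|k]; last exact: measurable_evaluation.
by apply: continuous_on_space cv; apply: aT; rewrite /= in_itv.
Qed.

Theorem discounted_density : (\int[P]_o (discounted v cc t (X^~ o) a)%:E =
  \int[P]_o (discounted v cc t (Y^~ o) a * D o)%:E)%E.
Proof.
have F0 x : (0 <= F x)%E by rewrite /F le_max lexx.
have := path_density mF F0; under eq_integral do rewrite F_continuous//.
by move=> ->; apply: eq_integral => o _; rewrite F_continuous.
Qed.
End PathSpace.

(** * The trapezoid rule and the pre-point integral *)

Section TrapezoidRule.
Context {R : realType} {d : nat}.
Variables (a t : R) (U g : R -> 'rV[R]_d -> R) (U1 g1 : 'I_d -> R -> 'rV[R]_d -> R)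
  (U2 : 'I_d -> 'I_d -> R -> 'rV[R]_d -> R).
Local Notation Ta := (`[a, +oo[%classic : set R).
Hypothesis cU : continuous_on Ta U.
Hypothesis cg : continuous_on Ta g.
Hypothesis cU1 : forall i, continuous_on Ta (U1 i).
Hypothesis cg1 : forall i, continuous_on Ta (g1 i).
Hypothesis cU2 : forall i j, continuous_on Ta (U2 i j).
Hypothesis dg : forall s x, a < s -> is_derive s 1 (U^~ x) (g s x).
Hypothesis dg1 : forall i s x, a < s -> is_derive s 1 ((U1 i)^~ x) (g1 i s x).
Hypothesis dU : forall i s x, Ta s -> is_derive x (delta_mx 0 i) (U s) (U1 i s x).
Hypothesis dU1 : forall i j s x, Ta s -> is_derive x (delta_mx 0 j) (U1 i s) (U2 i j s x).

(** The defect, over one cell, of the chain rule with the gradient averaged over both ends. *)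
Definition trapezoid_error (y : R -> 'rV[R]_d) (s s' : R) : R :=
  U s' (y s') - U s (y s) - (\int[lebesgue_measure]_(r in `[s, s']) g r (y r))%R
  - (\sum_i (y s' - y s) 0 i * (U1 i s (y s) + U1 i s' (y s'))) / 2.

(** The error splits into a time step at the later position, a space step at the earlier time, and
    the replacement of the gradient at the earlier time by that at the later one; [K] adds up the
    three constants. *)
Lemma trapezoid_path (y : R -> 'rV[R]_d) : {within `[a, t], continuous y} ->
  forall e : R, 0 < e -> exists2 r : R, 0 < r &
    forall s s', a <= s -> s <= s' -> s' <= t -> s' - s < r ->
    `|trapezoid_error y s s'| <= e * ((s' - s) + `|y s' - y s| ^+ 2).
Proof.
move=> cy e e0.
have aT : `[a, t] `<=` Ta by move=> r /=; rewrite !in_itv/= => /andP[->].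
have [M [_ HM]] := compact_bounded (continuous_compact cy (@segment_compact _ a t)).
have yM s : a <= s <= t -> `|y s| <= M + 1.
  by move=> st; apply: (HM (M + 1)); rewrite ?ltrDl//; exists s => //=; rewrite in_itv.
have [C C1 HC] := family_bounded cg1 (M + 1) aT.
have C0 : 0 <= C := le_trans ler01 C1.
pose K := 1 + d%:R ^+ 2 + d%:R * C.
have dC : 0 <= d%:R * C by rewrite mulr_ge0.
have d2 : 0 <= (d%:R : R) ^+ 2 by rewrite sqr_ge0.
have K0 : 0 < K by rewrite ltr_pwDl// ltr_pwDl.
pose e1 := e / K; have e10 : 0 < e1 by rewrite divr_gt0.
have [r1 r10 H1] := continuous_on_uniform (M + 1) aT cg e10.
have [r2 r20 H2] := family_uniform (I := ('I_d * 'I_d)%type) (F := fun ij => U2 ij.1 ij.2)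
  (fun ij => @cU2 ij.1 ij.2) (M + 1) aT e10.
pose rho := Num.min e1 (Num.min r1 r2).
have rho0 : 0 < rho by rewrite !lt_min e10 r10.
have [r3 r30 H3] := uniform_continuity_on_compact (@segment_compact _ a t) cy rho0.
exists (Num.min r1 r3); first by rewrite lt_min r10.
move=> s s' as_ ss s't; rewrite lt_min => /andP[hr1 hr3].
have h0 : 0 <= s' - s by rewrite subr_ge0.
have as' : a <= s' := le_trans as_ ss; have st := le_trans ss s't.
have osc r r' : s <= r <= s' -> s <= r' <= s' -> `|y r - y r'| < rho.
  move=> /andP[sr rs] /andP[sr' rs']; apply: H3; rewrite /= ?in_itv/=.
  - by rewrite (le_trans as_ sr) (le_trans rs).
  - by rewrite (le_trans as_ sr') (le_trans rs').
  - by rewrite ltr_norml; apply/andP; split; lra.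
set u := y s' - y s.
have uy : y s' = u + y s by rewrite /u subrK.
have urho : `|u| < rho by apply: osc; rewrite ?lexx ?ss.
have [ue1 ur1 ur2] : [/\ `|u| < e1, `|u| < r1 & `|u| < r2].
  by move: urho; rewrite !lt_min => /and3P[].
have ys := yM s; have ys' := yM s'.
have /ys ysM : a <= s <= t by rewrite as_.
have /ys' ysM' : a <= s' <= t by rewrite as'.
have sT : `[s, s'] `<=` Ta.
  by move=> r /=; rewrite !in_itv/= => /andP[sr _]; rewrite andbT (le_trans as_).
have Ts : Ta s by rewrite /= in_itv/= as_.
have [r4 r4s E4] := time_increment (x := y s') cU ss sT
  (fun r (h : s < r < s') => @dg r (y s') (le_lt_trans as_ (proj1 (andP h)))).
have B1 : `|U s' (y s') - U s (y s') - (\int[lebesgue_measure]_(r in `[s, s']) g r (y r))%R|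
    <= (s' - s) * e1.
  rewrite E4 distrC [leRHS]mulrC; apply: Rintegral_close => //.
    apply: (continuous_on_path sT cg); apply: continuous_subspaceW cy => r /=.
    by rewrite !in_itv/= => /andP[sr rs]; rewrite (le_trans as_ sr) (le_trans rs).
  move=> r rs; have /andP[sr4 r4s'] := r4s; have /andP[sr rs'] := rs; apply/ltW/H1.
  - by rewrite (le_trans as_ sr) (le_trans rs').
  - by rewrite (le_trans as_ sr4) (le_trans r4s').
  - by apply: yM; rewrite (le_trans as_ sr) (le_trans rs').
  - exact: ysM'.
  - by apply: le_lt_trans hr1; rewrite ler_norml; apply/andP; split; lra.
  - apply: lt_le_trans (osc r s' rs _) _; first by rewrite ss lexx.
    by rewrite /rho !ge_min lexx orbT.
have B2 := @trapezoid _ _ Ta U U1 U2 cU1 cU2 dU dU1 s (y s) u e1 Ts.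
have {}B2 : `|U s (y s') - U s (y s) - (\sum_i u 0 i * (U1 i s (y s) + U1 i s (y s'))) / 2|
    <= d%:R ^+ 2 * (e1 * `|u| ^+ 2).
  rewrite uy; apply: B2 => c /andP[c0 c1] i j; apply/ltW/(H2 (i, j)).
  - by rewrite as_.
  - by rewrite as_.
  - have -> : c *: u + y s = c *: y s' + (1 - c) *: y s.
      by rewrite /u scalerBr scalerBl scale1r -addrA; congr (_ + _); exact: addrC.
    apply: le_trans (ler_normD _ _) _; rewrite !normrZ (ger0_norm c0) ger0_norm ?subr_ge0//.
    have := ler_wpM2l c0 ysM'; have : (1 - c) * `|y s| <= (1 - c) * (M + 1) by rewrite ler_wpM2l ?subr_ge0.
    lra.
  - exact: ysM.
  - by rewrite subrr normr0.
  - by rewrite addrK normrZ ger0_norm//; apply: le_lt_trans ur2; rewrite ler_piMl.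
(* The time derivative of the gradient enters here: the displacement, itself small, multiplies a
   change of gradient of order s' - s. *)
have B3 : `|\sum_i u 0 i * (U1 i s' (y s') - U1 i s (y s'))| <= d%:R * (e1 * ((s' - s) * C)).
  apply: ler_norm_sum_ord => i.
  have [r5 r5s ->] := time_increment (x := y s') (@cU1 i) ss sT
    (fun r (h : s < r < s') => @dg1 i r (y s') (le_lt_trans as_ (proj1 (andP h)))).
  apply: ler_normM; first by apply: le_trans (coord_le_norm u i) (ltW ue1).
  apply: ler_normM; first by rewrite ger0_norm.
  have /andP[sr5 r5s'] := r5s.
  by apply: HC; rewrite ?(le_trans as_ sr5) ?(le_trans r5s').
have -> : trapezoid_error y s s' =
   (U s' (y s') - U s (y s') - (\int[lebesgue_measure]_(r in `[s, s']) g r (y r))%R)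
   + (U s (y s') - U s (y s) - (\sum_i u 0 i * (U1 i s (y s) + U1 i s (y s'))) / 2)
   - (\sum_i u 0 i * (U1 i s' (y s') - U1 i s (y s'))) / 2.
  rewrite /trapezoid_error -/u.
  have -> : \sum_i u 0 i * (U1 i s (y s) + U1 i s' (y s')) =
    \sum_i u 0 i * (U1 i s (y s) + U1 i s (y s')) + \sum_i u 0 i * (U1 i s' (y s') - U1 i s (y s')).
    by rewrite -big_split; apply: eq_bigr => i _ /=; ring.
  by field.
apply: le_trans (ler_normB _ _) _; apply: le_trans (lerD (ler_normD _ _) (lexx _)) _.
have B4 : `|(\sum_i u 0 i * (U1 i s' (y s') - U1 i s (y s'))) / 2| <= d%:R * (e1 * ((s' - s) * C)) / 2.
  by rewrite normrM [X in _ * X]ger0_norm ?invr_ge0// ler_wpM2r ?invr_ge0.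
apply: le_trans (lerD (lerD B1 B2) B4) _.
have -> : e = e1 * K by rewrite /e1 divfK// gt_eqF.
have u0 : 0 <= `|u| ^+ 2 by rewrite exprn_ge0.
move: (`|u| ^+ 2) u0 => u2 u20.
have q1 := mulr_ge0 (ltW e10) u20; have q2 := mulr_ge0 (ltW e10) h0.
have q3 := mulr_ge0 (mulr_ge0 (ltW e10) h0) dC; have q4 := mulr_ge0 q1 dC.
have q5 := mulr_ge0 q2 d2.
rewrite /K; clearbody e1; lra.
Qed.
End TrapezoidRule.

(** * Limits in probability along partitions of vanishing mesh *)

Section Partitions.
Context {R : realType}.
Variables (a t : R) (l : seq R).
Hypothesis lP : itv_partition a t l.

Lemma tick0 : tick a l 0 = a. Proof. by []. Qed.

Lemma tick_last : tick a l (size l) = t.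
Proof. by case: lP => _ /eqP <-; rewrite /tick nth_last. Qed.

Lemma tick_lt i : (i < size l)%N -> tick a l i < tick a l i.+1.
Proof. by case: lP => /(pathP a) H _; exact: H. Qed.

Lemma tick_itv i : (i <= size l)%N -> a <= tick a l i <= t.
Proof.
move=> il; rewrite /tick (set_nth_default t)//.
by rewrite itv_partition_nth_ge//= itv_partition_nth_le.
Qed.

Lemma tick_telescope (V : zmodType) (f : R -> V) :
  \sum_(i < size l) (f (tick a l i.+1) - f (tick a l i)) = f t - f a.
Proof.
rewrite -{1}tick_last -[in RHS]tick0; elim: (size l) => [|n IH]; first by rewrite big_ord0 subrr.
by rewrite big_ord_recr/= IH addrC subrKA.
Qed.
End Partitions.

(** What makes mesh limits unique: without arbitrarily fine partitions such a limit would be a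
    vacuous condition. *)
Lemma fine_partition_exists {R : realType} (a t delta : R) : a <= t -> 0 < delta ->
  exists2 l, itv_partition a t l &
    forall i, (i < size l)%N -> tick a l i.+1 - tick a l i < delta.
Proof.
rewrite le_eqVlt => /predU1P[<- _|at_ d0]; first by exists [::]; rewrite /itv_partition/= ?eqxx.
have near_d : \forall m \near \oo, (t - a) / m.+1%:R < delta.
  exact: (cvgr_lt _ (@grid_mesh_cvg R a t) delta d0).
have [N _ /(_ N (leqnn N)) HN] := near_d.
exists (mkseq (fun i => grid a t N i.+1) N.+1).
  split; last by rewrite (last_nth a) size_mkseq /= (nth_mkseq _ _ (ltnSn N)) gridN.
  apply/(pathP a) => i; rewrite size_mkseq => iN; rewrite nth_mkseq//.
  case: i iN => [|i] iN; first by rewrite /= -[ltLHS](grid0 a t N); exact: grid_lt.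
  by rewrite /= (nth_mkseq _ _ (ltnW iN)); exact: grid_lt.
move=> i; rewrite size_mkseq => iN.
rewrite /tick /= nth_mkseq//; case: i iN => [|i] iN.
  by have := gridS a t N 0; rewrite grid0 => /= ->.
by rewrite /= (nth_mkseq _ _ (ltnW iN)) gridS.
Qed.

Section MeshLimits.
Context {R : realType} {dO : measure_display} {Omega : measurableType dO} (P : probability Omega R).
Variables (a t : R).

Definition fine_sequence (l : nat -> seq R) := forall n, itv_partition a t (l n) /\
  forall i, (i < size (l n))%N -> tick a (l n) i.+1 - tick a (l n) i < n.+1%:R^-1.

(** A failure of the limit would provide, for each n, a bad partition of mesh below 1/(n+1).
    Sequences are what dominated convergence applies to. *)
Lemma mesh_limit_sequential (S : seq R -> Omega -> R) I :
  (forall l, fine_sequence l -> forall eps eta : R, 0 < eps -> 0 < eta ->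
    \forall n \near \oo, (P [set o | (eps < `|S (l n) o - I o|)%R] < eta%:E)%E) ->
  mesh_limit_in_probability P a t S I.
Proof.
move=> H eps eta e0 eta0; apply: contrapT => no.
have /choice[l Hl] : forall n : nat, exists l, [/\ itv_partition a t l,
    forall i, (i < size l)%N -> tick a l i.+1 - tick a l i < n.+1%:R^-1 &
    ~ (P [set o | (eps < `|S l o - I o|)%R] < eta%:E)%E].
  move=> n; apply: contrapT => no'; apply: no; exists (n.+1%:R^-1); first by rewrite invr_gt0.
  by move=> l lP lm; apply: contrapT => lS; apply: no'; exists l; split.
have [|n _ /(_ n (leqnn n))] := H l _ eps eta e0 eta0; last by case: (Hl n).
by move=> n; case: (Hl n).
Qed.

Variables (S : seq R -> Omega -> R).
Hypothesis mS : forall l, itv_partition a t l -> measurable_fun setT (S l).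

Let measurable_far (f : Omega -> R) (e : R) : measurable_fun setT f ->
  measurable [set o | e < `|f o|].
Proof.
move=> mf; rewrite -[X in measurable X]setTI.
apply: (measurable_fun_ltr (f := fun=> e) (g := fun o => `|f o|)) => //.
exact: measurableT_comp.
Qed.

Let far_triangle (f g h : Omega -> R) (e eta : R) : measurable_fun setT g -> measurable_fun setT h ->
  measurable_fun setT f ->
  (forall o, `|f o| <= `|g o| + `|h o|) ->
  (P [set o | (e / 2 < `|g o|)%R] < (eta / 2)%:E)%E ->
  (P [set o | (e / 2 < `|h o|)%R] < (eta / 2)%:E)%E ->
  (P [set o | (e < `|f o|)%R] < eta%:E)%E.
Proof.
move=> mg mh mf fgh Pg Ph.
have mG := measurable_far (e / 2) mg; have mH := measurable_far (e / 2) mh.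
apply: (@le_lt_trans _ _ (P [set o | (e / 2 < `|g o|)%R] + P [set o | (e / 2 < `|h o|)%R])%E).
  apply: le_trans (measureU2 _ mG mH).
  apply: le_measure; rewrite ?inE; [exact: measurable_far|exact: measurableU|].
  move=> o /= eo; case: (ltP (e / 2) `|g o|) => [|ge]; first by left.
  by right; have := fgh o; lra.
by rewrite [eta]splitr EFinD lteD.
Qed.

Lemma mesh_limitB (S' : seq R -> Omega -> R) I I' : measurable_fun setT I -> measurable_fun setT I' ->
  (forall l, itv_partition a t l -> measurable_fun setT (S' l)) ->
  mesh_limit_in_probability P a t S I -> mesh_limit_in_probability P a t S' I' ->
  mesh_limit_in_probability P a t (fun l o => S l o - S' l o) (fun o => I o - I' o).
Proof.
move=> mI mI' mS' H H' e eta e0 eta0.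
have e2 : 0 < e / 2 by rewrite divr_gt0.
have eta2 : 0 < eta / 2 by rewrite divr_gt0.
have [r r0 Hr] := H _ _ e2 eta2; have [r' r0' Hr'] := H' _ _ e2 eta2.
exists (Num.min r r'); first by rewrite lt_min r0.
move=> l lP lm.
have mSI : measurable_fun setT (fun o => S l o - I o) by apply: measurable_funB => //; exact: mS.
have mSI' : measurable_fun setT (fun o => S' l o - I' o) by apply: measurable_funB => //; exact: mS'.
apply: (far_triangle (g := fun o => S l o - I o) (h := fun o => S' l o - I' o)) => //.
- by apply: measurable_funB; apply: measurable_funB => //; [exact: mS|exact: mS'].
- by move=> o; rewrite opprD addrACA -opprD; exact: ler_normB.
- by apply: Hr => // i /lm; rewrite lt_min => /andP[].
- by apply: Hr' => // i /lm; rewrite lt_min => /andP[].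
Qed.

(** Both limits are compared with the sum along one sufficiently fine partition. *)
Lemma mesh_limit_unique I I' : a <= t -> measurable_fun setT I -> measurable_fun setT I' ->
  mesh_limit_in_probability P a t S I -> mesh_limit_in_probability P a t S I' ->
  {ae P, forall o, I o = I' o}.
Proof.
move=> at_ mI mI' H H'.
have mD : measurable_fun setT (fun o => I o - I' o) by exact: measurable_funB.
have far0 e : 0 < e -> P [set o | e < `|I o - I' o|] = 0%E.
  move=> e0; apply/eqP; rewrite eq_le measure_ge0 andbT; apply/lee_addgt0Pr => eta eta0; rewrite add0e.
  have e2 : 0 < e / 2 by rewrite divr_gt0.
  have eta2 : 0 < eta / 2 by rewrite divr_gt0.
  have [r r0 Hr] := H _ _ e2 eta2; have [r' r0' Hr'] := H' _ _ e2 eta2.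
  have rr : 0 < Num.min r r' by rewrite lt_min r0.
  have [l lP lm] := fine_partition_exists at_ rr; have ml := mS lP.
  have mSI : measurable_fun setT (fun o => S l o - I o) by exact: measurable_funB.
  have mSI' : measurable_fun setT (fun o => S l o - I' o) by exact: measurable_funB.
  apply: ltW; apply: (far_triangle (g := fun o => S l o - I o) (h := fun o => S l o - I' o)) => //.
  - move=> o; rewrite (_ : I o - I' o = (S l o - I' o) - (S l o - I o)); last by ring.
    by rewrite [leRHS]addrC; exact: ler_normB.
  - by apply: Hr => // i /lm; rewrite lt_min => /andP[].
  - by apply: Hr' => // i /lm; rewrite lt_min => /andP[].
exists (\bigcup_n [set o | n.+1%:R^-1 < `|I o - I' o|]); split.
- by apply: bigcupT_measurable => n; exact: measurable_far.
- apply/measure_negligible; first by apply: bigcupT_measurable => n; exact: measurable_far.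
  apply: negligible_bigcup => n; apply/negligibleP; first exact: measurable_far.
  by apply: far0; rewrite invr_gt0.
- move=> o /= neq; have d0 : 0 < `|I o - I' o| by rewrite normr_gt0 subr_eq0; apply/eqP.
  exists (Num.truncn `|I o - I' o|^-1) => //=.
  rewrite invf_plt ?posrE//; exact: truncnS_gt.
Qed.
End MeshLimits.

Section PrepointIntegral.
Context {R : realType} {d : nat} {dO : measure_display}
        {Omega : measurableType dO} (P : probability Omega R).
Variables (a t sigma : R) (w : R -> Omega -> 'rV[R]_d) (q : 'rV[R]_d) (U g : R -> 'rV[R]_d -> R).
Local Notation Ta := (`[a, +oo[%classic : set R).
Hypothesis wW : wiener P a w.
Hypothesis at_ : a <= t.
Hypothesis rU : regular_potential a U.
Hypothesis cg : continuous_on Ta g.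
Hypothesis dg : forall s x, a < s -> is_derive s 1 (U^~ x) (g s x).

Local Notation Y := (driftless_path sigma w t q).
Local Notation gradU := (fun s => grad (U s)).

Let U1 i s := partial i (U s).
Let U2 i j s := partial j (U1 i s).
Let cU : continuous_on Ta U. Proof. by case: rU => _ []. Qed.
Let cU1 i : continuous_on Ta (U1 i). Proof. by case: rU => _ _ /(_ i) []. Qed.
Let cU2 i j : continuous_on Ta (U2 i j). Proof. by case: rU => _ _ /(_ i) [_ /(_ j) []]. Qed.

Lemma driftless_increment s s' o : Y s' o - Y s o = sigma *: (w s' o - w s o).
Proof.
rewrite /driftless_path opprB addrC addrA addrNK -scalerBr.
by congr (_ *: _); rewrite opprB addrC addrA addrNK.
Qed.

Lemma driftless_terminal o : Y t o = q.
Proof. by rewrite /driftless_path subrr scaler0 subr0. Qed.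

Lemma measurable_driftless s i : a <= s <= t -> measurable_fun setT (fun o => Y s o 0 i).
Proof.
move=> /andP[as_ st].
rewrite (_ : (fun o => _) = (fun o => q 0 i - sigma * (w t o - w s o) 0 i)).
  apply: measurable_funB => //; apply: measurable_funM => //.
  exact: (wiener_increment_measurable wW).
by apply/funext => o; rewrite !mxE.
Qed.

Lemma continuous_driftless o : {within `[a, t], continuous (Y^~ o)}.
Proof.
have cw : {within `[a, t], continuous (w^~ o)}.
  case: wW => _ /(_ o) h _; apply: continuous_subspaceW h => r /=.
  by rewrite !in_itv/= => /andP[->].
move=> s; apply: cvgB; first exact: cvg_cst.
by apply: cvgZr; apply: cvgB; [exact: cvg_cst|exact: cw].
Qed.

Let aT : `[a, t] `<=` Ta.
Proof. by move=> r /=; rewrite !in_itv/= => /andP[->]. Qed.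

Lemma measurable_field s f : a <= s <= t -> continuous_on Ta f ->
  measurable_fun setT (fun o => f s (Y s o)).
Proof.
move=> st cf; apply: measurable_continuous_coord => [|i]; last exact: measurable_driftless.
by apply: continuous_on_space cf; apply: aT; rewrite /= in_itv.
Qed.

(** The integral of the gradient along the path in the trapezoid discretization obeys the ordinary
    chain rule, so it has this closed form without a stochastic integral. *)
Definition stratonovich_integral (o : Omega) : R :=
  U t (Y t o) - U a (Y a o) - (\int[lebesgue_measure]_(r in `[a, t]) g r (Y r o))%R.

Lemma measurable_driftless_integral (f : R -> 'rV[R]_d -> R) : continuous_on Ta f ->
  measurable_fun setT (fun o => \int[lebesgue_measure]_(r in `[a, t]) f r (Y r o))%R.
Proof.
move=> cf; apply: (measurable_path_integral (k := fun r o => f r (Y r o))) => // [s /andP[as_ st]|o].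
  by apply: measurable_field => //; rewrite (ltW as_).
have := continuous_on_path aT cf (continuous_driftless (o := o)); exact.
Qed.

Lemma measurable_stratonovich : measurable_fun setT stratonovich_integral.
Proof.
apply: measurable_funB; last exact: measurable_driftless_integral.
by apply: measurable_funB; apply: measurable_field; rewrite // lexx at_.
Qed.

Let mdot s s' r : a <= s <= t -> a <= s' <= t -> a <= r <= t ->
  measurable_fun setT (fun o => dotv (Y s' o - Y s o) (grad (U r) (Y r o))).
Proof.
move=> st s't rt; apply: measurable_sum => i; apply: measurable_funM.
  rewrite (_ : (fun o => _) = (fun o => Y s' o 0 i - Y s o 0 i)).
    by apply: measurable_funB; exact: measurable_driftless.
  by apply/funext => o; rewrite !mxE.
rewrite (_ : (fun o => _) = (fun o => U1 i r (Y r o))).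
  exact: measurable_field.
by apply/funext => o; rewrite !mxE.
Qed.

Lemma measurable_prepoint_sum l : itv_partition a t l ->
  measurable_fun setT (prepoint_sum gradU Y a l).
Proof.
move=> lP; apply: measurable_sum => i; have il := ltn_ord i.
by apply: mdot; apply: (tick_itv lP) => //; exact: ltnW.
Qed.

Lemma measurable_postpoint_sum l : itv_partition a t l ->
  measurable_fun setT (postpoint_sum gradU Y a l).
Proof.
move=> lP; apply: measurable_sum => i; have il := ltn_ord i.
by apply: mdot; apply: (tick_itv lP) => //; exact: ltnW.
Qed.

Lemma trapezoid_sum l o : itv_partition a t l ->
  prepoint_sum gradU Y a l o + postpoint_sum gradU Y a l o =
  2 * (stratonovich_integral o
    - \sum_(i < size l) trapezoid_error U g U1 (Y^~ o) (tick a l i) (tick a l i.+1)).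
Proof.
move=> lP; pose G s := (\int[lebesgue_measure]_(r in `[a, s]) g r (Y r o))%R.
have cgY := continuous_on_path aT cg (continuous_driftless (o := o)).
have EG s s' : a <= s -> s <= s' -> s' <= t ->
    (\int[lebesgue_measure]_(r in `[s, s']) g r (Y r o))%R = G s' - G s.
  move=> as_ ss s't; have sub : `[a, s']%classic `<=` `[a, t]%classic.
    by move=> r /=; rewrite !in_itv/= => /andP[-> rs]; rewrite (le_trans rs).
  have ass' : a <= s <= s' by rewrite as_.
  by rewrite /G (Rintegral_split ass' (continuous_subspaceW sub cgY)) addrAC subrr add0r.
pose pre i := dotv (Y (tick a l i.+1) o - Y (tick a l i) o) (grad (U (tick a l i)) (Y (tick a l i) o)).
pose post i := dotv (Y (tick a l i.+1) o - Y (tick a l i) o)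
  (grad (U (tick a l i.+1)) (Y (tick a l i.+1) o)).
have Epre : prepoint_sum gradU Y a l o = \sum_(i < size l) pre i by apply: eq_bigr.
have Epost : postpoint_sum gradU Y a l o = \sum_(i < size l) post i by apply: eq_bigr.
pose H s := U s (Y s o) - G s.
have gE s x k : grad (U s) x 0 k = U1 k s x by rewrite mxE.
have E i : (i < size l)%N -> trapezoid_error U g U1 (Y^~ o) (tick a l i) (tick a l i.+1) =
    (H (tick a l i.+1) - H (tick a l i)) - (pre i + post i) / 2.
  move=> il; have /andP[a1 a2] := tick_itv lP (ltnW il); have /andP[a3 a4] := tick_itv lP il.
  rewrite /trapezoid_error EG// ?(ltW (tick_lt lP il))//; congr (_ - _ / 2).
    by rewrite /H !opprB addrACA [RHS]addrACA; congr (_ + _); rewrite addrC.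
  rewrite /pre /post /dotv -big_split; apply: eq_bigr => k _ /=.
  by rewrite !gE mulrDr.
have Ga : G a = 0 by rewrite /G set_itv1 Rintegral_set1.
have EV : stratonovich_integral o = H t - H a by rewrite /H Ga subr0 addrAC.
clearbody pre post H.
have -> : \sum_(i < size l) trapezoid_error U g U1 (Y^~ o) (tick a l i) (tick a l i.+1) =
    \sum_(i < size l) (H (tick a l i.+1) - H (tick a l i) - (pre i + post i) / 2).
  by apply: eq_bigr => i _; exact: E.
rewrite Epre Epost sumrB (tick_telescope lP H) -mulr_suml big_split /=.
rewrite EV; move: (H t - H a) (\sum_(i < size l) pre i) (\sum_(i < size l) post i) => h A B.
by field.
Qed.

(** Only the sum of the two discretizations is shown to converge here. Its error is small relative
    to one plus the quadratic variation, and a first moment of the latter is enough for convergence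
    in probability. *)
Lemma trapezoid_limit : mesh_limit_in_probability P a t
  (fun l o => prepoint_sum gradU Y a l o + postpoint_sum gradU Y a l o)
  (fun o => 2 * stratonovich_integral o).
Proof.
apply: mesh_limit_sequential => l fl.
have lP n : itv_partition a t (l n) by case: (fl n).
pose Q n o := \sum_(i < size (l n)) square_increment (w^~ o) (tick a (l n) i) (tick a (l n) i.+1).
have ag n i : (i <= size (l n))%N -> a <= tick a (l n) i.
  by move=> /(tick_itv (lP n)) /andP[].
have mQ n : measurable_fun setT (Q n).
  apply: measurable_sum => i; have il := ltn_ord i.
  by apply: (measurable_square_increment wW); apply: ag => //; exact: ltnW.
have Q0 n o : 0 <= Q n o by apply: sumr_ge0 => i _; exact: square_increment_ge0.
apply: (@remainder_probability_vanishes _ _ _ P (fun n o => prepoint_sum gradU Y a (l n) o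
   + postpoint_sum gradU Y a (l n) o - 2 * stratonovich_integral o) Q _ mQ Q0 _ (d%:R * (t - a))).
- move=> n; apply: measurable_funB.
    by apply: measurable_funD; [exact: measurable_prepoint_sum|exact: measurable_postpoint_sum].
  by apply: measurable_funM => //; exact: measurable_stratonovich.
- move=> o e e0.
  have /choice[g1 Hg1] : forall i, exists h, continuous_on Ta h /\
      forall s x, a < s -> is_derive s 1 ((U1 i)^~ x) (h s x).
    by move=> i; case: rU => _ _ /(_ i) [_ _ [h ch dh]]; exists h.
  (* [K] dominates both coefficients in (t - a) + sigma^2 Q, which is therefore at most K (1 +
     Q). *)
  pose K := 1 + (t - a) + sigma ^+ 2.
  have K0 : 0 < K by rewrite ltr_pwDl ?sqr_ge0// ltr_pwDl ?subr_ge0.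
  have e1 : 0 < e / (2 * K) by rewrite divr_gt0 ?mulr_gt0.
  have dU i s x : Ta s -> is_derive x (delta_mx 0 i) (U s) (U1 i s x).
    rewrite /= in_itv/= andbT => as_; apply/derivableP.
    by case: rU => _ [_ /(_ i) [+ _] _] _; apply.
  have dU1 i j s x : Ta s -> is_derive x (delta_mx 0 j) (U1 i s) (U2 i j s x).
    rewrite /= in_itv/= andbT => as_; apply/derivableP.
    by case: rU => _ _ /(_ i) [_ /(_ j) [+ _] _]; apply.
  have [r r0 Hr] := @trapezoid_path R d a t U g U1 g1 U2 cU cg cU1 (fun i => (Hg1 i).1) cU2
    dg (fun i => (Hg1 i).2) dU dU1 _ (continuous_driftless (o := o)) _ e1.
  near=> n.
  have nr : n.+1%:R^-1 < r.
    near: n; have := cvgr_lt _ (@cvg_harmonic R) r r0; exact.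
  rewrite trapezoid_sum// mulrBr addrAC subrr add0r normrN normrM ger0_norm//.
  apply: (@le_trans _ _ (2 * (e / (2 * K) * ((t - a) + sigma ^+ 2 * Q n o)))).
    rewrite ler_pM2l//; apply: le_trans (ler_norm_sum _ _ _) _.
    rewrite -(tick_telescope (lP n) id) /Q mulr_sumr -big_split /= mulr_sumr.
    apply: ler_sum => i _; have il := ltn_ord i.
    have /andP[a1 _] := tick_itv (lP n) (ltnW il); have /andP[_ a4] := tick_itv (lP n) il.
    have [_ lm] := fl n.
    apply: le_trans (Hr _ _ a1 (ltW (tick_lt (lP n) il)) a4 (lt_trans (lm i il) nr)) _.
    rewrite ler_pM2l// lerD2l driftless_increment normrZ exprMn real_normK ?num_real//.
    by rewrite ler_wpM2l ?sqr_ge0//; exact: dotv_ge_norm.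
  have -> : 2 * (e / (2 * K) * ((t - a) + sigma ^+ 2 * Q n o)) = e * (((t - a) + sigma ^+ 2 * Q n o) / K).
    by field; rewrite gt_eqF.
  rewrite ler_pM2l// ler_pdivrMr// /K.
  have := mulr_ge0 (sqr_ge0 sigma) (Q0 n o).
  have ta : 0 <= t - a by rewrite subr_ge0.
  have := mulr_ge0 ta (Q0 n o); have := Q0 n o; have := sqr_ge0 sigma; lra.
- move=> n; rewrite /Q; under eq_integral do rewrite -sumEFin.
  rewrite ge0_integral_sum//; last 2 first.
  + move=> i; apply/measurable_EFinP; have il := ltn_ord i.
    by apply: (measurable_square_increment wW); apply: ag => //; exact: ltnW.
  + by move=> i o _; rewrite lee_fin square_increment_ge0.
  rewrite (eq_bigr (fun i : 'I_(size (l n)) => (d%:R * (tick a (l n) i.+1 - tick a (l n) i))%:E)).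
    by rewrite sumEFin -mulr_sumr (tick_telescope (lP n) id).
  move=> i _; have il := ltn_ord i.
  apply: (square_increment_expectation wW); first by apply: ag; exact: ltnW.
  exact: ltW (tick_lt (lP n) il).
Unshelve. all: by end_near. Qed.
End PrepointIntegral.

(** * From the density of the path law to the pre-point weight *)

Lemma mesh_limitZ {R : realType} {dO : measure_display} {Omega : measurableType dO}
    (P : probability Omega R) (a t k : R) (S : seq R -> Omega -> R) I : 0 < k ->
  mesh_limit_in_probability P a t (fun l o => k * S l o) I ->
  mesh_limit_in_probability P a t S (fun o => I o / k).
Proof.
move=> k0 H e eta e0 eta0; have [r r0 Hr] := H (k * e) eta (mulr_gt0 k0 e0) eta0.
exists r => // l lP lm; have := Hr l lP lm.
rewrite (_ : [set o | _] = [set o | e < `|S l o - I o / k|])//.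
have E o : k * `|S l o - I o / k| = `|k * S l o - I o|.
  by rewrite -{1}(gtr0_norm k0) -normrM mulrBr mulrCA divff ?mulr1// gt_eqF.
by apply/seteqP; split=> o /=; rewrite -E ltr_pM2l.
Qed.

Lemma sqr_enorm {R : realType} {d : nat} (x : 'rV[R]_d) : enorm x ^+ 2 = dotv x x.
Proof. by rewrite /enorm sqr_sqrtr//; apply: sumr_ge0 => i _; rewrite -expr2 sqr_ge0. Qed.

Lemma sqr_enormZ {R : realType} {d : nat} (k : R) (x : 'rV[R]_d) :
  enorm (k *: x) ^+ 2 = k ^+ 2 * enorm x ^+ 2.
Proof.
rewrite !sqr_enorm /dotv mulr_sumr; apply: eq_bigr => i _; rewrite !mxE; ring.
Qed.

Lemma continuous_on_sqr_gradient {R : realType} {d : nat} (a : R) (U : R -> 'rV[R]_d -> R) :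
  regular_potential a U -> continuous_on `[a, +oo[ (fun s x => enorm (grad (U s) x) ^+ 2).
Proof.
move=> rU; rewrite (_ : (fun s x => _) = fun s x => \sum_i partial i (U s) x * partial i (U s) x).
  by apply: continuous_on_sum => i; apply: continuous_onM; case: rU => _ _ /(_ i) [].
apply/funext => s; apply/funext => x; rewrite sqr_enorm.
by apply: eq_bigr => i _; rewrite !mxE.
Qed.

(** The existence of the pre-point integral is deduced and not constructed: [J] integrates mu times
    the gradient, so J / mu is the post-point limit, and subtracting it from the trapezoid limit
    leaves the pre-point sums. *)
Lemma prepoint_from_postpoint {R : realType} {d : nat} {dO : measure_display} {Omega : measurableType dO}
    (P : probability Omega R) (a t sigma mu : R) (w : R -> Omega -> 'rV[R]_d) (q : 'rV[R]_d)
    (U g : R -> 'rV[R]_d -> R) (J : Omega -> R) :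
  wiener P a w -> a <= t -> regular_potential a U -> continuous_on `[a, +oo[ g ->
  (forall s x, a < s -> is_derive s 1 (U^~ x) (g s x)) -> 0 < mu ->
  let Y := driftless_path sigma w t q in
  is_postpoint_integral P (fun s x => mu *: grad (U s) x) Y a t J ->
  is_prepoint_integral P (fun s => grad (U s)) Y a t
    (fun o => 2 * stratonovich_integral a t sigma w q U g o - J o / mu).
Proof.
move=> wW at_ rU cg dg mu0 Y [mJ JL].
have mV : measurable_fun setT (stratonovich_integral a t sigma w q U g).
  exact: (measurable_stratonovich _ _ wW at_ rU cg).
have m2V : measurable_fun setT (fun o => 2 * stratonovich_integral a t sigma w q U g o).
  exact: measurable_funM.
have mJm : measurable_fun setT (fun o => J o / mu) by exact: measurable_funM.
split; first exact: measurable_funB.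
have JL' : mesh_limit_in_probability P a t (postpoint_sum (fun s => grad (U s)) Y a) (fun o => J o / mu).
  apply: mesh_limitZ => //; move: JL; congr (mesh_limit_in_probability P a t _ J).
  apply/funext => l; apply/funext => o; rewrite /postpoint_sum mulr_sumr; apply: eq_bigr => i _.
  by rewrite /dotv mulr_sumr; apply: eq_bigr => k _; rewrite /= [X in _ * X = _]mxE; ring.
have mpre l : itv_partition a t l -> measurable_fun setT (prepoint_sum (fun s => grad (U s)) Y a l).
  exact: (measurable_prepoint_sum sigma q wW at_ rU).
have mpost l : itv_partition a t l -> measurable_fun setT (postpoint_sum (fun s => grad (U s)) Y a l).
  exact: (measurable_postpoint_sum sigma q wW at_ rU).
have := mesh_limitB (fun l lP => measurable_funD (mpre l lP) (mpost l lP)) m2V mJm mpost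
  (trapezoid_limit sigma q wW at_ rU cg dg) JL'.
congr (mesh_limit_in_probability P a t _ _).
by apply/funext => l; apply/funext => o /=; rewrite addrK.
Qed.

Theorem mainTheorem2 (R : realType) (d : nat) (d_gt0 : (0 < d)%N)
  (mu beta t0 : R) (mu_gt0 : 0 < mu) (beta_gt0 : 0 < beta)
  (U p : R -> 'rV[R]_d -> R)
  (dO : measure_display) (Omega : measurableType dO) (P : probability Omega R)
  (w : R -> Omega -> 'rV[R]_d) :
  let sigma : R := Num.sqrt (2 * mu / beta) in
  let gradU : R -> 'rV[R]_d -> 'rV[R]_d := fun s => grad (U s) in
  let drift : R -> 'rV[R]_d -> 'rV[R]_d := fun s x => mu *: gradU s x in
  wiener P t0 w ->
  regular_potential t0 U ->
  fokker_planck_solution mu beta t0 U p ->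
  determined_by_initial_datum mu beta t0 U p ->
  probability_density (p t0) ->
  (forall (t : R) (q : 'rV[R]_d), t0 <= t ->
    exists X : R -> Omega -> 'rV[R]_d,
      [/\ well_posed_solution P drift sigma w t0 t q X,
          girsanov P drift sigma t0 t X (driftless_path sigma w t q) &
          class_D P w t0 t (work_process beta t U p X)]) ->
  forall (t : R) (q : 'rV[R]_d), t0 <= t ->
    let path : R -> Omega -> 'rV[R]_d := driftless_path sigma w t q in
    (exists I : Omega -> R, is_prepoint_integral P gradU path t0 t I) /\
    forall I : Omega -> R, is_prepoint_integral P gradU path t0 t I ->
      let weight (o : Omega) : R :=
        expR (- (beta / 2) *
          (I o + \int[lebesgue_measure]_(s in `[t0, t])
                   (mu / 2 * enorm (gradU s (path s o)) ^+ 2))) in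
      (p t q)%:E = ('E_P[(fun o => (p t0 (path t0 o) * weight o)%R)])%E.
Proof.
move=> sigma gradU drift wW rU fp _ [p0 _] HX t q t0t Y.
have [X [[sX _] [J JL XYD] DX]] := HX t q t0t.
have [g cg dg] : exists2 g, continuous_on `[t0, +oo[ g &
    forall s x, t0 < s -> is_derive s 1 (U^~ x) (g s x) by case: rU => _ [].
have IL := prepoint_from_postpoint wW t0t rU cg dg mu_gt0 JL.
split; first by eexists; exact: IL.
move=> I [mI II] weight.
have t0i : t0 <= t0 <= t by rewrite lexx.
have sub : `[t0, t] `<=` `[t0, +oo[ by move=> r /=; rewrite !in_itv/= => /andP[->].
have cN := continuous_on_sqr_gradient rU.
have cp : continuous_on `[t0, +oo[ p by case: fp => -[].
have cdrift : continuous_on `[t0, +oo[ (fun s x => enorm (drift s x) ^+ 2).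
  rewrite (_ : (fun s x => _) = (fun s x => mu ^+ 2 * enorm (grad (U s) x) ^+ 2)).
    by apply: continuous_onM => //; exact: continuous_on_cst.
  by apply/funext => s; apply/funext => x; rewrite sqr_enormZ.
have cvv := continuous_fk_value rU fp.
have ccc := continuous_discount_rate (beta := beta) cg.
pose D o := expR ((J o - (\int[lebesgue_measure]_(s in `[t0, t]) (enorm (drift s (Y s o)) ^+ 2))%R / 2)
  / sigma ^+ 2).
have [mJ _] := JL.
have mint f : continuous_on `[t0, +oo[ f ->
    measurable_fun setT (fun o => \int[lebesgue_measure]_(r in `[t0, t]) f r (Y r o))%R.
  exact: (measurable_driftless_integral sigma q wW t0t).
have mD : measurable_fun setT D.
  apply: (measurableT_comp (f := expR)); first exact: measurable_expR.
  apply: measurable_funM => //; apply: measurable_funB => //; apply: measurable_funM => //.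
  exact: (mint (fun s x => enorm (drift s x) ^+ 2)).
have mX s i : t0 <= s <= t -> measurable_fun setT (fun o => X s o 0 i).
  move=> st _ B mB; rewrite setTI; have [FX _ _] := sX.
  exact: (FX s i B st mB).1.
have mY s i := @measurable_driftless R d dO Omega P t0 t sigma w q wW t0t s i.
have cY o := @continuous_driftless R d dO Omega P t0 t sigma w q wW o.
have D0 o : 0 <= D o by exact: expR_ge0.
have [_ cX _] := sX.
have va0 x : 0 <= fk_value beta U p t0 x by rewrite mulr_ge0// expR_ge0.
have E1 := work_process_expectation mu_gt0 beta_gt0 rU fp cg dg wW sX p0 t0t DX.
have E2 := discounted_density mX mY mD D0 XYD cX cY t0t sub cvv ccc va0.
pose v := fk_value beta U p; pose cc s x := beta * g s x.
have mdY : measurable_fun setT (fun o => discounted v cc t (Y^~ o) t0).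
  apply: measurable_funM.
    by apply: (measurableT_comp (f := expR)); [exact: measurable_expR|exact: mint].
  exact: (measurable_field sigma q wW t0t t0i).
have mG : measurable_fun setT (fun o => p t0 (Y t0 o) * weight o).
  apply: measurable_funM; first exact: (measurable_field sigma q wW t0t t0i).
  apply: (measurableT_comp (f := expR)); first exact: measurable_expR.
  apply: measurable_funM => //; apply: measurable_funD => //.
  apply: (mint (fun s x => mu / 2 * enorm (gradU s x) ^+ 2)).
  by apply: continuous_onM => //; exact: continuous_on_cst.
have mpre l : itv_partition t0 t l -> measurable_fun setT (prepoint_sum gradU Y t0 l).
  exact: (measurable_prepoint_sum sigma q wW t0t rU).
have [mI' IL'] := IL.
(* The pre-point integral is determined up to a null event only, so an arbitrary version is replaced
   almost surely by the explicit one. *)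
have aeI := mesh_limit_unique mpre t0t mI mI' II IL'.
rewrite unlock.
(* The expectation along the driftless path is e^(beta U_t(q)) p_t(q); once the constant factor is
   divided out, an almost sure identity of integrands remains. *)
transitivity (\int[P]_o ((expR (- (beta * U t q)))%:E * (discounted v cc t (Y^~ o) t0 * D o)%:E))%E.
  rewrite ge0_integralZl_EFin//; last 2 first.
  - by move=> o _; rewrite lee_fin mulr_ge0// mulr_ge0// expR_ge0.
  - by apply/measurable_EFinP; exact: measurable_funM.
  have -> : (\int[P]_o (discounted v cc t (Y^~ o) t0 * D o)%:E = (fk_value beta U p t q)%:E)%E.
    exact: etrans (esym E2) E1.
  by rewrite -EFinM /fk_value mulrA -expRD addrC subrr expR0 mul1r.
apply: ae_eq_integral => //.
- by apply: emeasurable_funM => //; apply/measurable_EFinP; exact: measurable_funM.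
- exact/measurable_EFinP.
move: aeI; apply: filterS => o Io _; rewrite -EFinM; congr (_%:E).
have cgY := continuous_on_path sub cg (cY o).
have cNY := continuous_on_path sub cN (cY o).
have iN := continuous_itv_integrable cNY.
rewrite /discounted /discount /v /fk_value /D /weight Io.
have -> : (\int[lebesgue_measure]_(r in `[t0, t]) cc r (Y r o) =
    beta * \int[lebesgue_measure]_(r in `[t0, t]) g r (Y r o))%R.
  by rewrite RintegralZl//; exact: continuous_itv_integrable.
have -> : (\int[lebesgue_measure]_(s in `[t0, t]) (mu / 2 * enorm (gradU s (Y s o)) ^+ 2) =
    mu / 2 * \int[lebesgue_measure]_(s in `[t0, t]) (enorm (gradU s (Y s o)) ^+ 2))%R.
  by rewrite RintegralZl.
have -> : (\int[lebesgue_measure]_(s in `[t0, t]) (enorm (drift s (Y s o)) ^+ 2) =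
    mu ^+ 2 * \int[lebesgue_measure]_(s in `[t0, t]) (enorm (gradU s (Y s o)) ^+ 2))%R.
  by rewrite -RintegralZl//; apply: eq_Rintegral => s _; rewrite sqr_enormZ.
rewrite /stratonovich_integral driftless_terminal -/Y.
rewrite sqr_sqrtr; last by rewrite divr_ge0 ?mulr_ge0 ?ltW.
move: (\int[lebesgue_measure]_(s in `[t0, t]) (enorm (gradU s (Y s o)) ^+ 2))%R => N.
move: (\int[lebesgue_measure]_(r in `[t0, t]) g r (Y r o))%R => G.
(* With sigma^2 = 2 mu / beta, the term (beta / 2) J / mu is J / sigma^2, and -beta mu N / 4 is
   -(mu^2 N / 2) / sigma^2: together they are Girsanov's exponent. Twice the Stratonovich integral,
   multiplied by -beta / 2, gives the boundary values of U and the discount. *)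
set E := (X in _ = _ * expR X).
have -> : E = - (beta * U t q) + beta * G + beta * U t0 (Y t0 o) + (J o - mu ^+ 2 * N / 2) / (2 * mu / beta).
  by rewrite /E; field; rewrite !gt_eqF.
by rewrite !expRD; ring.
Qed.
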